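(* Let $\mathbb{K}$ be an algebraically closed field, let $n$ be an integer with $n+1>3$, and let $\mathcal{X}$ be a smooth plane curve over $\mathbb{K}$ of degree $n+1$, equipped with three points $P_1,P_2,P_3$ such that there are three distinct lines cutting out on $\mathcal{X}$ the divisors $nP_1+P_2$, $nP_2+P_3$ and $nP_3+P_1$, respectively. Let $g$ be the genus of $\mathcal{X}$. Then the set $G_0(P_1,P_2)$ of pure gaps of $\mathcal{X}$ at $(P_1,P_2)$ has cardinality $\frac{1}{3}(g-1)g$, and it consists exactly of the pairs $$(a,b)=\big((i-1)n+r+1,\ (j-1)n+i+s\big),$$ with integers $i,j\ge 1$, $i+j=d\le n-1$, $r\in\{0,\ldots,n-d-1\}$ and $s\in\{0,\ldots,n-d\}$. Moreover, for such $(a,b)$, the Riemann-Roch spaces $\mathcal{L}(aP_1+bP_2)$ and $\mathcal{L}((a-1)P_1+(b-1)P_2)$ both have dimension $\frac{1}{2}(d-1)(d-2)+i$. The same statements hold with the ordered pair $(P_1,P_2)$ replaced by $(P_2,P_3)$ and by $(P_3,P_1)$.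
   Context: For a divisor $D$ on $\mathcal{X}$, $\mathcal{L}(D)=\{f\in\mathbb{K}(\mathcal{X})^{*}:\operatorname{div}(f)\ge -D\}\cup\{0\}$ is its Riemann-Roch space. Let $\mathbb{N}_0$ be the set of nonnegative integers. For distinct points $Q_1,\ldots,Q_r\in\mathcal{X}$, an $r$-tuple $(n_1,\ldots,n_r)\in\mathbb{N}_0^r$ is a pure gap of $\mathcal{X}$ at $(Q_1,\ldots,Q_r)$ if $\mathcal{L}(\sum_{i=1}^r n_iQ_i)$ and $\mathcal{L}(\sum_{i=1}^r n_iQ_i-Q_j)$ have the same dimension for all $j=1,\ldots,r$; the set of pure gaps is denoted $G_0(Q_1,\ldots,Q_r)$. The divisor cut out on $\mathcal{X}$ by a line is the intersection divisor of the line with $\mathcal{X}$. *)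

(* Defs.v *)
From HB Require Import structures.
From mathcomp Require Import all_boot all_order all_algebra.
From mathcomp Require Import generic_quotient ring_quotient fraction.
From mathcomp.multinomials Require Import freeg mpoly.
From mathcomp Require Import boolp classical_sets cardinality.

Set Implicit Arguments.
Unset Strict Implicit.
Unset Printing Implicit Defensive.

Import GRing.Theory.
Local Open Scope ring_scope.
Local Open Scope quotient_scope.

(* A point of P^2(K) is represented by its unique vector of homogeneous
   coordinates whose first nonzero entry is 1, so that equality of points is
   Leibniz equality. *)
Definition normalized (K : fieldType) (v : 'rV[K]_3) : bool :=
  [exists i, (v 0 i == 1) && [forall j : 'I_3, (j < i)%N ==> (v 0 j == 0)]].

Definition proj_plane (K : fieldType) := {v : 'rV[K]_3 | normalized v}.

(* The value at the normalized representative; only its vanishing is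
   meaningful for a form, and only ratios of values of forms of equal degree. *)
Definition mpoly_at (K : fieldType) (F : {mpoly K[3]}) (P : proj_plane K) : K :=
  F.@[fun i => val P 0 i].

(* Lines are points of the dual plane: (a_0 : a_1 : a_2) stands for the line
   a_0 X_0 + a_1 X_1 + a_2 X_2 = 0. *)
Definition line_form (K : fieldType) (l : proj_plane K) : {mpoly K[3]} :=
  \sum_(i < 3) val l 0 i *: 'X_i.

Definition mdvd (K : fieldType) (F G : {mpoly K[3]}) : Prop :=
  exists Q, G = Q * F.

(* Curves are integral: the ideal (F) is prime.  Over an algebraically closed
   field this follows from smoothness; it is a field of the record because the
   homogeneous coordinate ring has to be a domain for the function field to be
   formed. *)
Record smooth_plane_curve (K : closedFieldType) (m : nat) := SmoothPlaneCurve {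
  curve_form : {mpoly K[3]};
  curve_homog : curve_form \is m.-homog;
  curve_neq0 : curve_form != 0;
  curve_proper : ~ mdvd curve_form 1;
  curve_prime : forall G H : {mpoly K[3]},
    mdvd curve_form (G * H) -> mdvd curve_form G \/ mdvd curve_form H;
  curve_smooth : forall P : proj_plane K,
    mpoly_at curve_form P = 0 ->
    exists i : 'I_3, mpoly_at (mderiv i curve_form) P != 0
}.

Section Curve.

Context {K : closedFieldType} {m : nat} (X : smooth_plane_curve K m).

Definition curve_point :=
  {P : proj_plane K | mpoly_at (curve_form X) P == 0}.

Definition curve_ideal : {pred {mpoly K[3]}} :=
  fun G => `[< mdvd (curve_form X) G >].

Lemma curve_idealr_closed : idealr_closed curve_ideal.
Proof.
split; first by apply/asboolP; exists 0; rewrite mul0r.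
- by apply/asboolP; apply: curve_proper.
- move=> a u v /asboolP[p ->] /asboolP[q ->].
  by apply/asboolP; exists (a * p + q); rewrite mulrDl mulrA.
Qed.

HB.instance Definition _ :=
  isIdealr.Build {mpoly K[3]} curve_ideal curve_idealr_closed.

Lemma curve_prime_idealr_closed : prime_idealr_closed curve_ideal.
Proof.
move=> u v /asboolP /(curve_prime (s := X))[h|h]; apply/orP.
- by left; apply/asboolP.
- by right; apply/asboolP.
Qed.

HB.instance Definition _ :=
  isPrimeIdealrClosed.Build {mpoly K[3]} curve_ideal curve_prime_idealr_closed.

Definition coord_ring := {ideal_quot curve_ideal}.

HB.instance Definition _ := GRing.ComNzRing.on coord_ring.
HB.instance Definition _ := Quotient.on coord_ring.

Definition coord_unit : pred coord_ring := fun x => `[< exists y, y * x = 1 >].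

Definition coord_inv (x : coord_ring) : coord_ring :=
  if pselect (exists y, y * x = 1) is left h then sval (cid h) else x.

Lemma coord_mulVx : {in coord_unit, left_inverse 1 coord_inv *%R}.
Proof.
move=> x /asboolP h; rewrite /coord_inv; case: pselect => // h'.
exact: svalP (cid h').
Qed.

Lemma coord_unitP (x y : coord_ring) : y * x = 1 -> coord_unit x.
Proof. by move=> h; apply/asboolP; exists y. Qed.

Lemma coord_invr_out : {in [predC coord_unit], coord_inv =1 id}.
Proof.
move=> x /negP h; rewrite /coord_inv; case: pselect => // h'.
by case: h; apply/asboolP.
Qed.

HB.instance Definition _ := GRing.ComNzRing_hasMulInverse.Build coord_ring
  coord_mulVx coord_unitP coord_invr_out.

HB.instance Definition _ := GRing.ComUnitRing_isIntegral.Build coord_ring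
  (@Quotient.rquot_IdomainAxiom {mpoly K[3]} curve_ideal).

(* The function field K(X) is the subfield [is_ratfun] of quotients of forms of
   equal degree inside the fraction field of the homogeneous coordinate ring. *)
Definition hom_field := {fraction coord_ring}.

Definition cls (G : {mpoly K[3]}) : hom_field := tofrac (\pi_coord_ring G : coord_ring).

Definition is_ratfun (f : hom_field) : Prop :=
  exists d (G H : {mpoly K[3]}),
    [/\ G \is d.-homog, H \is d.-homog, cls H != 0 & f = cls G / cls H].

(* The local ring O_P, its maximal ideal and its units. *)
Definition regular_at (P : curve_point) (f : hom_field) : Prop :=
  exists d (G H : {mpoly K[3]}),
    [/\ G \is d.-homog, H \is d.-homog, mpoly_at H (val P) != 0
      & f = cls G / cls H].

Definition vanishes_at (P : curve_point) (f : hom_field) : Prop :=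
  exists d (G H : {mpoly K[3]}),
    [/\ G \is d.-homog, H \is d.-homog, mpoly_at H (val P) != 0,
        mpoly_at G (val P) = 0 & f = cls G / cls H].

Definition unit_at (P : curve_point) (f : hom_field) : Prop :=
  regular_at P f /\ ~ vanishes_at P f.

Definition uniformizer (P : curve_point) (t : hom_field) : Prop :=
  vanishes_at P t /\
  forall f, vanishes_at P f -> exists2 h, regular_at P h & f = h * t.

Definition is_ord (P : curve_point) (f : hom_field) (k : int) : Prop :=
  exists t u, [/\ uniformizer P t, unit_at P u & f = u * t ^ k].

Definition divisor := {freeg curve_point / int}.

(* D is the divisor cut out on X by the form G of degree d: its multiplicity
   at P is ord_P (G / H) for any form H of degree d not vanishing at P. *)
Definition cuts_out (d : nat) (G : {mpoly K[3]}) (D : divisor) : Prop :=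
  forall (P : curve_point) (H : {mpoly K[3]}),
    H \is d.-homog -> mpoly_at H (val P) != 0 ->
    is_ord P (cls G / cls H) (coeff P D).

Definition line_cuts_out (l : proj_plane K) (D : divisor) : Prop :=
  cuts_out 1 (line_form l) D.

Definition RRspace (D : divisor) : set hom_field :=
  [set f | is_ratfun f /\
     (f = 0 \/
      forall P : curve_point, exists2 k : int, is_ord P f k & (- coeff P D <= k)%R)].

(* For a K-subspace V: V has a K-basis of k elements; K acts through the constant forms. *)
Definition has_dim (V : set hom_field) (k : nat) : Prop :=
  exists e : 'I_k -> hom_field,
    (forall i, V (e i)) /\
    forall f, V f ->
      exists! c : 'rV[K]_k, f = \sum_(i < k) cls (c 0 i)%:MP * e i.

(* Riemann's characterization: g = max_D (deg D + 1 - dim L(D)). *)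
Definition is_genus (g : nat) : Prop :=
  (forall D k, has_dim (RRspace D) k -> (deg D + 1 - k%:Z <= g%:Z)%R) /\
  exists D k, has_dim (RRspace D) k /\ deg D + 1 - k%:Z = g%:Z.

Definition sum_divisor (r : nat) (Q : r.-tuple curve_point)
    (a : r.-tuple nat) : divisor :=
  \sum_(i < r) << (tnth a i)%:Z *g tnth Q i >>.

(* Meant for pairwise distinct points [Q]. *)
Definition pure_gaps (r : nat) (Q : r.-tuple curve_point) : set (r.-tuple nat) :=
  [set a | forall j : 'I_r, exists k : nat,
     has_dim (RRspace (sum_divisor Q a)) k /\
     has_dim (RRspace (sum_divisor Q a - << tnth Q j >>)) k].

End Curve.

(* Main.v *)
(* Let x, y, z be the equations of the three lines.  They vanish only at P1, P2,
   P3, with orders (n, 0, 1), (1, n, 0) and (0, 1, n), so at each of these points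
   the monomials of degree d < n in x, y, z have pairwise distinct orders.  On a
   smooth plane curve the system cut out by all forms of degree d is complete
   (a form can be divided by the lines of a pencil one after the other), hence the
   spaces L(a P1 + b P2) with (a, b) <= (i n, i + j n), i + j < n, have bases of
   Laurent monomials x^p y^q z^r with p + q + r = 0, and their dimensions are
   counted.  For a pair (a, b) outside the list, a monomial of degree 0 has a pole
   of order exactly a at P1 or exactly b at P2.  The genus is n (n - 1) / 2: the
   divisor (n - 1) (n P1 + P2) attains this value of deg D + 1 - dim L(D), and the
   monomials regular outside of P1, together with functions having one prescribed
   pole outside of P1, show that no divisor exceeds it. *)

(* An order is only defined through a factorization by a uniformizer, so that even its existence
   needs a proof. One dimension count serves for this and for completeness: a form [G] not divisible
   by the equation [F] of the curve divides, modulo [F], some binary form with nonzero coefficients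
   in two given linear forms ([pencil_in_ideal]). If one of the two is a local parameter at [P] and
   the other does not vanish there, that binary form is a power of a uniformizer times a unit, which
   bounds the order of [G]. Over an algebraically closed field a binary form is also a product of
   lines, so a denominator can be cancelled line by line.

   The bound d < n matters because the order of a monomial at each of the three points is then, up
   to a shift, a two-digit number in base n that determines the monomial.

   The bound on the genus rests on monotonicity: adding a point raises the dimension by at most one,
   so a lower bound for the dimension at one large divisor N P1 + s gives a lower bound at every
   smaller divisor. *)
Require Import Defs.
From HB Require Import structures.
From mathcomp Require Import all_boot all_order all_algebra.
From mathcomp Require Import generic_quotient ring_quotient fraction.
From mathcomp.multinomials Require Import freeg mpoly.
From mathcomp Require Import boolp classical_sets cardinality.
From mathcomp Require Import zify ring.

Set Implicit Arguments.
Unset Strict Implicit.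
Unset Printing Implicit Defensive.

Import Order.TTheory GRing.Theory Num.Theory.
Local Open Scope ring_scope.

(** * Linear algebra *)

Section LinearAlgebra.

Context {K L : fieldType} (io : {rmorphism K -> L}).

Definition lcomb k (e : 'I_k -> L) (c : 'rV[K]_k) : L :=
  \sum_(i < k) io (c 0 i) * e i.

Definition indep k (e : 'I_k -> L) : Prop := forall c, lcomb e c = 0 -> c = 0.

Definition subspace (V : set L) : Prop :=
  V 0 /\ forall a f g, V f -> V g -> V (io a * f + g).

(** With [io] the constants of [cls] this is [has_dim] up to conversion, so results over the
    abstract field transfer directly. *)
Definition basis_dim (V : set L) k : Prop :=
  exists e : 'I_k -> L, (forall i, V (e i)) /\
    forall f, V f -> exists! c : 'rV[K]_k, f = \sum_(i < k) io (c 0 i) * e i.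

Definition has_indep (V : set L) k : Prop :=
  exists2 e : 'I_k -> L, forall i, V (e i) & indep e.

(** An upper bound on the dimension that does not presuppose a basis, so that it can be propagated
    from a space to a larger one. *)
Definition max_indep (V : set L) k : Prop := forall l, has_indep V l -> (l <= k)%N.

Lemma lcomb0 k (e : 'I_k -> L) : lcomb e 0 = 0.
Proof. by apply: big1 => i _; rewrite mxE rmorph0 mul0r. Qed.

Lemma lcombB k (e : 'I_k -> L) c d : lcomb e (c - d) = lcomb e c - lcomb e d.
Proof.
rewrite /lcomb -sumrB; apply: eq_bigr => i _.
by rewrite !mxE rmorphB mulrBl.
Qed.

Lemma lcomb_mul k l (e : 'I_k -> L) (e' : 'I_l -> L) (M : 'M[K]_(l, k)) c :
  (forall i, e' i = lcomb e (row i M)) -> lcomb e' c = lcomb e (c *m M).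
Proof.
move=> he'; rewrite /lcomb.
under eq_bigr => i _ do rewrite he' /lcomb mulr_sumr.
rewrite exchange_big; apply: eq_bigr => j _ /=.
rewrite mxE rmorph_sum mulr_suml; apply: eq_bigr => i _.
by rewrite rmorphM mxE mulrA.
Qed.

Lemma subspaceZ V a f : subspace V -> V f -> V (io a * f).
Proof. by move=> [V0 hV] Vf; rewrite -[_ * _]addr0; apply: hV. Qed.

Lemma subspace_lcomb V k (e : 'I_k -> L) c :
  subspace V -> (forall i, V (e i)) -> V (lcomb e c).
Proof.
move=> sV Ve; rewrite /lcomb; elim/big_ind: _ => [|f g Vf Vg|i _].
- by case: sV.
- by rewrite -[f]mul1r -(rmorph1 io); case: sV => _; apply.
- exact: subspaceZ.
Qed.

Lemma lcomb_rows k l (e : 'I_k -> L) (e' : 'I_l -> L) :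
  (forall i, exists c, e' i = lcomb e c) ->
  exists M : 'M[K]_(l, k), forall i, e' i = lcomb e (row i M).
Proof.
move=> h; have [c hc] := choice h.
exists (\matrix_i c i) => i.
by rewrite rowK.
Qed.

Lemma basis_dim_max V k : basis_dim V k -> max_indep V k.
Proof.
move=> [e [Ve he]] l [e' Ve' ie'].
have [|M hM] := @lcomb_rows _ _ e e'.
  by move=> i; have [c [hc _]] := he _ (Ve' i); exists c.
have fM : row_free M.
  rewrite -kermx_eq0; apply/eqP/row_matrixP => i; rewrite row0.
  apply: ie'; rewrite (lcomb_mul _ hM).
  suff -> : row i (kermx M) *m M = 0 by rewrite lcomb0.
  by rewrite -row_mul mulmx_ker row0.
by rewrite -(eqP fM) rank_leq_col.
Qed.

Lemma basis_indep V k (e : 'I_k -> L) : V 0 ->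
  (forall f, V f -> exists! c : 'rV[K]_k, f = \sum_(i < k) io (c 0 i) * e i) ->
  indep e.
Proof.
move=> V0 he c hc; have [d [_ ud]] := he _ V0.
by rewrite -(ud c) ?(ud 0) // ?hc //; apply/esym/(lcomb0 e).
Qed.

Lemma basis_dim_eq V W k : subspace V -> (V `<=` W)%classic ->
  basis_dim V k -> basis_dim W k -> W = V.
Proof.
move=> sV VW [e [Ve he]] [e' [We' he']].
apply/seteqP; split => // f Wf.
have [|M hM] := @lcomb_rows _ _ e' e.
  by move=> i; have [c [hc _]] := he' _ (VW _ (Ve i)); exists c.
have fM : row_free M.
  rewrite -kermx_eq0; apply/eqP/row_matrixP => i; rewrite row0.
  apply: (basis_indep _ he); first by case: sV.
  rewrite (lcomb_mul _ hM).
  suff -> : row i (kermx M) *m M = 0 by rewrite lcomb0.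
  by rewrite -row_mul mulmx_ker row0.
have [c [-> _]] := he' _ Wf.
rewrite -/(lcomb e' c).
(* Both dimensions are [k], so [M] is square and its free rows make it invertible; [e'] is then
   expressed through [e]. *)
have uM : M \in unitmx by rewrite -row_free_unit.
rewrite -[c](mulmxKV uM) -(lcomb_mul _ hM).
exact: subspace_lcomb.
Qed.

Lemma has_indepS (V W : set L) k g : subspace V -> (V `<=` W)%classic ->
  W g -> ~ V g -> has_indep V k -> has_indep W k.+1.
Proof.
move=> sV VW Wg nVg [e Ve ie].
exists (fun i => if unlift ord0 i is Some j then e j else g).
  by move=> i; case: unliftP => [j _|_] //; apply: VW.
move=> c; rewrite /lcomb big_ord_recl unlift_none.
under eq_bigr => i _ do rewrite liftK.
pose d : 'rV[K]_k := \row_j c 0 (fintype.lift ord0 j).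
have -> : \sum_(i < k) io (c 0 (fintype.lift ord0 i)) * e i = lcomb e d.
  by apply: eq_bigr => i _; rewrite mxE.
have [c0|c0] := eqVneq (c 0 ord0) 0.
  rewrite c0 rmorph0 mul0r add0r => /ie d0.
  apply/rowP => i; rewrite mxE; case: (unliftP ord0 i) => [j|] -> //.
  by move/rowP: d0 => /(_ j); rewrite !mxE.
move=> h; case: nVg.
have -> : g = io (- (c 0 ord0)^-1) * lcomb e d.
  have ioc0 : io (c 0 ord0) != 0 by rewrite fmorph_eq0.
  apply: (mulfI ioc0); rewrite mulrA -rmorphM mulrN mulfV // rmorphN rmorph1.
  by rewrite mulN1r; apply/eqP; rewrite -addr_eq0 h.
by apply: subspaceZ => //; apply: subspace_lcomb.
Qed.

(** The hypothesis says that [W / V] has dimension at most one. If some [e i0] lies outside [V],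
    subtracting multiples of it moves the other vectors into [V] and keeps them independent. *)
Lemma max_indepS (V W : set L) k :
  (forall f g, W f -> W g -> ~ V g -> exists c, V (f - io c * g)) ->
  max_indep V k -> max_indep W k.+1.
Proof.
move=> hVW mV [//|l] [e We ie].
have [Ve|] := pselect (forall i, V (e i)).
  by apply: leqW; apply: mV; exists e.
move=> /existsNP[i0 nVi0].
have /choice[c hc] : forall j, exists c, V (e (fintype.lift i0 j) - io c * e i0).
  by move=> j; apply: hVW.
rewrite ltnS; apply: mV.
exists (fun j => e (fintype.lift i0 j) - io (c j) * e i0) => // d hd.
pose d' : 'rV[K]_l.+1 := \row_i
  if unlift i0 i is Some j then d 0 j else - \sum_j d 0 j * c j.
have : lcomb e d' = 0.
  rewrite -[RHS]hd /lcomb (bigD1_ord i0) //= mxE unlift_none.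
  under eq_bigr => i _ do rewrite mxE liftK.
  under [RHS]eq_bigr => i _ do rewrite mulrBr mulrA -rmorphM.
  by rewrite sumrB rmorphN rmorph_sum mulNr mulr_suml addrC.
move/ie/rowP => h; apply/rowP => j.
by have := h (fintype.lift i0 j); rewrite !mxE liftK.
Qed.

Lemma has_indep_sub (V W : set L) k :
  (V `<=` W)%classic -> has_indep V k -> has_indep W k.
Proof. by move=> VW [e Ve ie]; exists e => // i; apply: VW. Qed.

Lemma basis_dimI V k (e : 'I_k -> L) : indep e -> (forall i, V (e i)) ->
  (forall f, V f -> exists c, f = lcomb e c) -> basis_dim V k.
Proof.
move=> ie Ve he; exists e; split => // f /he[c ->].
exists c; split => // d hd; apply/eqP; rewrite -subr_eq0; apply/eqP/ie.
by rewrite lcombB; apply/eqP; rewrite subr_eq0; apply/eqP.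
Qed.

Lemma sum_enum_val (T : finType) (f : T -> L) (Q : pred T) (c : T -> K) :
  (forall t, ~~ Q t -> c t = 0) ->
  \sum_t io (c t) * f t = \sum_(i < #|Q|) io (c (enum_val i)) * f (enum_val i).
Proof.
move=> cQ; rewrite (bigID Q) /= [X in _ + X]big1 => [|t /cQ ->].
  by rewrite addr0 (big_enum_val (fun t => io (c t) * f t)).
by rewrite rmorph0 mul0r.
Qed.

(** Turns a Riemann-Roch dimension into the number of monomials satisfying [Q], out of a family that
    is independent as a whole. *)
Lemma basis_fin (T : finType) (f : T -> L) (Q : pred T) (V : set L) :
  (forall c : T -> K, \sum_t io (c t) * f t = 0 -> forall t, c t = 0) ->
  (forall t, Q t -> V (f t)) ->
  (forall g, V g -> exists c : T -> K, (forall t, ~~ Q t -> c t = 0) /\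
     g = \sum_t io (c t) * f t) ->
  basis_dim V #|Q|.
Proof.
move=> ind VQ span; apply: (@basis_dimI _ _ (fun i : 'I_#|Q| => f (enum_val i))).
(* [d] extends the coefficients by zero outside [Q]. *)
- move=> c hc; pose d t := \sum_(i | enum_val i == t) c 0 i.
  have dE i : d (enum_val i) = c 0 i.
    by rewrite /d (big_pred1 i) // => j; rewrite (inj_eq enum_val_inj).
  have dQ t : ~~ Q t -> d t = 0.
    move=> nQ; apply: big1 => i /eqP it; case/negP: nQ.
    by rewrite -it; apply: (enum_valP i).
  have d0 : \sum_t io (d t) * f t = 0.
    by rewrite (sum_enum_val _ dQ) -[RHS]hc; apply: eq_bigr => i _; rewrite dE.
  by apply/rowP => i; rewrite mxE -dE ind.
- by move=> i; apply/VQ/(enum_valP i).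
move=> g /span[c [cQ ->]]; exists (\row_i c (enum_val i)).
by rewrite (sum_enum_val _ cQ); apply: eq_bigr => i _; rewrite mxE.
Qed.

End LinearAlgebra.

(** * Ternary forms *)

Section Forms.

Context {K : fieldType}.
Implicit Types (G F H A B : {mpoly K[3]}).

(** Same as [line_form], but for arbitrary coefficients: auxiliary lines need not be normalized
    points of the dual plane. *)
Definition lform (a : 'I_3 -> K) : {mpoly K[3]} := \sum_(i < 3) a i *: 'X_i.

Definition dot (a b : 'I_3 -> K) : K := \sum_i a i * b i.

Lemma lform_homog a : lform a \is 1.-homog.
Proof. by apply: rpred_sum => i _; apply: rpredZ; rewrite dhomogX /= mdeg1. Qed.

Lemma lform_at a v : (lform a).@[v] = dot a v.
Proof.
by rewrite rmorph_sum /=; apply: eq_bigr => i _; rewrite mevalZ mevalXU.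
Qed.

Lemma dhomogMX d i G : G \is d.-homog -> 'X_i * G \is d.+1.-homog.
Proof. by move=> hG; rewrite -[d.+1]add1n; apply: dhomogM => //; rewrite dhomogX /= mdeg1. Qed.

Lemma dhomog_ind (P : {mpoly K[3]} -> Prop) d :
  P 0 -> (forall a F G, P F -> P G -> P (a *: F + G)) ->
  (forall m, mdeg m = d -> P 'X_[m]) ->
  forall G, G \is d.-homog -> P G.
Proof.
move=> P0 PD PX G /dhomogP hG; rewrite [G]mpolyE big_seq.
elim/big_rec: _ => // m H mG PH; apply: PD => //.
exact/PX/hG.
Qed.

Lemma mnm_ind (P : nat -> 'X_{1..3} -> Prop) : P 0%N 0%MM ->
  (forall d i m, mdeg m = d -> P d m -> P d.+1 (U_(i) + m)%MM) ->
  forall d m, mdeg m = d -> P d m.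
Proof.
move=> P0 PS; elim=> [|d IH] m hm.
  by have /eqP -> : m == 0%MM by rewrite -mdeg_eq0 hm.
have [i mi] : exists i, m i != 0%N.
  apply/existsP; rewrite -negb_forall; apply/negP => /forallP h.
  by move: hm; rewrite mdegE big1 // => i _; apply/eqP.
have le : (U_(i) <= m)%MM by rewrite lep1mP.
rewrite -[m](submK le) addmC; have hd : mdeg (m - U_(i))%MM = d; last by apply: PS => //; apply: IH.
by have := mdegD (m - U_(i))%MM U_(i)%MM; rewrite submK // hm mdeg1 addn1 => -[].
Qed.

Lemma comp_homog (l : 3.-tuple {mpoly K[3]}) d G :
  (forall i, tnth l i \is 1.-homog) -> G \is d.-homog -> G \mPo l \is d.-homog.
Proof.
move=> hl.
apply: (@dhomog_ind (fun G => is_true (G \mPo l \is d.-homog))) => [|a A B hA hB|].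
- by rewrite comp_mpoly0 dhomog0.
- by rewrite comp_mpolyD comp_mpolyZ rpredD // rpredZ.
move: d; apply: (@mnm_ind (fun d m => is_true ('X_[m] \mPo l \is d.-homog))) => [|d i m _ IH].
  by rewrite mpolyX0 comp_mpoly1 dhomog1.
rewrite mpolyXD rmorphM /= -[d.+1]add1n comp_mpolyXU -tnth_nth.
exact: dhomogM.
Qed.

(** Telescoping: [X_k m - l_k m(l) = X_k (m - m(l)) + (X_k - l_k) m(l)]. This produces homogeneous
    cofactors, both for a line ([dvd_lform]) and for a point ([local_frame]). *)
Lemma comp_sub_ideal (l : 3.-tuple {mpoly K[3]}) d G :
  (forall i, tnth l i \is 1.-homog) -> G \is d.-homog ->
  exists2 A : 'I_3 -> {mpoly K[3]}, forall i, A i \is d.-1.-homog &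
    G - (G \mPo l) = \sum_i A i * ('X_i - tnth l i).
Proof.
move=> hl.
apply: (@dhomog_ind (fun G => exists2 A : 'I_3 -> {mpoly K[3]},
  forall i, A i \is d.-1.-homog &
  G - (G \mPo l) = \sum_i A i * ('X_i - tnth l i))) => [|a F H [A hA eA] [B hB eB]|].
- exists (fun _ => 0) => [i|]; first exact: dhomog0.
  by rewrite comp_mpoly0 subrr big1 // => i _; rewrite mul0r.
- exists (fun i => a *: A i + B i) => [i|]; first by rewrite rpredD ?rpredZ.
  under eq_bigr => i _ do rewrite mulrDl -scalerAl.
  rewrite big_split -scaler_sumr -eA -eB /= comp_mpolyD comp_mpolyZ scalerBr.
  by rewrite opprD addrACA.
(* In degree 0 the truncated [d.-1] is 0 again, and multiplying [A i] by ['X_k] would give degree 1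
   where 0 is required; the induction therefore also records that [A i = 0] there. *)
have h m : mdeg m = d -> exists2 A : 'I_3 -> {mpoly K[3]},
    forall i, A i \is d.-1.-homog /\ (d = 0%N -> A i = 0) &
    'X_[m] - ('X_[m] \mPo l) = \sum_i A i * ('X_i - tnth l i).
  move: d m {G}; apply: (@mnm_ind (fun d m => exists2 A : 'I_3 -> {mpoly K[3]},
    forall i, A i \is d.-1.-homog /\ (d = 0%N -> A i = 0) &
    'X_[m] - ('X_[m] \mPo l) = \sum_i A i * ('X_i - tnth l i))) => [|d k m hm [A hA eA]].
    exists (fun _ => 0) => [i|]; first by split=> //; apply: dhomog0.
    by rewrite mpolyX0 comp_mpoly1 subrr big1 // => i _; rewrite mul0r.
  exists (fun i => 'X_k * A i + (if i == k then 'X_[m] \mPo l else 0)) => [i|].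
    split=> //; apply: rpredD => /=.
      case: d hm hA => [|d] _ hA; last by apply: dhomogMX; case: (hA i).
      by have [_ ->] := hA i; rewrite ?mulr0 ?dhomog0.
    by case: eqP => _; rewrite ?dhomog0 // comp_homog // dhomogX /= hm.
  under eq_bigr => i _ do rewrite mulrDl -mulrA.
  rewrite big_split -mulr_sumr -eA /= (bigD1 k) //= eqxx big1 => [|i /negbTE ->]; last first.
    by rewrite mul0r.
  rewrite mpolyXD rmorphM /= comp_mpolyXU -tnth_nth.
  by ring.
by move=> m /h[A hA eA]; exists A => // i; case: (hA i).
Qed.

Lemma poly_def' (R : nzRingType) d (f : {poly R}) : (size f <= d)%N ->
  \sum_(k < d) f`_k *: 'X^k = f.
Proof.
move=> sf; rewrite -poly_def; apply/polyP => k; rewrite coef_poly.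
by case: ltnP => // dk; rewrite nth_default // (leq_trans sf).
Qed.

Section Parametrization.

Variables (p q r : 'I_3 -> K) (lam mu : 'I_3 -> K) (l : 'I_3 -> K).

(** Restriction to the line through [p] and [q], in the affine coordinate for which [q] is the point
    at infinity. *)
Definition param : {mpoly K[3]} -> {poly K} :=
  mmap polyC (fun i => (p i)%:P + q i *: 'X).

HB.instance Definition _ := GRing.RMorphism.on param.

Lemma paramZ c G : param (c *: G) = c *: param G.
Proof. by rewrite /param mmapZ mul_polyC. Qed.

Lemma param_lform a : param (lform a) = (dot a p)%:P + dot a q *: 'X.
Proof.
rewrite /lform [LHS]rmorph_sum scaler_suml (rmorph_sum polyC) -big_split.
apply: eq_bigr => i _; rewrite /= paramZ /param mmapX mmap1U.
by rewrite scalerDr scalerA polyCM mul_polyC.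
Qed.

Lemma horner_param G t : (param G).[t] = G.@[fun i => p i + t * q i].
Proof.
rewrite /param /mmap mevalE horner_sum; apply: eq_bigr => m _.
rewrite hornerM hornerC; congr (_ * _).
rewrite /mmap1 horner_prod; apply: eq_bigr => i _.
by rewrite horner_exp hornerD hornerC hornerZ hornerX mulrC [_ * q i]mulrC.
Qed.

(** The converse of the restriction [param], for linear forms [lam] and [mu] restricting to 1 and to
    the coordinate. *)
Definition homogenize d (f : {poly K}) : {mpoly K[3]} :=
  \sum_(k < d.+1) f`_k *: (lform lam ^+ (d - k) * lform mu ^+ k).

Lemma homogenize_homog d f : homogenize d f \is d.-homog.
Proof.
apply: rpred_sum => k _; apply: rpredZ.
have := dhomogM (dhomogMn (d - k) (lform_homog lam)) (dhomogMn k (lform_homog mu)).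
by rewrite !mul1n subnK // -ltnS.
Qed.

Lemma homogenize_is_linear d : linear (homogenize d).
Proof.
move=> a f g; rewrite scaler_sumr -big_split; apply: eq_bigr => k _ /=.
by rewrite coefD coefZ scalerDl scalerA.
Qed.

HB.instance Definition _ d :=
  GRing.isLinear.Build K {poly K} {mpoly K[3]} _ (homogenize d)
    (homogenize_is_linear d).

Lemma homogenizeM d a b (f : {poly K}) : (size f <= d.+1)%N ->
  homogenize d.+1 ((a%:P + b *: 'X) * f) =
  (a *: lform lam + b *: lform mu) * homogenize d f.
Proof.
move=> sf; rewrite mulrDl linearD mulrDl -!scalerAl mul_polyC !linearZ /=.
congr (_ *: _ + _ *: _); rewrite /homogenize mulr_sumr.
  rewrite big_ord_recr /= [X in _ + X](_ : _ = 0) ?addr0; last first.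
    by rewrite nth_default ?scale0r.
  apply: eq_bigr => k _; rewrite -scalerAr mulrA -exprS subSn //.
  by rewrite -ltnS.
rewrite big_ord_recl coefXM eqxx scale0r add0r; apply: eq_bigr => k _.
by rewrite coefXM /= -scalerAr mulrCA -exprS subSS.
Qed.

Hypothesis coordE : forall i,
  'X_i = p i *: lform lam + q i *: lform mu + r i *: lform l.
Hypothesis param_lam : param (lform lam) = 1.
Hypothesis param_mu : param (lform mu) = 'X.
Hypothesis param_l : param (lform l) = 0.

Lemma param_homogenize d (f : {poly K}) : (size f <= d.+1)%N -> param (homogenize d f) = f.
Proof.
move=> sf; rewrite [LHS]rmorph_sum /= -[RHS](poly_def' sf).
apply: eq_bigr => k _.
by rewrite paramZ rmorphM !rmorphXn /= param_lam param_mu expr1n mul1r.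
Qed.

Let flat : 3.-tuple {mpoly K[3]} := [tuple p i *: lform lam + q i *: lform mu | i < 3].

(** Restricting and homogenizing back amounts to composing with [flat], the projection onto the line
    along [r]. *)
Lemma homogenize_param d G : G \is d.-homog ->
  (size (param G) <= d.+1)%N /\ homogenize d (param G) = G \mPo flat.
Proof.
apply: (@dhomog_ind (fun G => (size (param G) <= d.+1)%N /\
  homogenize d (param G) = G \mPo flat)) => [|a A B [sA eA] [sB eB]|].
- by rewrite comp_mpoly0 !raddf0 size_poly0.
- rewrite rmorphD /= paramZ linearD linearZ /= comp_mpolyD comp_mpolyZ eA eB.
  split=> //; rewrite (leq_trans (size_polyD _ _)) // geq_max sB.
  by rewrite (leq_trans (size_scale_leq _ _)).
move: d; apply: (@mnm_ind (fun d m => (size (param 'X_[m]) <= d.+1)%N /\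
  homogenize d (param 'X_[m]) = 'X_[m] \mPo flat)) => [|d i m _ [sm em]].
  rewrite mpolyX0 comp_mpoly1 rmorph1 size_poly1; split=> //.
  by rewrite /homogenize big_ord1 coef1 eqxx scale1r !expr0 mulr1.
have e : param 'X_[U_(i) + m] = ((p i)%:P + q i *: 'X) * param 'X_[m].
  by rewrite mpolyXD rmorphM /= {1}/param mmapX mmap1U.
rewrite e homogenizeM // em; split; last first.
  by rewrite mpolyXD rmorphM /= comp_mpolyXU -tnth_nth tnth_mktuple.
rewrite (leq_trans (size_polyMleq _ _)) //.
have : (size ((p i)%:P + q i *: 'X)%R <= 2)%N.
  rewrite (leq_trans (size_polyD _ _)) // geq_max size_polyC.
  by rewrite (leq_trans (leq_b1 _)) // (leq_trans (size_scale_leq _ _)) // size_polyX.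
by lia.
Qed.

(** Here [G] composed with [flat] is zero, so [G] lies in the ideal of the differences
    ['X_i - flat_i], and each of these is [r i] times [lform l]. *)
Lemma dvd_lform d G : G \is d.-homog -> param G = 0 ->
  exists2 A, A \is d.-1.-homog & G = lform l * A.
Proof.
move=> hG pG; have [_] := homogenize_param hG; rewrite pG linear0 => e0.
have hflat i : tnth flat i \is 1.-homog.
  by rewrite tnth_mktuple rpredD ?rpredZ ?lform_homog.
have [A hA] := comp_sub_ideal hflat hG.
rewrite -e0 subr0 => ->; exists (\sum_i r i *: A i).
  by apply: rpred_sum => i _; apply: rpredZ; apply: hA.
rewrite mulr_sumr; apply: eq_bigr => i _.
by rewrite coordE tnth_mktuple addrAC subrr add0r -!scalerAr mulrC.
Qed.

(** The restriction has full degree exactly when the form does not vanish at the point at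
    infinity. *)
Lemma coef_param d G : G \is d.-homog -> (param G)`_d = G.@[q].
Proof.
move: G; apply: (@dhomog_ind (fun G => (param G)`_d = G.@[q])) => [|a A B hA hB|].
- by rewrite !raddf0 coef0.
- by rewrite rmorphD /= paramZ coefD coefZ hA hB mevalD mevalZ.
move: d; apply: (@mnm_ind (fun d m => (param 'X_[m])`_d = 'X_[m].@[q])) => [|d i m hm IH].
  by rewrite mpolyX0 rmorph1 meval1 coef1.
have [|sm _] := @homogenize_param d 'X_[m]; first by rewrite dhomogX /= hm.
have -> : param 'X_[U_(i) + m] = ((p i)%:P + q i *: 'X) * param 'X_[m].
  by rewrite mpolyXD rmorphM /= {1}/param mmapX mmap1U.
rewrite mulrDl mul_polyC -scalerAl coefD !coefZ coefXM /= IH.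
by rewrite nth_default // mulr0 add0r mpolyXD rmorphM /= mevalXU.
Qed.

End Parametrization.

(** The vectors [p, q, r] and the forms [lam, mu, l] are dual bases, with [p] and [q] spanning the
    line. *)
Definition line_param (p q r lam mu l : 'I_3 -> K) : Prop :=
  [/\ forall i, 'X_i = p i *: lform lam + q i *: lform mu + r i *: lform l,
      dot lam p = 1 /\ dot lam q = 0, dot mu p = 0 /\ dot mu q = 1 &
      dot l p = 0 /\ dot l q = 0].

Lemma sum_ord3 (V : nmodType) (f : 'I_3 -> V) : \sum_i f i = f 0 + f 1 + f 2%:R.
Proof.
rewrite !big_ord_recl big_ord0 addr0 addrA.
by congr (f _ + f _ + f _); apply/val_inj.
Qed.

Lemma sum_ord3_shift (V : nmodType) (k : 'I_3) (f : 'I_3 -> V) :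
  \sum_i f i = f k + f (k + 1) + f (k + 2%:R).
Proof.
by rewrite (reindex_inj (addrI k)) sum_ord3 addr0.
Qed.

Lemma lform_delta i : lform (fun j => (j == i)%:R) = 'X_i.
Proof.
rewrite /lform (bigD1 i) //= eqxx scale1r big1 ?addr0 // => j /negbTE ->.
by rewrite scale0r.
Qed.

(** Two standard basis vectors are pushed onto the line by correcting the coordinate [k], in which
    [l] is nonzero. *)
Lemma exists_line_param (l : 'I_3 -> K) k : l k != 0 ->
  exists p q r lam mu, line_param p q r lam mu l.
Proof.
move=> lk0; set i := k + 1; set j := k + 2%:R.
have [ik jk ij] : [/\ i != k, j != k & i != j].
  by rewrite /i /j; case: k {lk0 i j} => [[|[|[|//]]] ?].
pose d i : 'I_3 -> K := fun x => (x == i)%:R.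
pose p : 'I_3 -> K := fun x => d i x - l i / l k * d k x.
pose q : 'I_3 -> K := fun x => d j x - l j / l k * d k x.
exists p, q, (fun x => d k x / l k), (d i), (d j).
rewrite /line_param /dot !(sum_ord3_shift k) -/i -/j !lform_delta.
have dd x : d x x = 1 by rewrite /d eqxx.
have [dki dkj dij] : [/\ d k i = 0, d k j = 0 & d i j = 0].
  by rewrite /d (negbTE ik) (negbTE jk) eq_sym (negbTE ij).
have [dik djk dji] : [/\ d i k = 0, d j k = 0 & d j i = 0].
  by rewrite /d eq_sym (negbTE ik) eq_sym (negbTE jk) (negbTE ij).
rewrite /p /q !dd dki dkj dij dik djk dji; split.
- have hx x : x = k \/ x = i \/ x = j.
    by rewrite /i /j; case: k {lk0 i j d p q dd dki dkj dij dik djk dji ik jk ij} x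
      => [[|[|[|//]]] ?] [[|[|[|//]]] ?]; (try by left; apply/val_inj);
      (try by right; left; apply/val_inj); right; right; apply/val_inj.
  have lE : lform l = l k *: 'X_k + l i *: 'X_i + l j *: 'X_j.
    exact: sum_ord3_shift.
  move=> x; case: (hx x) => [|[|]] ->;
    rewrite ?dd ?dki ?dkj ?dij ?dik ?djk ?dji ?mulr0 ?mul0r ?subr0 ?scale0r ?addr0
      ?add0r ?scale1r // lE !scalerDr !scalerA.
  rewrite !mul1r mulVf // scale1r ![(l k)^-1 * _]mulrC !scaleNr.
  by rewrite !mulr1; set u := (l i / l k) *: _; set v := (l j / l k) *: _; ring.
- by split; ring.
- by split; ring.
- by split; field.
Qed.

End Forms.

Section ClosedForms.

Context {K : closedFieldType}.
Implicit Types (G F H A B : {mpoly K[3]}).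

(** If [f] divided by the gcd were not constant it would have a root [t]; being coprime to the
    cofactor of [g], it would divide the [h] given at [t], which does not vanish there. *)
Lemma dvdp_local (f g : {poly K}) : f != 0 ->
  (forall t, root f t -> exists2 h, ~~ root h t & f %| h * g) -> f %| g.
Proof.
move=> f0 hloc; set D := gcdp f g.
have D0 : D != 0 by rewrite gcdp_eq0 (negbTE f0).
have fE : f = f %/ D * D by rewrite divpK ?dvdp_gcdl.
have gE : g = g %/ D * D by rewrite divpK ?dvdp_gcdr.
have cop : coprimep (f %/ D) (g %/ D) by rewrite coprimep_div_gcd ?f0.
have [/eqP sE|/closed_rootP[t rt]] := boolP (size (f %/ D) == 1%N).
  rewrite fE gE dvdp_mul2r //; have : f %/ D %= 1 by rewrite -size_poly_eq1 sE.
  by move/eqp_dvdl => ->; apply: dvd1p.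
have [|h nrh] := hloc t; first by rewrite fE rootM rt.
rewrite fE gE mulrA dvdp_mul2r // Gauss_dvdpl // => /root_dvdp/(_ rt) rh.
by rewrite rh in nrh.
Qed.

(* Along the line [l = 0], parametrised so that its point at infinity is not on
   [F], divisibility modulo [l] becomes divisibility of univariate polynomials,
   which is local at the roots of the restriction of [F]. *)
Lemma dvd_mod_line (l : 'I_3 -> K) N F d G : F \is N.-homog -> G \is d.-homog ->
  (exists k, l k != 0) -> ~ mdvd (lform l) F ->
  (forall v, (exists i, v i != 0) -> F.@[v] = 0 -> (lform l).@[v] = 0 ->
     exists H A B, H.@[v] != 0 /\ H * G = lform l * A + F * B) ->
  exists A B, A \is d.-1.-homog /\ G = lform l * A + F * B.
Proof.
move=> hF hG [k lk0] nlF hloc.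
have [p' [q' [r [lam' [mu' [cE [pl ql] [pm qm] [p0 q0]]]]]]] := exists_line_param lk0.
have pF0 : param p' q' F != 0.
  apply/eqP => pF0.
  have [A _ FE] := dvd_lform cE hF pF0.
  by apply: nlF; exists A; rewrite mulrC.
(* The line is reparametrized so that [q = p' + t0 q'], a point off [F], lies at infinity; the dual
   pair becomes [lam, lam']. *)
have /closed_nonrootP[t0 nrt0] := pF0.
pose q i := p' i + t0 * q' i.
pose lam i := mu' i - t0 * lam' i.
have dotq a : dot a q = dot a p' + t0 * dot a q'.
  rewrite /dot mulr_sumr -big_split; apply: eq_bigr => i _ /=.
  by rewrite /q; ring.
have dotlam v : dot lam v = dot mu' v - t0 * dot lam' v.
  rewrite /dot mulr_sumr -sumrB; apply: eq_bigr => i _ /=.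
  by rewrite /lam; ring.
have lamE : lform lam = lform mu' - t0 *: lform lam'.
  rewrite /lform scaler_sumr -sumrB; apply: eq_bigr => i _ /=.
  by rewrite scalerA -scalerBl.
have cE' i : 'X_i = q' i *: lform lam + q i *: lform lam' + r i *: lform l.
  rewrite [LHS]cE lamE /q scalerBr scalerDl scalerA [t0 * _]mulrC.
  set u := _ *: _; set v := _ *: _; set w := (_ * _) *: _; ring.
pose phi := param q' q.
have phiE a : phi (lform a) = (dot a q')%:P + (dot a p' + t0 * dot a q') *: 'X.
  by rewrite /phi param_lform dotq.
have phl : phi (lform lam) = 1.
  by rewrite phiE !dotlam pl ql pm qm; rewrite !mulr0 subr0 !mulr1 sub0r addNr scale0r addr0.
have phm : phi (lform lam') = 'X.
  by rewrite phiE pl ql mulr0 addr0 scale1r add0r.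
have ph0 : phi (lform l) = 0.
  by rewrite phiE p0 q0 mulr0 addr0 scale0r addr0.
have Fq : F.@[q] != 0.
  by move: nrt0; rewrite /root horner_param.
(* Full degree: no zero of [F] on the line is lost at infinity, and quotients have the degree
   required for homogenizing. *)
have sF : size (phi F) = N.+1.
  have [sF _] := homogenize_param q' q lam lam' hF.
  apply/eqP; rewrite eqn_leq sF ltnNge; apply/negP => sN.
  by case/eqP: Fq; rewrite -(coef_param q' q lam lam' hF) nth_default.
have dFG : phi F %| phi G.
  apply: dvdp_local => [|t rt]; first by rewrite -size_poly_gt0 sF.
  have atE H : (phi H).[t] = H.@[fun i => q' i + t * q i] by apply: horner_param.
  have [||| H [A [B [nH e]]]] := hloc (fun i => q' i + t * q i).
  - apply/existsP; rewrite -negb_forall; apply/negP => /forallP h.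
    have : (phi (lform lam)).[t] = 0.
      by rewrite atE lform_at /dot big1 // => i _; rewrite (eqP (h i)) mulr0.
    by rewrite phl hornerC => /eqP; rewrite oner_eq0.
  - by rewrite -atE; apply/eqP.
  - by rewrite -atE ph0 horner0.
  exists (phi H); first by rewrite /root atE.
  by rewrite /phi -rmorphM e rmorphD !rmorphM /= -!/(phi _) ph0 mul0r add0r dvdp_mulr.
have [W WE] : exists W, phi G = W * phi F by apply/dvdpP.
have [sG _] := homogenize_param q' q lam lam' hG.
(* The case of a zero quotient is apart because [d - N] is truncated: only a nonzero [W] forces
   [N <= d]. *)
have [W' [hW' eW']] : exists W', F * W' \is d.-homog /\ phi W' = W.
  have [W0|W0] := eqVneq W 0.
    by exists 0; rewrite mulr0 dhomog0 W0 /phi rmorph0.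
  move: sG; rewrite -/phi WE size_mul //; last by rewrite -size_poly_gt0 sF.
  rewrite sF addnS /= => sW.
  have Wp : (0 < size W)%N by rewrite size_poly_gt0.
  exists (homogenize lam lam' (d - N) W); split; last first.
    apply: param_homogenize => //.
    by rewrite -(leq_add2r N) (leq_trans sW) // addSn ltnS; lia.
  have Nd : (N <= d)%N by rewrite -(leq_add2l (size W)) (leq_trans sW) //; lia.
  rewrite -(subnKC Nd).
  by apply: dhomogM => //; rewrite addnC addnK homogenize_homog.
have hD : G - F * W' \is d.-homog by rewrite rpredB.
have pD : phi (G - F * W') = 0.
  by rewrite /phi rmorphB rmorphM /= -!/(phi _) eW' WE mulrC subrr.
have [A hA AE] := dvd_lform cE' hD pD.
by exists A, W'; split=> //; rewrite -AE subrK.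
Qed.

End ClosedForms.

(** * Binary forms in the ideal of two plane curves *)

Section Pencil.

Context {K : fieldType}.
Implicit Types (G F H A B : {mpoly K[3]}).

(** The cofactor is replaced by its homogeneous component of degree [d - N]. *)
Lemma homog_cofactor N d F Q : F \is N.-homog -> Q * F \is d.-homog -> (N <= d)%N ->
  exists2 Q', Q' \is (d - N).-homog & Q * F = Q' * F.
Proof.
move=> hF hQF Nd; exists (pihomog mdeg (d - N) Q); first exact: pihomogP.
pose k := (mmeasure mdeg Q + d).+1.
have hk : (mmeasure mdeg Q <= k)%N by rewrite /k; lia.
have kd : (d - N < k)%N by rewrite /k; lia.
rewrite -{1}(pihomog_dE hQF) {1}(pihomog_partitionE hk).
rewrite mulr_suml raddf_sum /=.
have pE j : pihomog mdeg d (pihomog mdeg j Q * F) =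
    if j == (d - N)%N then pihomog mdeg j Q * F else 0.
  have h : pihomog mdeg j Q * F \is (j + N).-homog.
    by apply: dhomogM => //; apply: pihomogP.
  case: eqP => [jd|jd]; first by rewrite pihomog_dE // -{1}(subnK Nd) -jd.
  by apply: pihomog_ne0 h; apply/eqP; lia.
under eq_bigr => j _ do rewrite pE.
rewrite (bigD1 (Ordinal kd)) //= eqxx big1 ?addr0 // => j jd.
by case: eqP => // jd'; case/eqP: jd; apply/val_inj.
Qed.

Definition pencil_form (s w : 'I_3 -> K) m (c : 'rV[K]_m.+1) : {mpoly K[3]} :=
  \sum_(k < m.+1) c 0 k *: (lform s ^+ (m - k) * lform w ^+ k).

Lemma pencil_form_homog s w m c : @pencil_form s w m c \is m.-homog.
Proof.
apply: rpred_sum => k _; apply: rpredZ.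
have := dhomogM (dhomogMn (m - k) (lform_homog s)) (dhomogMn k (lform_homog w)).
by rewrite !mul1n subnK // -ltnS.
Qed.

Lemma pencil_form_linear s w m : linear (@pencil_form s w m).
Proof.
move=> a f g; rewrite scaler_sumr -big_split; apply: eq_bigr => k _ /=.
by rewrite !mxE scalerDl scalerA.
Qed.

HB.instance Definition _ s w m :=
  GRing.isLinear.Build K 'rV[K]_m.+1 {mpoly K[3]} _ (@pencil_form s w m)
    (@pencil_form_linear s w m).

Lemma bin2_double d : ('C(d + 2, d) * 2 = (d + 1) * (d + 2))%N.
Proof.
rewrite -bin_sub ?leq_addr // addKn.
by have := mul_bin_diag (d + 2) 1; rewrite addn2 bin1; lia.
Qed.

(** Twice the Hilbert function identity of a complete intersection of degrees [N] and [e]: the ideal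
    has codimension [N * e] in degree [d + N + e]. *)
Lemma bin_quad d N e :
  ((d + N + e + 1) * (d + N + e + 2) + (d + 1) * (d + 2) =
   (d + N + 1) * (d + N + 2) + (d + e + 1) * (d + e + 2) + 2 * (N * e))%N.
Proof. by ring. Qed.

Lemma dim_dhomog d : dim (dhomog 3 K d) = 'C(d + 2, d).
Proof. by []. Qed.

Lemma dim_pair (U V : vectType K) : dim (U * V)%type = (dim U + dim V)%N.
Proof. by []. Qed.

Lemma dim_row d : dim 'rV[K]_d = d.
Proof. exact: mul1n. Qed.

(* The forms of degree [m] modulo [(F, G)] have bounded dimension, whereas the
   binary forms in [s, w] have dimension [m + 1]. *)
Lemma pencil_in_ideal N e F G (s w : 'I_3 -> K) : F \is N.-homog -> G \is e.-homog ->
  F != 0 -> (forall B, mdvd F (B * G) -> mdvd F B) ->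
  exists m c A B, [/\ c != 0, (e <= m)%N, B \is (m - e).-homog &
    pencil_form s w (c : 'rV[K]_m.+1) = A * F + B * G].
Proof.
(* Any degree with [m + 1 > N * e] and [m >= N + e] would suit; [d = N * e] ensures both. *)
move=> hF hG F0 reg; pose d := (N * e)%N; pose m := (d + N + e)%N.
pose U := (dhomog 3 K (d + e) * (dhomog 3 K (d + N) * 'rV[K]_m.+1))%type.
have hf (u : U) : val u.1 * F + val u.2.1 * G - pencil_form s w u.2.2 \is m.-homog.
  have m1 : (d + e + N)%N = m by rewrite /m addnAC.
  have := dhomogM (dhomog_is_dhomog u.1) hF; rewrite m1 => h1.
  by rewrite rpredB ?rpredD ?pencil_form_homog // dhomogM ?dhomog_is_dhomog.
pose f (u : U) : dhomog 3 K m := DHomog (hf u).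
have lf : linear f.
  move=> a u v; apply/val_inj; rewrite /= linearP /=.
  by rewrite !mulrDl -!scalerAl !scalerDr scalerN; ring.
pose fL : {linear U -> dhomog 3 K m} :=
  HB.pack f (GRing.isLinear.Build K U (dhomog 3 K m) _ f lf).
(* If no nonzero binary form is in the ideal, the kernel of [fL] consists of syzygies of [F] and [G]
   alone, and it is too small for the dimension of [U]. *)
apply: contrapT => none.
have cker u : u \in lker (linfun fL) -> u.2.2 = 0.
  rewrite memv_ker lfunE /= => /eqP/(congr1 val) /= fu0.
  apply/eqP; apply: contrapT => /negP c0; apply: none.
  exists m, u.2.2, (val u.1), (val u.2.1); split=> //.
  - by rewrite /m leq_addl.
  - by rewrite /m addnK dhomog_is_dhomog.
  - by apply/esym/eqP; rewrite -subr_eq0 fu0.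
have hg1 (C : dhomog 3 K d) : - (val C * G) \is (d + e).-homog.
  by rewrite rpredN dhomogM // dhomog_is_dhomog.
have hg2 (C : dhomog 3 K d) : val C * F \is (d + N).-homog.
  by rewrite dhomogM // dhomog_is_dhomog.
pose g (C : dhomog 3 K d) : U := (DHomog (hg1 C), (DHomog (hg2 C), 0)).
have lg : linear g.
  move=> a u v; congr (_, (_, _)); last by rewrite /= scaler0 addr0.
    apply/val_inj => /=; rewrite mulrDl -scalerAl opprD scalerN.
    by [].
  by apply/val_inj => /=; rewrite mulrDl -scalerAl.
pose gL : {linear dhomog 3 K d -> U} :=
  HB.pack g (GRing.isLinear.Build K (dhomog 3 K d) U _ g lg).
(* By regularity every syzygy is a Koszul one, [(- C G, C F)], so the kernel has dimension at most
   that of the forms of degree [d]. *)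
have sub : (lker (linfun fL) <= limg (linfun gL))%VS.
  apply/subvP => u uk; have c0 := cker u uk.
  move: uk; rewrite memv_ker lfunE /= => /eqP/(congr1 val) /=.
  rewrite c0 linear0 subr0 => e0.
  have [Q QE] : mdvd F (val u.2.1).
    apply: reg; exists (- val u.1); rewrite mulNr.
    by apply/eqP; rewrite -addr_eq0 addrC e0.
  have [||C hC CE] := @homog_cofactor N (d + N) F Q hF.
  - by rewrite -QE dhomog_is_dhomog.
  - by rewrite leq_addl.
  rewrite addnK in hC.
  apply/memv_imgP; exists (DHomog hC); first by rewrite memvf.
  rewrite (lfunE gL) /= /g; case: u c0 e0 QE => [u1 [u2 u3]] /= -> e0 QE.
  congr (_, (_, _)); apply/val_inj => /=; last by rewrite -CE -QE.
  apply: (mulIf F0); rewrite mulNr; apply/eqP.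
  by rewrite -addr_eq0 mulrAC -CE -QE e0.
have dU : (dim U <= dim (dhomog 3 K d) + dim (dhomog 3 K m))%N.
  have := limg_ker_dim (linfun fL) fullv; rewrite capfv dimvf => <-.
  apply: leq_add; last by rewrite -dimvf dimvS ?subvf.
  rewrite (leq_trans (dimvS sub)) // -dimvf.
  by have := limg_ker_dim (linfun gL) fullv; rewrite dimvf => <-; rewrite leq_addl.
have := dU; rewrite (dim_pair (dhomog 3 K (d + e)) (dhomog 3 K (d + N) * 'rV[K]_m.+1)%type).
rewrite (dim_pair (dhomog 3 K (d + N)) 'rV[K]_m.+1) !dim_dhomog dim_row.
have := bin2_double (d + e); have := bin2_double (d + N).
have := bin2_double d; have := bin2_double m.
have := bin_quad d N e; rewrite -/d -/m.
have : (d <= m)%N by rewrite /m -addnA leq_addr.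
clearbody m d.
move: 'C(m + 2, m) 'C(d + 2, d) 'C(d + N + 2, _) 'C(d + e + 2, _) => b1 b2 b3 b4.
by clear; lia.
Qed.

End Pencil.

(** * Local rings of the curve *)

(* The function field is replaced by an abstract field [L] receiving the
   homogeneous coordinate ring: conversion in the concrete fraction field is
   intractable. *)
Section Abstract.

Context {K : closedFieldType} {m : nat} {X : smooth_plane_curve K m}.
Context {L : fieldType} (phi : {rmorphism {mpoly K[3]} -> L}).
Implicit Types (P : curve_point X) (D : divisor X).

(** This and the next definitions copy those of the curve, and become them by conversion for
    [phi := cls]. *)
Definition ratfun (f : L) : Prop :=
  exists d (G H : {mpoly K[3]}),
    [/\ G \is d.-homog, H \is d.-homog, phi H != 0 & f = phi G / phi H].

Definition regular P (f : L) : Prop :=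
  exists d (G H : {mpoly K[3]}),
    [/\ G \is d.-homog, H \is d.-homog, mpoly_at H (val P) != 0
      & f = phi G / phi H].

Definition vanishes P (f : L) : Prop :=
  exists d (G H : {mpoly K[3]}),
    [/\ G \is d.-homog, H \is d.-homog, mpoly_at H (val P) != 0,
        mpoly_at G (val P) = 0 & f = phi G / phi H].

Definition lunit P (f : L) : Prop := regular P f /\ ~ vanishes P f.

Definition uniformizing P (t : L) : Prop :=
  vanishes P t /\ forall f, vanishes P f -> exists2 h, regular P h & f = h * t.

Definition has_order P (f : L) (k : int) : Prop :=
  exists t u, [/\ uniformizing P t, lunit P u & f = u * t ^ k].

Definition cut_out (d : nat) (G : {mpoly K[3]}) D : Prop :=
  forall P (H : {mpoly K[3]}), H \is d.-homog -> mpoly_at H (val P) != 0 ->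
    has_order P (phi G / phi H) (coeff P D).

Definition RR D : set L :=
  [set f | ratfun f /\
     (f = 0 \/ forall P, exists2 k : int, has_order P f k & (- coeff P D <= k)%R)].

Definition cst (a : K) : L := phi a%:MP.
HB.instance Definition _ := GRing.RMorphism.copy cst (phi \o (@mpolyC 3 K)).

End Abstract.

Arguments regular {K m X L} phi P f.

Section LocalRings.

Context {K : closedFieldType} {m : nat} {X : smooth_plane_curve K m}.
Local Notation F := (curve_form X).
Context {L : fieldType} (phi : {rmorphism {mpoly K[3]} -> L}).
Hypothesis phi_eq0 : forall G, phi G = 0 <-> mdvd F G.
Implicit Types (G H A B : {mpoly K[3]}) (P : curve_point X).
Local Notation regular := (regular phi).
Local Notation vanishes := (vanishes phi).
Local Notation lunit := (lunit phi).
Local Notation ratfun := (ratfun phi).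
Local Notation cst := (cst phi).

Local Notation "G @@ P" := (mpoly_at G (val P)) (at level 30).

Lemma atM G H P : (G * H) @@ P = G @@ P * H @@ P.
Proof. exact: rmorphM. Qed.

Lemma atD G H P : (G + H) @@ P = G @@ P + H @@ P.
Proof. exact: rmorphD. Qed.

Lemma atB G H P : (G - H) @@ P = G @@ P - H @@ P.
Proof. exact: rmorphB. Qed.

Lemma atZ c G P : (c *: G) @@ P = c * G @@ P.
Proof. exact: mevalZ. Qed.

Lemma atX G k P : (G ^+ k) @@ P = (G @@ P) ^+ k.
Proof. exact: rmorphXn. Qed.

Lemma at_curve P : F @@ P = 0.
Proof. exact/eqP/(valP P). Qed.

Lemma at_phi G H P : phi G = phi H -> G @@ P = H @@ P.
Proof.
move=> e; have [Q QE] : mdvd F (G - H) by apply/phi_eq0; rewrite rmorphB /= e subrr.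
by apply/eqP; rewrite -subr_eq0 -atB QE atM at_curve mulr0.
Qed.

Lemma at_neq0 G P : G @@ P != 0 -> phi G != 0.
Proof.
apply: contraNN => /eqP; rewrite -(rmorph0 phi) => /(at_phi P) ->.
by rewrite /mpoly_at meval0.
Qed.

Lemma at_const c P : (c%:MP) @@ P = c.
Proof. exact: mevalC. Qed.

Lemma const_homog c : (c%:MP : {mpoly K[3]}) \is 0.-homog.
Proof. by rewrite -[c%:MP]mulr1 mul_mpolyC; apply: rpredZ; apply: dhomog1. Qed.

Lemma curve_regular G B : ~ mdvd F G -> mdvd F (B * G) -> mdvd F B.
Proof. by move=> nG /curve_prime[]. Qed.

Section AtPoint.

Variable P : curve_point X.

Lemma ratfun_regular f : regular P f -> ratfun f.
Proof.
move=> [d [G [H [hG hH H0 ->]]]]; exists d, G, H; split=> //.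
exact: at_neq0 H0.
Qed.

Lemma regularD f g : regular P f -> regular P g -> regular P (f + g).
Proof.
move=> [d [G [H [hG hH H0 ->]]]] [e [G' [H' [hG' hH' H'0 ->]]]].
exists (d + e)%N, (G * H' + H * G'), (H * H'); split.
- by rewrite rpredD // dhomogM.
- exact: dhomogM.
- by rewrite atM mulf_neq0.
- have H1 := at_neq0 H0; have H2 := at_neq0 H'0.
  by rewrite (addf_div _ _ H1 H2) !(rmorphD, rmorphM) /= [phi H * phi G']mulrC.
Qed.

Lemma regularM f g : regular P f -> regular P g -> regular P (f * g).
Proof.
move=> [d [G [H [hG hH H0 ->]]]] [e [G' [H' [hG' hH' H'0 ->]]]].
exists (d + e)%N, (G * G'), (H * H'); split; try exact: dhomogM.
  by rewrite atM mulf_neq0.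
by rewrite !rmorphM /= invfM mulrACA.
Qed.

Lemma regular_cst c : regular P (cst c).
Proof.
exists 0%N, c%:MP, 1; split; rewrite ?const_homog ?dhomog1 //.
  by rewrite /mpoly_at meval1 oner_eq0.
by rewrite rmorph1 divr1.
Qed.

Lemma regular1 : regular P 1.
Proof. by rewrite -(rmorph1 cst); apply: regular_cst. Qed.

Lemma regular0 : regular P 0.
Proof. by rewrite -(rmorph0 cst); apply: regular_cst. Qed.

Lemma regularX f k : regular P f -> regular P (f ^+ k).
Proof.
move=> rf; elim: k => [|k IH]; first exact: regular1.
by rewrite exprS; apply: regularM.
Qed.

Lemma vanishes_regular f : vanishes P f -> regular P f.
Proof. by move=> [d [G [H [*]]]]; exists d, G, H. Qed.

(** By cross-multiplication, vanishing can be tested on any representative with a denominator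
    nonzero at [P]. *)
Lemma vanishes_fracP G H : H @@ P != 0 -> vanishes P (phi G / phi H) -> G @@ P = 0.
Proof.
move=> H0 [e [G' [H' [_ _ H'0 G'0 /eqP]]]].
rewrite (eqr_div _ _ (at_neq0 H0) (at_neq0 H'0)) -!rmorphM /= => /eqP/(at_phi P).
by rewrite !atM G'0 mul0r => /eqP; rewrite mulf_eq0 (negbTE H'0) orbF => /eqP.
Qed.

Lemma vanishesM f g : regular P f -> vanishes P g -> vanishes P (f * g).
Proof.
move=> [d [G [H [hG hH H0 ->]]]] [e [G' [H' [hG' hH' H'0 G'0 ->]]]].
exists (d + e)%N, (G * G'), (H * H'); split; try exact: dhomogM.
- by rewrite atM mulf_neq0.
- by rewrite atM G'0 mulr0.
- by rewrite !rmorphM /= invfM mulrACA.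
Qed.

Lemma unitP f : lunit P f <-> exists d G H,
  [/\ G \is d.-homog, H \is d.-homog, H @@ P != 0, G @@ P != 0 & f = phi G / phi H].
Proof.
split=> [[[d [G [H [hG hH H0 fE]]]] nf]|[d [G [H [hG hH H0 G0 ->]]]]].
  exists d, G, H; split=> //; apply/eqP => G0; apply: nf.
  by exists d, G, H.
split; first by exists d, G, H.
by move/(vanishes_fracP H0)/eqP; apply/negP.
Qed.

Lemma unit_neq0 f : lunit P f -> f != 0.
Proof.
move/unitP => [d [G [H [_ _ H0 G0 ->]]]].
by rewrite mulf_eq0 invr_eq0 negb_or (at_neq0 H0) (at_neq0 G0).
Qed.

Lemma unitM f g : lunit P f -> lunit P g -> lunit P (f * g).
Proof.
move=> /unitP[d [G [H [hG hH H0 G0 ->]]]] /unitP[e [G' [H' [hG' hH' H'0 G'0 ->]]]].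
apply/unitP; exists (d + e)%N, (G * G'), (H * H'); split; try exact: dhomogM.
- by rewrite atM mulf_neq0.
- by rewrite atM mulf_neq0.
- by rewrite !rmorphM /= invfM mulrACA.
Qed.

Lemma unitV f : lunit P f -> lunit P f^-1.
Proof.
move=> /unitP[d [G [H [hG hH H0 G0 ->]]]].
by apply/unitP; exists d, H, G; split=> //; rewrite invfM invrK mulrC.
Qed.

Lemma unit_cst c : c != 0 -> lunit P (cst c).
Proof.
move=> c0; apply/unitP; exists 0%N, c%:MP, 1; split; rewrite ?const_homog ?dhomog1 //.
- by rewrite /mpoly_at meval1 oner_eq0.
- by rewrite at_const.
- by rewrite rmorph1 divr1.
Qed.

Lemma unit1 : lunit P 1.
Proof. by rewrite -(rmorph1 cst); apply: unit_cst; apply: oner_neq0. Qed.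

Lemma unitXz f k : lunit P f -> lunit P (f ^ k).
Proof.
move=> uf; have uX j : lunit P (f ^+ j).
  by elim: j => [|j IH]; [exact: unit1 | rewrite exprS; apply: unitM].
by case: k => k; [exact: uX | apply/unitV/uX].
Qed.

Lemma regular_unitV f : regular P f -> regular P f^-1 -> f != 0 -> lunit P f.
Proof.
move=> rf rf' f0; split=> // vf; have := vanishesM rf' vf.
rewrite mulVf // -(rmorph1 cst) => h; have := unit_cst (oner_neq0 K).
by case.
Qed.

(** The residue field is [K]: the constant is the value of the fraction at [P]. *)
Lemma residue f : regular P f -> exists c, vanishes P (f - cst c).
Proof.
move=> [d [G [H [hG hH H0 ->]]]]; exists (G @@ P / H @@ P).
exists d, (G - (G @@ P / H @@ P) *: H), H; split=> //.
- by rewrite rpredB // rpredZ.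
- by rewrite atB atZ divfK // subrr.
- rewrite -mul_mpolyC rmorphB (rmorphM phi) /= mulrBl -[cst _]/(phi _).
  by rewrite [X in _ = _ - X]mulfK ?(at_neq0 H0).
Qed.

End AtPoint.

End LocalRings.

Lemma ord3_shift (i j : 'I_3) : j = i \/ j = i + 1 \/ j = i + 2%:R.
Proof.
by case: i j => [[|[|[|//]]] ?] [[|[|[|//]]] ?]; (try by left; apply/val_inj);
  (try by right; left; apply/val_inj); right; right; apply/val_inj.
Qed.

(** * Points of the projective plane and values of forms *)

Section ProjectivePoints.

Context {K : fieldType}.
Implicit Types (u v : proj_plane K) (G : {mpoly K[3]}).

Lemma normalizedP v : exists i, val v 0 i = 1 /\ forall j : 'I_3, (j < i)%N -> val v 0 j = 0.
Proof.
have /existsP[i /andP[/eqP vi /forallP h]] := valP v.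
by exists i; split=> // j ji; apply/eqP; have := h j; rewrite ji.
Qed.

Lemma proportional_eq u v c : (forall i, val u 0 i = c * val v 0 i) -> u = v.
Proof.
move=> uv; have [i [ui ui0]] := normalizedP u; have [j [vj vj0]] := normalizedP v.
have c0 : c != 0.
  by apply/eqP => c0; have := uv i; rewrite c0 mul0r ui => /eqP; rewrite oner_eq0.
have ij : i = j.
  apply/val_inj; case: (ltngtP i j) => // [lij|lji].
    by have := uv i; rewrite ui (vj0 _ lij) mulr0 => /eqP; rewrite oner_eq0.
  have /eqP := uv j; rewrite (ui0 _ lji) vj mulr1 eq_sym.
  by rewrite (negbTE c0).
have c1 : c = 1 by have := uv i; rewrite ui ij vj mulr1.
apply/val_inj/rowP => k; have := uv k; rewrite c1 mul1r.
by rewrite ![val _]/(sval _).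
Qed.

Lemma exists_proportional (v : 'I_3 -> K) : (exists i, v i != 0) ->
  exists u c, c != 0 /\ forall i, v i = c * val u 0 i.
Proof.
move=> [k vk].
have [i vi imin] : exists2 i, v i != 0 & forall j : 'I_3, (j < i)%N -> v j = 0.
  case: (@arg_minnP _ k (fun i => v i != 0) val vk) => i vi imin.
  exists i => // j ji; apply/eqP; apply: contraTT ji => /imin.
  by rewrite -leqNgt.
pose w : 'rV[K]_3 := \row_j (v j / v i).
have nw : normalized w.
  apply/existsP; exists i; rewrite mxE mulfV // eqxx /=.
  by apply/forallP => j; apply/implyP => /imin vj; rewrite mxE vj mul0r.
exists (exist _ w nw), (v i); split=> // j.
by rewrite /= mxE mulrC divfK.
Qed.

Lemma form_scale d G (v w : 'I_3 -> K) c : G \is d.-homog ->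
  (forall i, v i = c * w i) -> G.@[v] = c ^+ d * G.@[w].
Proof.
move=> hG vw; move: G hG.
apply: (@dhomog_ind _ (fun G => G.@[v] = c ^+ d * G.@[w])) => [|a A B hA hB|].
- by rewrite !meval0 mulr0.
- by rewrite !mevalD !mevalZ hA hB; ring.
move: d; apply: (@mnm_ind (fun d m => ('X_[m] : {mpoly K[3]}).@[v] = c ^+ d * 'X_[m].@[w]))
  => [|d i m _ IH].
  by rewrite mpolyX0 !meval1 mul1r.
by rewrite mpolyXD !mevalM IH !mevalXU vw exprS; ring.
Qed.

(** Combined with [comp_sub_ideal], it shows that a form vanishing at [p], with [p i = 1], lies in
    the ideal of the lines ['X_j - p j 'X_i]. *)
Lemma comp_point (p : 'I_3 -> K) (i : 'I_3) d G : G \is d.-homog ->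
  G \mPo [tuple p j *: 'X_i | j < 3] = G.@[p] *: 'X_i ^+ d.
Proof.
move: G; apply: (@dhomog_ind _ (fun G =>
  G \mPo [tuple p j *: 'X_i | j < 3] = G.@[p] *: 'X_i ^+ d)) => [|a A B hA hB|].
- by rewrite comp_mpoly0 meval0 scale0r.
- by rewrite comp_mpolyD comp_mpolyZ hA hB !mevalD !mevalZ scalerDl scalerA.
move: d; apply: (@mnm_ind (fun d m =>
  ('X_[m] : {mpoly K[3]}) \mPo [tuple p j *: 'X_i | j < 3] =
  ('X_[m] : {mpoly K[3]}).@[p] *: 'X_i ^+ d)) => [|d k m _ IH].
  by rewrite mpolyX0 comp_mpoly1 meval1 scale1r.
rewrite mpolyXD rmorphM /= comp_mpolyXU -tnth_nth tnth_mktuple IH.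
by rewrite mevalM mevalXU exprS -scalerAl -scalerAr scalerA.
Qed.

End ProjectivePoints.

(** * Two lines generating the ideal of a point of the curve *)

Section Frame.

Context {K : closedFieldType} {m : nat} {X : smooth_plane_curve K m}.
Hypothesis m_gt1 : (1 < m)%N.
Local Notation F := (curve_form X).
Implicit Types (G H A B : {mpoly K[3]}) (P : curve_point X).
Local Notation "G @@ P" := (mpoly_at G (val P)) (at level 30).

Lemma mdvd_degree d G : G \is d.-homog -> G != 0 -> mdvd F G -> (m <= d)%N.
Proof.
move=> hG G0 [Q QE].
have Q0 : Q != 0 by apply: contraNneq G0 => Q0; rewrite QE Q0 mul0r.
have F0 := curve_neq0 X.
rewrite (dhomog_uniq G0 hG (dhomog_msize hG)).
rewrite (dhomog_uniq F0 (curve_homog X) (dhomog_msize (curve_homog X))).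
rewrite QE; change ((msize F).-1 <= (msize (Q * F)).-1)%N.
rewrite msizeM //; have : (0 < msize Q)%N by rewrite lt0n msize_poly_eq0.
by case: (msize Q) => // q _; rewrite addSn /= -!subn1 leq_sub2r // leq_addl.
Qed.

Lemma lform_neq0 (a : 'I_3 -> K) : (exists k, a k != 0) -> lform a != 0.
Proof.
move=> [k ak]; apply: contraNneq ak => e.
have := congr1 (mcoeff U_(k)%MM) e.
rewrite mcoeff0 /lform raddf_sum /= (bigD1 k) //= big1 => [|j /negbTE jk].
  by rewrite mcoeffZ mcoeffXU eqxx mulr1 addr0 => ->.
by rewrite mcoeffZ mcoeffXU jk mulr0.
Qed.

Lemma curve_ndvd_lform (a : 'I_3 -> K) : (exists k, a k != 0) -> ~ mdvd F (lform a).
Proof.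
move=> /lform_neq0 a0 /(mdvd_degree (lform_homog a) a0).
by rewrite leqNgt m_gt1.
Qed.

(** By primality [F] would divide the line or the cofactor, both of smaller degree. *)
Lemma lform_ndvd_curve (a : 'I_3 -> K) : (exists k, a k != 0) -> ~ mdvd (lform a) F.
Proof.
move=> ak [Q QE].
have hQ : Q * lform a \is m.-homog by rewrite -QE curve_homog.
have [|Q' hQ' QE'] := homog_cofactor (lform_homog a) hQ; first exact: ltnW.
have Q'0 : Q' != 0.
  by apply: contraNneq (curve_neq0 X) => Q0; rewrite QE QE' Q0 mul0r.
have [] : mdvd F Q' \/ mdvd F (lform a).
  by apply: curve_prime; rewrite -QE' -QE; exists 1; rewrite mul1r.
  by move/(mdvd_degree hQ' Q'0); lia.
exact: curve_ndvd_lform.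
Qed.

(** On the curve [A a = - B b], and [A] is invertible at [P]: so [lform b] alone generates the
    maximal ideal, that is, it is transverse to the curve at [P]. The last clause keeps [P] as the
    only common zero of [a] and [b], which [simple_pole] exploits. *)
Lemma local_frame P : exists i (a b : 'I_3 -> K) A B,
  [/\ 'X_i @@ P = 1, lform a @@ P = 0, lform b @@ P = 0,
      exists k, b k != 0 & A @@ P != 0] /\
  [/\ A \is m.-1.-homog, B \is m.-1.-homog, F = A * lform a + B * lform b,
      forall d G, G \is d.-homog -> G @@ P = 0 -> exists C D,
        [/\ C \is d.-1.-homog, D \is d.-1.-homog & G = C * lform a + D * lform b] &
      forall Q : proj_plane K, mpoly_at (lform a) Q = 0 -> mpoly_at (lform b) Q = 0 ->
        Q = val P].
Proof.
pose p i := val (val P) 0 i.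
have [i [pi pi0]] := normalizedP (val P).
(* These are lines through [P]; the one of index [i] is zero, and the other two form the frame, in
   the order that smoothness dictates. *)
pose t j : 'I_3 -> K := fun x => (x == j)%:R - p j * (x == i)%:R.
have tE j : lform (t j) = 'X_j - p j *: 'X_i.
  rewrite -[in RHS](lform_delta j) -[in RHS](lform_delta i) /lform scaler_sumr -sumrB.
  by apply: eq_bigr => x _; rewrite /t scalerBl scalerA.
have dec d G : G \is d.-homog -> G @@ P = 0 -> exists2 A : 'I_3 -> {mpoly K[3]},
    forall j, A j \is d.-1.-homog & G = \sum_j A j * lform (t j).
  move=> hG GP.
  have hl j : tnth [tuple p j *: 'X_i | j < 3] j \is 1.-homog.
    by rewrite tnth_mktuple rpredZ // dhomogX /= mdeg1.
  have [A hA AE] := comp_sub_ideal hl hG; exists A => //.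
  move: AE; rewrite (comp_point p i hG) [_.@[p]]GP scale0r subr0 => ->.
  by apply: eq_bigr => j _; rewrite tnth_mktuple tE.
have tP j : lform (t j) @@ P = 0.
  by rewrite tE /mpoly_at mevalB mevalZ !mevalXU pi mulr1 subrr.
have ti0 : lform (t i) = 0 by rewrite tE /p pi scale1r subrr.
have hQ (Q : proj_plane K) : mpoly_at (lform (t (i + 1))) Q = 0 ->
    mpoly_at (lform (t (i + 2%:R))) Q = 0 -> Q = val P.
  move=> h1 h2; apply: (@proportional_eq _ _ _ (val Q 0 i)) => j.
  have hj k : mpoly_at (lform (t k)) Q = 0 -> val Q 0 k = val Q 0 i * p k.
    rewrite tE /mpoly_at mevalB mevalZ !mevalXU => /eqP.
    by rewrite subr_eq0 mulrC => /eqP.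
  have [->|[->|->]] := ord3_shift i j; [|exact: hj|exact: hj].
  by rewrite [val (val P) 0 i]pi mulr1.
have [A hA AE] := dec _ _ (curve_homog X) (at_curve P).
have frame j j' : (forall (V : nmodType) (f : 'I_3 -> V), \sum_i f i = f i + f j + f j') ->
    A j @@ P != 0 -> j' != i -> (forall (Q : proj_plane K), mpoly_at (lform (t j)) Q = 0 ->
    mpoly_at (lform (t j')) Q = 0 -> Q = val P) -> exists i (a b : 'I_3 -> K) A B,
  [/\ 'X_i @@ P = 1, lform a @@ P = 0, lform b @@ P = 0,
      exists k, b k != 0 & A @@ P != 0] /\
  [/\ A \is m.-1.-homog, B \is m.-1.-homog, F = A * lform a + B * lform b,
      forall d G, G \is d.-homog -> G @@ P = 0 -> exists C D,
        [/\ C \is d.-1.-homog, D \is d.-1.-homog & G = C * lform a + D * lform b] &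
      forall Q : proj_plane K, mpoly_at (lform a) Q = 0 -> mpoly_at (lform b) Q = 0 ->
        Q = val P].
  move=> sumE Aj j'i QP; exists i, (t j), (t j'), (A j), (A j'); split; split=> //.
  - by rewrite /mpoly_at mevalXU.
  - by exists j'; rewrite /t eqxx (negbTE j'i) mulr0 subr0 oner_eq0.
  - by rewrite AE sumE ti0 mulr0 add0r.
  - move=> d G hG /(dec _ _ hG)[C hC CE]; exists (C j), (C j'); split=> //.
    by rewrite CE sumE ti0 mulr0 add0r.
have [i1 i2] : i + 1 != i /\ i + 2%:R != i.
  by case: i {t tE pi pi0 dec tP ti0 hQ AE frame} => [[|[|[|//]]] ?].
have sumE := @sum_ord3_shift _ i.
have [A1|A1] := eqVneq (A (i + 1) @@ P) 0; last first.
  by apply: (frame (i + 1) (i + 2%:R)) => //; move=> V f; apply: sum_ord3_shift.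
have [A2|A2] := eqVneq (A (i + 2%:R) @@ P) 0; last first.
  apply: (frame (i + 2%:R) (i + 1)) => //; last by move=> Q h1 h2; apply: hQ.
  by move=> V f; rewrite (sum_ord3_shift i) addrAC.
(* If both cofactors vanished at [P], Leibniz's rule would make all derivatives of [F] vanish
   there. *)
have [k] := curve_smooth (at_curve P); case/negP; apply/eqP.
rewrite (congr1 (mderiv k) AE) (sum_ord3_shift i) ti0 mulr0 add0r mderivD !mderivM
  /mpoly_at !mevalD !mevalM.
have := tP (i + 1); have := tP (i + 2%:R); rewrite /mpoly_at => -> ->.
by move: A1 A2; rewrite /mpoly_at => -> ->; rewrite !mulr0 !mul0r !addr0.
Qed.

End Frame.

(** * Existence and uniqueness of orders *)

Section Orders.

Context {K : closedFieldType} {m : nat} {X : smooth_plane_curve K m}.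
Hypothesis m_gt1 : (1 < m)%N.
Local Notation F := (curve_form X).
Context {L : fieldType} (phi : {rmorphism {mpoly K[3]} -> L}).
Hypothesis phi_eq0 : forall G, phi G = 0 <-> mdvd F G.
Implicit Types (G H A B : {mpoly K[3]}) (P : curve_point X) (f g t u : L).
Local Notation regular := (regular phi).
Local Notation vanishes := (vanishes phi).
Local Notation lunit := (lunit phi).
Local Notation ratfun := (ratfun phi).
Local Notation cst := (cst phi).
Local Notation uniformizing := (uniformizing phi).
Local Notation has_order := (has_order phi).
Local Notation "G @@ P" := (mpoly_at G (val P)) (at level 30).
Local Notation at_neq0 := (at_neq0 phi_eq0).

Lemma phi_curve : phi F = 0.
Proof. by apply/phi_eq0; exists 1; rewrite mul1r. Qed.

Lemma phi_lform_neq0 (a : 'I_3 -> K) : (exists k, a k != 0) -> phi (lform a) != 0.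
Proof.
by move=> /(curve_ndvd_lform m_gt1 (X := X)) h; apply/eqP => /phi_eq0.
Qed.

Lemma div_eq_mul (a b c d e s : L) : b != 0 -> c != 0 -> s != 0 ->
  c * a * s = d * e -> a / b = d / (c * b) * (e / s).
Proof. move=> b0 c0 s0 h; rewrite mulf_div; apply/eqP.
by rewrite eqr_div ?mulf_neq0 // -h; apply/eqP; ring.
Qed.

(** If ['X_i G = C a + D b], multiplying by [A] and using [A a = - B b] gives
    [A 'X_i G = (D A - C B) b] on the curve. *)
Lemma frame_uniformizing P i (a b : 'I_3 -> K) A B :
  'X_i @@ P = 1 -> lform b @@ P = 0 -> A @@ P != 0 ->
  A \is m.-1.-homog -> B \is m.-1.-homog -> F = A * lform a + B * lform b ->
  (forall d G, G \is d.-homog -> G @@ P = 0 -> exists C D,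
    [/\ C \is d.-1.-homog, D \is d.-1.-homog & G = C * lform a + D * lform b]) ->
  uniformizing P (phi (lform b) / phi 'X_i).
Proof.
move=> iP bP AP hA hB FE dec.
have iP0 : 'X_i @@ P != 0 by rewrite iP oner_eq0.
split.
  exists 1%N, (lform b), 'X_i; split=> //; first exact: lform_homog.
  by rewrite dhomogX /= mdeg1.
move=> f [d [G [H [hG hH H0 G0 ->]]]].
have hGi : 'X_i * G \is d.+1.-homog by apply: dhomogMX.
have [|C [D [hC hD E]]] := dec _ _ hGi; first by rewrite atM G0 mulr0.
exists (phi (D * A - C * B) / phi (A * H)).
  exists (d + m.-1)%N, (D * A - C * B), (A * H); split=> //.
  - by rewrite rpredB // dhomogM.
  - by rewrite addnC dhomogM.
  - by rewrite atM mulf_neq0.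
rewrite rmorphM; apply: div_eq_mul; try exact: at_neq0 => //.
- exact: at_neq0 H0.
- exact: at_neq0 AP.
- exact: at_neq0 iP0.
rewrite -!rmorphM; apply/eqP; rewrite -subr_eq0 -rmorphB; apply/eqP/phi_eq0.
exists C; rewrite FE.
have -> : A * G * 'X_i = A * (C * lform a + D * lform b) by rewrite -E; ring.
by ring.
Qed.

Lemma exists_uniformizing P : exists2 w, uniformizing P w & w != 0.
Proof.
have [i [a [b [A [B [[iP aP bP bk AP] [hA hB FE dec QP]]]]]]] := local_frame P.
exists (phi (lform b) / phi 'X_i).
  exact: frame_uniformizing iP bP AP hA hB FE dec.
have iP0 : 'X_i @@ P != 0 by rewrite iP oner_eq0.
by rewrite mulf_neq0 ?invr_eq0 ?(at_neq0 iP0) ?phi_lform_neq0.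
Qed.

Lemma uniformizing_neq0 P t : uniformizing P t -> t != 0.
Proof.
move=> [vt ut]; have [w [vw _] w0] := exists_uniformizing P.
by have [h _ wE] := ut _ vw; apply: contraNneq w0 => t0; rewrite wE t0 mulr0.
Qed.

Lemma lunit_regular P u : lunit P u -> regular P u. Proof. by case. Qed.

Lemma lunit_neq0 P u : lunit P u -> u != 0.
Proof. exact: unit_neq0. Qed.

Lemma lunit_not_vanishes P u : lunit P u -> ~ vanishes P u. Proof. by case. Qed.

Lemma uniformizing_ratio P t w : uniformizing P t -> uniformizing P w ->
  exists2 u, lunit P u & t = u * w.
Proof.
move=> ut uw; have [h rh tE] := uw.2 _ ut.1; have [h' rh' wE] := ut.2 _ uw.1.
have t0 := uniformizing_neq0 ut; have w0 := uniformizing_neq0 uw.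
have hh : h' * h = 1 by apply: (mulIf w0); rewrite -mulrA -tE -wE mul1r.
have h0 : h != 0 by apply: contraNneq t0 => h0; rewrite tE h0 mul0r.
exists h => //; apply: (regular_unitV phi_eq0) => //.
by rewrite -[_^-1]mul1r -hh mulfK.
Qed.

(** Two uniformizers differ by a unit, so an order can be read in any of them. *)
Lemma orderP P w f k : uniformizing P w -> has_order P f k ->
  exists2 u, lunit P u & f = u * w ^ k.
Proof.
move=> uw [t [u [ut uu ->]]]; have [v uv ->] := uniformizing_ratio ut uw.
exists (u * v ^ k); last by rewrite expfzMl mulrA.
by apply: unitM => //; apply: unitXz.
Qed.

Lemma order_neq0 P f k : has_order P f k -> f != 0.
Proof.
move=> [t [u [ut uu ->]]]; rewrite mulf_neq0 ?(lunit_neq0 uu) //.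
by rewrite expfz_neq0 // (uniformizing_neq0 ut).
Qed.

Lemma orderM P f g k l : has_order P f k -> has_order P g l -> has_order P (f * g) (k + l).
Proof.
move=> [t [u [ut uu ->]]] /(orderP ut)[v uv ->].
exists t, (u * v); split=> //; first exact: unitM.
by rewrite expfzDr ?(uniformizing_neq0 ut) // mulrACA.
Qed.

Lemma orderV P f k : has_order P f k -> has_order P f^-1 (- k).
Proof.
move=> [t [u [ut uu ->]]]; exists t, u^-1; split=> //; first exact: unitV.
by rewrite invfM invr_expz.
Qed.

Lemma lunit_order P u : lunit P u -> has_order P u 0.
Proof.
move=> uu; have [w uw _] := exists_uniformizing P.
by exists w, u; split=> //; rewrite expr0z mulr1.
Qed.

Lemma order_cst P c : c != 0 -> has_order P (cst c) 0.
Proof. by move=> c0; apply/lunit_order/(unit_cst phi_eq0). Qed.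

Lemma order1 P : has_order P 1 0.
Proof. by apply/lunit_order/(unit1 phi_eq0). Qed.

Lemma orderXz P f k l : has_order P f k -> has_order P (f ^ l) (k * l).
Proof.
move=> ok; have oX j : has_order P (f ^+ j) (k * j%:Z).
  elim: j => [|j IH]; first by rewrite mulr0; apply: order1.
  by rewrite exprS intS mulrDr mulr1; apply: orderM.
by case: l => l; [exact: oX | rewrite NegzE mulrN; apply/orderV/oX].
Qed.

Lemma vanishesXz P t k : uniformizing P t -> 0 < k -> vanishes P (t ^ k).
Proof.
move=> ut; case: k => // -[//|k] _; rewrite -exprnP exprS mulrC.
by apply: vanishesM ut.1; apply: regularX; apply: vanishes_regular; apply: ut.1.
Qed.

Lemma order_le P f k l : has_order P f k -> has_order P f l -> k <= l.
Proof.
move=> [t [u [ut uu ->]]] /(orderP ut)[v uv e]; rewrite leNgt; apply/negP => lk.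
have t0 := uniformizing_neq0 ut.
apply: (lunit_not_vanishes uv).
have -> : v = u * t ^ (k - l).
  by apply: (mulIf (expfz_neq0 l t0)); rewrite -mulrA -expfzDr // subrK -e.
apply: vanishesM (lunit_regular uu) _.
by apply: vanishesXz => //; rewrite subr_gt0.
Qed.

Lemma order_uniq P f k l : has_order P f k -> has_order P f l -> k = l.
Proof. by move=> fk fl; apply/le_anti; rewrite !(@order_le P f). Qed.

(** Factors [w] are removed from [g] while it vanishes; since [g] divides a unit times [w ^+ k],
    this stops after at most [k] steps. *)
Lemma strip_order P w k g g' u : uniformizing P w -> regular P g -> regular P g' ->
  lunit P u -> g * g' = u * w ^+ k -> exists j, has_order P g j.
Proof.
move=> uw; have w0 := uniformizing_neq0 uw.
elim: k g => [|k IH] g rg rg' uu gg'.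
  exists 0; apply: lunit_order; split=> // vg; apply: (lunit_not_vanishes uu).
  by move: gg'; rewrite expr0 mulr1 => <-; rewrite mulrC; apply: vanishesM.
have [vg|nvg] := pselect (vanishes P g); last by exists 0; apply: lunit_order.
have [h rh gE] := uw.2 _ vg.
have [j oh] : exists j, has_order P h j.
  apply: (IH h) => //; apply: (mulIf w0).
  by rewrite mulrAC -gE gg' exprSr mulrA.
exists (j + 1); rewrite gE; apply: orderM => //.
by exists w, 1; split=> //; [exact: (unit1 phi_eq0) | rewrite mul1r expr1z].
Qed.

(** The lowest power of [lform b] is extracted; what remains is congruent modulo [lform b] to a
    nonzero multiple of a power of [lform s], hence is nonzero where [b] vanishes and [s] does
    not. *)
Lemma pencil_factor (s b : 'I_3 -> K) e (c : 'rV[K]_e.+1) : c != 0 ->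
  exists k a H R, [/\ (k <= e)%N, a != 0, H \is (e - k).-homog,
    pencil_form s b c = lform b ^+ k * H &
    H = a *: lform s ^+ (e - k) + lform b * R].
Proof.
move=> c0; have [j cj] : exists j, c 0 j != 0.
  apply/existsP; rewrite -negb_forall; apply: contraNN c0 => /forallP h.
  by apply/eqP/rowP => j; rewrite mxE; apply/eqP.
have [k ck kmin] : exists2 k, c 0 k != 0 & forall j : 'I_e.+1, (j < k)%N -> c 0 j = 0.
  case: (@arg_minnP _ j (fun i => c 0 i != 0) val cj) => k ck kmin.
  exists k => // i ik; apply/eqP; apply: contraTT ik => /kmin.
  by rewrite -leqNgt.
pose H := \sum_(j < e.+1 | (k <= j)%N) c 0 j *: (lform s ^+ (e - j) * lform b ^+ (j - k)).
exists k, (c 0 k), H, (\sum_(j < e.+1 | (k <= j)%N && (j != k))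
  c 0 j *: (lform s ^+ (e - j) * lform b ^+ (j - k).-1)).
split=> //; first by rewrite -ltnS.
- apply: rpred_sum => i ki; apply: rpredZ.
  have := dhomogM (dhomogMn (e - i) (lform_homog s)) (dhomogMn (i - k) (lform_homog b)).
  rewrite !mul1n (_ : (e - i + (i - k))%N = (e - k)%N) //.
  by move: (ltn_ord i); lia.
- rewrite /pencil_form (bigID (fun j : 'I_e.+1 => (k <= j)%N)) /= [X in _ + X]big1.
    rewrite addr0 mulr_sumr; apply: eq_bigr => i ki.
    by rewrite -scalerAr mulrCA -exprD subnKC.
  by move=> i; rewrite -ltnNge => /kmin ->; rewrite scale0r.
rewrite /H (bigD1 k) //= subnn expr0 mulr1; congr (_ + _).
rewrite mulr_sumr; apply: eq_bigr => i /andP[ki ik].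
rewrite -scalerAr mulrCA -exprS prednK // subn_gt0 ltn_neqAle ki.
by rewrite eq_sym andbT.
Qed.

Lemma frac_id (a b c h y z1 z2 z3 z4 : L) : y != 0 -> z1 != 0 -> z2 != 0 ->
  z3 != 0 -> z4 != 0 -> z1 * z2 = z3 * z4 -> b * a = c * h ->
  a / y * (b / z1) = h / z3 * (z2 / y) * (c / z4).
Proof.
move=> y0 z10 z20 z30 z40 zz ba; rewrite !mulf_div; apply/eqP.
rewrite eqr_div ?mulf_neq0 //; apply/eqP.
have -> : a * b * (z3 * y * z4) = (b * a) * y * (z3 * z4) by ring.
by rewrite ba -zz; ring.
Qed.

(** Modulo [F], some multiple [B' G] is a binary form in ['X_i'] and the local parameter [lform b],
    thus a power of the uniformizer times a unit. Powers of coordinates only bring the degrees to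
    0. *)
Lemma form_order P d G i : G \is d.-homog -> phi G != 0 -> 'X_i @@ P = 1 ->
  exists k, has_order P (phi G / phi 'X_i ^+ d) k.
Proof.
move=> hG G0 i1.
have [i' [a [b [A [B [[iP aP bP bk AP] [hA hB FE dec QP]]]]]]] := local_frame P.
have iP0 : 'X_i' @@ P != 0 by rewrite iP oner_eq0.
have i10 : 'X_i @@ P != 0 by rewrite i1 oner_eq0.
have uw := frame_uniformizing iP bP AP hA hB FE dec.
set w := phi (lform b) / phi 'X_i' in uw.
have nG : ~ mdvd F G by move/phi_eq0/eqP; apply/negP.
have reg := @curve_regular _ _ X G _ nG.
have [e [c [A' [B' [c0 de hB' pE]]]]] := pencil_in_ideal (fun x => (x == i')%:R) b
  (curve_homog X) hG (curve_neq0 X) reg.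
have [k [a' [H [R [ke a'0 hH pE' HE]]]]] := pencil_factor (fun x => (x == i')%:R) b c0.
have HP : H @@ P != 0.
  by rewrite HE atD atZ atX atM bP mul0r addr0 lform_delta iP expr1n mulr1.
have hX j : ('X_j : {mpoly K[3]}) \is 1.-homog by rewrite dhomogX /= mdeg1.
have hXn j k' : ('X_j ^+ k' : {mpoly K[3]}) \is k'.-homog.
  by have := dhomogMn k' (hX j); rewrite mul1n.
have XP0 j k' : 'X_j @@ P != 0 -> ('X_j ^+ k') @@ P != 0.
  by rewrite atX; apply: expf_neq0.
have uH : lunit P (phi H / phi 'X_i' ^+ (e - k)).
  apply/(unitP phi_eq0); exists (e - k)%N, H, ('X_i' ^+ (e - k)); split=> //.
    exact: XP0.
  by rewrite rmorphXn.
have uX : lunit P ((phi 'X_i' / phi 'X_i) ^+ d).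
  apply/(unitP phi_eq0); exists d, ('X_i' ^+ d), ('X_i ^+ d); split=> //; try exact: XP0.
  by rewrite !rmorphXn expr_div_n.
apply: (@strip_order P w k (phi G / phi 'X_i ^+ d) (phi B' / phi 'X_i' ^+ (e - d)) _
  uw _ _ (unitM phi_eq0 uH uX)).
- exists d, G, ('X_i ^+ d); split=> //; first exact: XP0.
  by rewrite rmorphXn.
- exists (e - d)%N, B', ('X_i' ^+ (e - d)); split=> //; first exact: XP0.
  by rewrite rmorphXn.
have hE : phi B' * phi G = phi (lform b) ^+ k * phi H.
  move/(congr1 phi): pE; rewrite pE' rmorphD !rmorphM phi_curve mulr0 add0r => <-.
  by rewrite rmorphXn.
have z0 k' : phi 'X_i' ^+ k' != 0 by rewrite expf_neq0 // (at_neq0 iP0).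
have y0 : phi 'X_i ^+ d != 0 by rewrite expf_neq0 // (at_neq0 i10).
rewrite /w !expr_div_n; apply: frac_id => //.
by rewrite -!exprD !subnK.
Qed.

Lemma order_exists P f : ratfun f -> f != 0 -> exists k, has_order P f k.
Proof.
move=> [d [G [H [hG hH H0 ->]]]] f0.
have [i' [a [b [A [B [[iP aP bP bk AP] [hA hB FE dec QP]]]]]]] := local_frame P.
have i0 : 'X_i' @@ P != 0 by rewrite iP oner_eq0.
have G0 : phi G != 0 by apply: contraNneq f0 => ->; rewrite mul0r.
have [k ok] := form_order hG G0 iP; have [l ol] := form_order hH H0 iP.
exists (k - l); have := orderM ok (orderV ol).
have s0 : phi 'X_i' ^+ d != 0 by rewrite expf_neq0 // (at_neq0 i0).
by rewrite invf_div mulf_div [phi G * _]mulrC -mulf_div divff // mul1r.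
Qed.

End Orders.

(** * Valuation calculus and Riemann-Roch spaces *)

Section Valuations.

Context {K : closedFieldType} {m : nat} {X : smooth_plane_curve K m}.
Hypothesis m_gt1 : (1 < m)%N.
Local Notation F := (curve_form X).
Context {L : fieldType} (phi : {rmorphism {mpoly K[3]} -> L}).
Hypothesis phi_eq0 : forall G, phi G = 0 <-> mdvd F G.
Implicit Types (G H A B : {mpoly K[3]}) (P : curve_point X) (f g t u : L).
Local Notation regular := (regular phi).
Local Notation vanishes := (vanishes phi).
Local Notation ratfun := (ratfun phi).
Local Notation cst := (cst phi).
Local Notation uniformizing := (uniformizing phi).
Local Notation has_order := (has_order phi).

Local Notation RR := (@RR K m X L phi).

Lemma vanishesD P f g : vanishes P f -> vanishes P g -> vanishes P (f + g).
Proof.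
move=> vf vg; have [w uw _] := exists_uniformizing m_gt1 phi_eq0 P.
have [h rh ->] := uw.2 _ vf; have [h' rh' ->] := uw.2 _ vg.
by rewrite -mulrDl; apply: vanishesM uw.1; apply: regularD.
Qed.

Lemma has_order_ratfun P f k : has_order P f k -> ratfun f.
Proof.
have mulrat g h : ratfun g -> ratfun h -> ratfun (g * h).
  move=> [d [G [H [hG hH H0 ->]]]] [e [G' [H' [hG' hH' H'0 ->]]]].
  exists (d + e)%N, (G * G'), (H * H'); split; try exact: dhomogM.
    by rewrite rmorphM mulf_neq0.
  by rewrite !rmorphM /= invfM mulrACA.
have rat1 : ratfun 1 by apply: (ratfun_regular phi_eq0 (regular1 phi P)).
have invrat g : ratfun g -> g != 0 -> ratfun g^-1.
  move=> [d [G [H [hG hH H0 ->]]]] h; exists d, H, G; split=> //.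
    by apply: contraNneq h => ->; rewrite mul0r.
  by rewrite invfM invrK mulrC.
move=> [t [u [ut uu ->]]].
have ratr g : regular P g -> ratfun g by move=> rg; apply: (ratfun_regular phi_eq0 rg).
apply: (mulrat); first exact/ratr/(lunit_regular uu).
have rt : ratfun t by apply/ratr/vanishes_regular/ut.1.
have ratX j : ratfun (t ^+ j).
  by elim: j => [|j IH]; rewrite ?expr0 // exprS; apply: (mulrat).
case: k => k; first exact: ratX.
by apply: (invrat); rewrite ?expf_neq0 ?(uniformizing_neq0 m_gt1 phi_eq0 ut).
Qed.

(** Zero has no [has_order]; [vge] gives it infinite valuation, so that these sets are closed under
    sums. *)
Definition vge P (k : int) f : Prop := f = 0 \/ exists2 j, has_order P f j & k <= j.

Lemma regular_order_ge0 P f k : regular P f -> has_order P f k -> 0 <= k.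
Proof.
move=> rf [t [u [ut uu fE]]]; rewrite leNgt; apply/negP => k0.
have t0 := uniformizing_neq0 m_gt1 phi_eq0 ut.
apply: (lunit_not_vanishes uu).
have -> : u = f * t ^ (- k) by rewrite fE -mulrA -expfzDr // subrr mulr1.
by apply: vanishesM => //; apply: vanishesXz => //; rewrite oppr_gt0.
Qed.

Lemma vgeP P w k f : uniformizing P w ->
  vge P k f <-> exists2 h, regular P h & f = h * w ^ k.
Proof.
move=> uw; have w0 := uniformizing_neq0 m_gt1 phi_eq0 uw; split.
  case=> [->|[j oj kj]]; first by exists 0; [exact: regular0 | rewrite mul0r].
  have [u uu ->] := orderP m_gt1 phi_eq0 uw oj.
  exists (u * w ^ (j - k)); last by rewrite -mulrA -expfzDr // subrK.
  apply: regularM; first exact: lunit_regular.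
  move: kj; rewrite -subr_ge0; case: (j - k) => // i _.
  by apply: regularX; apply: vanishes_regular; apply: uw.1.
move=> [h rh ->]; have [->|h0] := eqVneq h 0; first by left; rewrite mul0r.
have [j oj] := order_exists m_gt1 phi_eq0 P (ratfun_regular phi_eq0 rh) h0.
right; exists (j + k).
  apply: (orderM m_gt1 phi_eq0) => //; exists w, 1; split=> //.
    exact: unit1.
  by rewrite mul1r.
by rewrite lerDr; apply: regular_order_ge0 oj.
Qed.

Lemma vge_regular P f : vge P 0 f <-> regular P f.
Proof.
have [w uw _] := exists_uniformizing m_gt1 phi_eq0 P.
split=> [/(vgeP _ _ uw)[h rh ->]|rf]; first by rewrite expr0z mulr1.
by apply/(vgeP _ _ uw); exists f => //; rewrite expr0z mulr1.
Qed.

Lemma vge0 P k : vge P k 0. Proof. by left. Qed.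

Lemma has_order_vge P f k : has_order P f k -> vge P k f.
Proof. by right; exists k. Qed.

Lemma vge_le P k l f : k <= l -> vge P l f -> vge P k f.
Proof.
move=> kl [->|[j oj lj]]; first exact: vge0.
by right; exists j => //; apply: le_trans lj.
Qed.

Lemma vgeD P k f g : vge P k f -> vge P k g -> vge P k (f + g).
Proof.
have [w uw _] := exists_uniformizing m_gt1 phi_eq0 P.
move=> /(vgeP _ _ uw)[h rh ->] /(vgeP _ _ uw)[h' rh' ->].
by apply/(vgeP _ _ uw); exists (h + h'); [exact: regularD | rewrite mulrDl].
Qed.

Lemma vgeM P k l f g : vge P k f -> vge P l g -> vge P (k + l) (f * g).
Proof.
case=> [->|[j oj kj]]; first by rewrite mul0r => _; apply: vge0.
case=> [->|[i oi li]]; first by rewrite mulr0; apply: vge0.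
by right; exists (j + i); [exact: orderM | exact: lerD].
Qed.

Lemma vge_cst P c : vge P 0 (cst c).
Proof. by apply/vge_regular/regular_cst. Qed.

Lemma vgeZ P k c f : vge P k f -> vge P k (cst c * f).
Proof. by move=> vf; rewrite -[k]add0r; apply: vgeM => //; apply: vge_cst. Qed.

Lemma vge_sum (I : finType) (Q : pred I) P k (f : I -> L) :
  (forall i, Q i -> vge P k (f i)) -> vge P k (\sum_(i | Q i) f i).
Proof.
move=> h; elim/big_ind: _ => //; [exact: vge0 | by move=> *; apply: vgeD].
Qed.

Lemma has_order_add P f g k : has_order P f k -> vge P (k + 1) g -> has_order P (f + g) k.
Proof.
move=> [t [u [ut uu ->]]] /(vgeP _ _ ut)[h rh ->].
have t0 := uniformizing_neq0 m_gt1 phi_eq0 ut.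
exists t, (u + h * t); split=> //; last first.
  by rewrite mulrDl expfzDr // expr1z -mulrA [t * _]mulrC.
split.
  apply: (regularD phi_eq0); first exact: lunit_regular.
  by apply: regularM => //; apply: vanishes_regular; apply: ut.1.
move=> v; apply: (lunit_not_vanishes uu).
have -> : u = (u + h * t) + (cst (-1) * h) * t.
  by rewrite rmorphN rmorph1 mulN1r mulNr addrK.
apply: vanishesD => //; apply: vanishesM ut.1.
by apply: regularM => //; apply: regular_cst.
Qed.

(** The constant is the residue of [f / g] at [P]. *)
Lemma leading_term P f g k : vge P k f -> has_order P g k ->
  exists c, vge P (k + 1) (f - cst c * g).
Proof.
move=> vf og; have [w uw _] := exists_uniformizing m_gt1 phi_eq0 P.
have [c] : exists c, vanishes P (f / g - cst c).
  apply: residue => //; apply/vge_regular; rewrite -(subrr k).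
  by apply: vgeM => //; apply/has_order_vge/orderV.
move=> /uw.2 [h rh hE]; exists c.
have -> : f - cst c * g = h * w * g.
  by rewrite -hE mulrBl divfK // (order_neq0 m_gt1 phi_eq0 og).
rewrite addrC; apply: vgeM; last exact: has_order_vge.
by apply/(vgeP _ _ uw); exists h.
Qed.

Lemma RRP D f : RR D f <-> ratfun f /\ forall P, vge P (- coeff P D) f.
Proof.
split=> [[rf vf]|[rf vf]]; split=> //.
  by move=> P; case: vf => [->|/(_ P)]; [exact: vge0 | right].
have [->|f0] := eqVneq f 0; [by left | right=> P].
by have [/eqP|] := vf P; first by rewrite (negbTE f0).
Qed.

Lemma subspace_RR P D : subspace cst (RR D).
Proof.
have r0 : ratfun 0 by apply: (ratfun_regular phi_eq0 (regular0 phi P)).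
split; first by apply/RRP; split=> // Q; apply: vge0.
move=> a f g /RRP[rf vf] /RRP[rg vg]; apply/RRP.
have v Q : vge Q (- coeff Q D) (cst a * f + g) by apply: vgeD => //; apply: vgeZ.
split=> //; case: (v P) => [->|[j oj _]] //.
exact: has_order_ratfun oj.
Qed.

(** Among terms of distinct orders, the one of least order dominates the sum. *)
Lemma sum_order (I : finType) P (f : I -> L) (k : I -> int) (c : I -> K) :
  (forall i, has_order P (f i) (k i)) -> injective k -> (exists i, c i != 0) ->
  exists i, [/\ c i != 0, has_order P (\sum_i cst (c i) * f i) (k i) &
    forall j, c j != 0 -> k i <= k j].
Proof.
move=> hof kinj [i0 ci0].
case: (@Order.TotalTheory.arg_minP _ _ I i0 (fun i => c i != 0) k ci0) => i ci imin.
exists i; split=> //; rewrite (bigD1 i) //=; apply: has_order_add.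
  by rewrite -[k i]add0r; apply: orderM => //; apply: order_cst.
apply: vge_sum => j ji; have [->|cj] := eqVneq (c j) 0.
  by rewrite rmorph0 mul0r; apply: vge0.
apply/vgeZ/(@vge_le _ _ (k j)); last exact: has_order_vge.
by rewrite lezD1 lt_neqAle imin // andbT (inj_eq kinj) eq_sym.
Qed.

Lemma sum_order_ge (I : finType) P (f : I -> L) (k : I -> int) (c : I -> K) l :
  (forall i, has_order P (f i) (k i)) -> injective k ->
  vge P l (\sum_i cst (c i) * f i) -> forall i, c i != 0 -> l <= k i.
Proof.
move=> hof kinj vl i ci.
have [|j [cj oj jmin]] := @sum_order _ P f k c hof kinj; first by exists i.
apply: le_trans (jmin i ci); case: vl => [s0|[a oa la]].
  by have := order_neq0 m_gt1 phi_eq0 oj; rewrite s0 eqxx.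
by rewrite (order_uniq m_gt1 phi_eq0 oj oa).
Qed.

Lemma sum_order_indep (I : finType) P (f : I -> L) (k : I -> int) (c : I -> K) :
  (forall i, has_order P (f i) (k i)) -> injective k ->
  \sum_i cst (c i) * f i = 0 -> forall i, c i = 0.
Proof.
move=> hof kinj s0 i; apply/eqP; apply: contraT => ci.
have [|j [cj oj jmin]] := @sum_order _ P f k c hof kinj; first by exists i.
by have := order_neq0 m_gt1 phi_eq0 oj; rewrite s0 eqxx.
Qed.

Lemma RR_le D D' : (forall Q, coeff Q D <= coeff Q D') -> (RR D `<=` RR D')%classic.
Proof.
move=> le f /RRP[rf vf]; apply/RRP; split=> // Q.
by apply: vge_le (vf Q); rewrite lerN2.
Qed.

(** A function of the larger space outside the smaller one has the extremal order at [P], and a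
    multiple of it cancels the leading term of any other. *)
Lemma max_indep_RR P D k : max_indep cst (RR D) k -> max_indep cst (RR (D + << P >>)) k.+1.
Proof.
apply: max_indepS => f g /RRP[rf vf] /RRP[rg vg] nDg.
have cQ Q : Q != P -> coeff Q (D + << P >>) = coeff Q D.
  by move=> QP; rewrite coeffD coeffU eq_sym (negbTE QP) mulr0 addr0.
have cP : coeff P (D + << P >>) = coeff P D + 1.
  by rewrite coeffD coeffU eqxx mulr1.
have og : has_order P g (- coeff P D - 1).
  have := vg P; rewrite cP opprD => -[g0|[j oj le]].
    by case: nDg; rewrite g0; case: (subspace_RR P D).
  have [lt|ge] := ltP j (- coeff P D).
    suff <- : j = - coeff P D - 1 by [].
    by apply/le_anti; rewrite le andbT; move: lt; clear; lia.
  case: nDg; apply/RRP; split=> // Q; have [->|QP] := eqVneq Q P.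
    by right; exists j.
  by rewrite -(cQ _ QP).
have [|c vc] := @leading_term P f g (- coeff P D - 1) _ og.
  by have := vf P; rewrite cP opprD.
exists c.
have [_ /(_ (- c) g f)] := subspace_RR P (D + << P >>).
rewrite rmorphN mulNr [- _ + _]addrC => h.
have /RRP[r v] := h (proj2 (RRP _ _) (conj rg vg)) (proj2 (RRP _ _) (conj rf vf)).
apply/RRP; split=> // Q; have [->|QP] := eqVneq Q P; first by rewrite subrK in vc.
by rewrite -(cQ _ QP).
Qed.

End Valuations.

(** * Completeness of the linear systems cut out by forms *)

Section Completeness.

Context {K : closedFieldType} {m : nat} {X : smooth_plane_curve K m}.
Hypothesis m_gt1 : (1 < m)%N.
Local Notation F := (curve_form X).
Context {L : fieldType} (phi : {rmorphism {mpoly K[3]} -> L}).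
Hypothesis phi_eq0 : forall G, phi G = 0 <-> mdvd F G.
Implicit Types (G H A B : {mpoly K[3]}) (P : curve_point X) (f g t u : L).
Local Notation cst := (cst phi).
Local Notation "G @@ P" := (mpoly_at G (val P)) (at level 30).
Local Notation at_neq0 := (at_neq0 phi_eq0).

Lemma point_of_zero (v : 'I_3 -> K) : (exists i, v i != 0) -> F.@[v] = 0 ->
  exists P c, c != 0 /\ forall i, v i = c * val (val P : proj_plane K) 0 i :> K.
Proof.
move=> v0 Fv; have [u [c [c0 vE]]] := exists_proportional v0.
have Fu : mpoly_at F u == 0.
  have := form_scale (curve_homog X) vE; rewrite Fv => /esym/eqP.
  by rewrite mulf_eq0 expf_eq0 (negbTE c0) andbF.
by exists (exist _ u Fu), c.
Qed.

(** The local expressions of [f] put [B] in the ideal of [l] and [F] near each of their common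
    zeros, so [dvd_mod_line] gives [B = l A + F R]; then [l] is cancelled in the field. *)
Lemma peel_line (l : 'I_3 -> K) d k M B f :
  (forall P, exists e H A, [/\ H \is e.-homog, A \is (e + d).-homog, H @@ P != 0 &
     phi H * f = phi A]) ->
  (exists i, l i != 0) -> B \is k.+1.-homog -> phi (lform l) * phi M * f = phi B ->
  exists2 B', B' \is k.-homog & phi M * f = phi B'.
Proof.
move=> loc l0 hB lMf.
have := dvd_mod_line (curve_homog X) hB l0 (lform_ndvd_curve m_gt1 l0).
case=> [v v0 Fv lv|A [R [hA BE]]].
  have [P [c [c0 vE]]] := point_of_zero v0 Fv.
  have [e [H [A [hH hA HP Hf]]]] := loc P.
  have : mdvd F (H * B - lform l * (M * A)).
    by apply/phi_eq0; rewrite rmorphB !rmorphM /= -lMf -Hf; ring.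
  move=> [R RE]; exists H, (M * A), R; split; last by rewrite [F * R]mulrC -RE; ring.
  by rewrite (form_scale hH vE) mulf_neq0 // expf_neq0.
exists A => //; apply: (mulfI (phi_lform_neq0 m_gt1 phi_eq0 l0)).
by rewrite mulrA lMf BE rmorphD !rmorphM /= (phi_curve phi_eq0) mul0r addr0.
Qed.

Lemma pencil_formE (s w : 'I_3 -> K) e (c : 'rV[K]_e.+1) :
  pencil_form s w c = homogenize s w e (rVpoly c).
Proof. by apply: eq_bigr => k _; rewrite coef_rVpoly_ord. Qed.

(** The binary form splits into lines of the pencil, peeled by induction on its degree [e]. *)
Lemma peel_pencil (s w : 'I_3 -> K) d e (p : {poly K}) B f :
  (forall P, exists e H A, [/\ H \is e.-homog, A \is (e + d).-homog, H @@ P != 0 &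
     phi H * f = phi A]) ->
  (exists i, s i != 0) -> (exists i, s i = 0 /\ w i != 0) ->
  p != 0 -> (size p <= e.+1)%N -> B \is (e + d).-homog ->
  phi (homogenize s w e p) * f = phi B -> exists2 A, A \is d.-homog & f = phi A.
Proof.
move=> loc s0 w0; elim: e p B => [|e IH] p B p0 sp hB pf.
  have [a pE] : exists a, p = a%:P by exists p`_0; apply: size1_polyC.
  have a0 : a != 0 by apply: contraNneq p0 => a0; rewrite pE a0.
  exists (a^-1 *: B); first exact: rpredZ.
  have ca : cst a != 0 by rewrite fmorph_eq0.
  apply: (mulfI ca); rewrite -mul_mpolyC rmorphM mulrA -[phi _%:MP]/(cst _).
  rewrite -rmorphM mulfV // rmorph1 mul1r -pf; congr (_ * _).
  by rewrite /homogenize big_ord1 expr0 mul1r pE coefC eqxx -mul_mpolyC mulr1.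
(* A drop in the degree of [p] is a root at infinity, that is, a factor [lform s]. *)
have [sp'|sp'] := leqP (size p) e.+1.
  have := homogenizeM s w 1 0 sp'; rewrite scale0r addr0 mul1r scale1r scale0r addr0 => hE.
  rewrite hE rmorphM /= in pf.
  have [B' hB' pf'] := peel_line loc s0 hB pf.
  exact: IH pf'.
(* A finite root [z] contributes the line [w - z s]. *)
have [z rz] : exists z, root p z.
  by apply/closed_rootP; rewrite neq_ltn (leq_trans _ sp') ?orbT.
have [q pE] := factor_theorem _ _ rz.
have q0 : q != 0 by apply: contraNneq p0 => q0; rewrite pE q0 mul0r.
have sq : (size q <= e.+1)%N.
  by move: sp; rewrite pE size_Mmonic ?monicXsubC // size_XsubC addn2.
have pE' : p = ((- z)%:P + 1 *: 'X) * q.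
  by rewrite pE mulrC scale1r polyCN addrC.
pose l i := - z * s i + 1 * w i.
have lE : lform l = - z *: lform s + 1 *: lform w.
  rewrite /lform !scaler_sumr -big_split; apply: eq_bigr => i _ /=.
  by rewrite !scalerA -scalerDl.
rewrite pE' homogenizeM // -lE rmorphM /= in pf.
have [|B' hB' pf'] := peel_line loc _ hB pf.
  by have [i [si wi]] := w0; exists i; rewrite /l si mulr0 add0r mul1r.
exact: IH pf'.
Qed.

(** The hypothesis makes [f] a global section of the sheaf O(d) on the curve. One local denominator
    [H0] is multiplied into a binary form modulo [F], which can then be peeled off. *)
Theorem complete_forms P0 d f :
  (forall P, exists e H A, [/\ H \is e.-homog, A \is (e + d).-homog, H @@ P != 0 &
     phi H * f = phi A]) -> exists2 A, A \is d.-homog & f = phi A.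
Proof.
move=> loc; have [e0 [H0 [A0 [hH0 hA0 HP0 Hf0]]]] := loc P0.
have nH0 : ~ mdvd F H0 by move/phi_eq0/eqP; apply/negP/(at_neq0 HP0).
pose s : 'I_3 -> K := fun i => (i == 0)%:R; pose w : 'I_3 -> K := fun i => (i == 1)%:R.
have [e [c [A' [B' [c0 de hB' pE]]]]] := pencil_in_ideal s w
  (curve_homog X) hH0 (curve_neq0 X) (fun B => @curve_regular _ _ X H0 B nH0).
apply: (@peel_pencil s w d e (rVpoly c) (B' * A0)) => //.
- by exists 0; rewrite /s eqxx oner_eq0.
- by exists 1; split; rewrite /s /w ?eqxx ?oner_eq0.
- by apply: contraNneq c0 => h; rewrite -[c]rVpolyK h linear0.
- exact: size_poly.
- by have := dhomogM hB' hA0; rewrite addnA subnK.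
- rewrite -pencil_formE pE rmorphD !rmorphM /= (phi_curve phi_eq0) mulr0 add0r.
  by rewrite -Hf0 mulrA.
Qed.

End Completeness.

(** * Uniqueness of the tangent line *)

Section Lines.

Context {K : closedFieldType} {m : nat} {X : smooth_plane_curve K m}.
Hypothesis m_gt1 : (1 < m)%N.
Local Notation F := (curve_form X).
Context {L : fieldType} (phi : {rmorphism {mpoly K[3]} -> L}).
Hypothesis phi_eq0 : forall G, phi G = 0 <-> mdvd F G.
Implicit Types (G H A B : {mpoly K[3]}) (P : curve_point X) (f g t u : L).
Local Notation cst := (cst phi).
Local Notation has_order := (has_order phi).
Local Notation "G @@ P" := (mpoly_at G (val P)) (at level 30).
Local Notation at_neq0 := (at_neq0 phi_eq0).

Local Notation vge := (vge phi).

Lemma homog0_const G : G \is 0.-homog -> exists c, G = c%:MP.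
Proof.
apply: (@dhomog_ind _ (fun G => exists c, G = c%:MP)) => [|a A B [c ->] [c' ->]|m0].
- by exists 0; rewrite mpolyC0.
- by exists (a * c + c'); rewrite -mul_mpolyC mpolyCD mpolyCM.
- by move/eqP; rewrite mdeg_eq0 => /eqP ->; exists 1; rewrite mpolyX0 mpolyC1.
Qed.

Lemma line_order (a : 'I_3 -> K) P i j k : 'X_i @@ P = 1 -> 'X_j @@ P = 1 ->
  has_order P (phi (lform a) / phi 'X_i) k -> has_order P (phi (lform a) / phi 'X_j) k.
Proof.
move=> iP jP oi.
have i0 : 'X_i @@ P != 0 by rewrite iP oner_eq0.
have j0 : 'X_j @@ P != 0 by rewrite jP oner_eq0.
have hX k' : ('X_k' : {mpoly K[3]}) \is 1.-homog by rewrite dhomogX /= mdeg1.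
have ou : has_order P (phi 'X_i / phi 'X_j) 0.
  apply: (lunit_order m_gt1 phi_eq0); apply/(unitP phi_eq0).
  by exists 1%N, 'X_i, 'X_j.
have := orderM m_gt1 phi_eq0 oi ou.
by rewrite addr0 mulrA divfK // (at_neq0 i0).
Qed.

(** It makes the three points distinct: each carries contact of order at least n with its own
    line. *)
Lemma tangent_unique (u v : proj_plane K) P i k l :
  'X_i @@ P = 1 -> 1 < k -> 1 < l ->
  has_order P (phi (line_form u) / phi 'X_i) k ->
  has_order P (phi (line_form v) / phi 'X_i) l -> u = v.
Proof.
have [j [a [b [A [B [[jP aP bP bk AP] [hA hB FE dec QP]]]]]]] := local_frame P.
move=> iP k1 l1 ou0 ov0.
have j0 : 'X_j @@ P != 0 by rewrite jP oner_eq0.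
set s := phi 'X_j; have s0 : s != 0 := at_neq0 j0.
have ou : has_order P (phi (line_form u) / s) k by exact: line_order ou0.
have ov : has_order P (phi (line_form v) / s) l by exact: line_order ov0.
have ob : has_order P (phi (lform b) / s) 1.
  exists (phi (lform b) / s), 1; split.
  - exact: frame_uniformizing FE dec.
  - exact: unit1.
  - by rewrite mul1r expr1z.
have coords (w : proj_plane K) h : 1 < h -> has_order P (phi (line_form w) / s) h ->
    exists c d, c != 0 /\ line_form w = c *: lform a + d *: lform b.
  move=> h1 ow; have wP : line_form w @@ P = 0.
    apply/eqP; apply: contraT => wP.
    have : has_order P (phi (line_form w) / s) 0.
      apply: (lunit_order m_gt1 phi_eq0); apply/(unitP phi_eq0).
      exists 1%N, (line_form w), 'X_j; split=> //; first exact: lform_homog.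
      by rewrite dhomogX /= mdeg1.
    by move/(order_uniq m_gt1 phi_eq0 ow) => h0; rewrite h0 in h1.
  have [C [D [/homog0_const[c ->] /homog0_const[d ->] E]]] := dec _ _ (lform_homog _) wP.
  exists c, d; split; last by rewrite -!mul_mpolyC.
  apply/eqP => c0; rewrite c0 mpolyC0 mul0r add0r in E.
  have [d0|d0] := eqVneq d 0.
    have := order_neq0 m_gt1 phi_eq0 ow.
    by rewrite [line_form w]E d0 mpolyC0 mul0r rmorph0 mul0r eqxx.
  move: ow; rewrite [line_form w]E rmorphM -mulrA -[phi _%:MP]/(cst d) => ow.
  have := orderM m_gt1 phi_eq0 (order_cst m_gt1 phi_eq0 P d0) ob.
  by rewrite add0r => /(order_uniq m_gt1 phi_eq0 ow) e; rewrite e in h1.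
have [c [d [c0 uE]]] := coords u k k1 ou; have [c' [d' [c'0 vE]]] := coords v l l1 ov.
(* The combination [c' u - c v] has order at least 2 but is a multiple of [lform b], whose order is
   1. *)
have e0 : c' * d - c * d' = 0.
  apply/eqP; apply: contraT => e0.
  have oe := orderM m_gt1 phi_eq0 (order_cst m_gt1 phi_eq0 P e0) ob.
  have : vge P 2 (cst (c' * d - c * d') * (phi (lform b) / s)).
    have -> : cst (c' * d - c * d') * (phi (lform b) / s) =
      cst c' * (phi (line_form u) / s) + cst (- c) * (phi (line_form v) / s).
      rewrite uE vE -!mul_mpolyC !(rmorphD phi) !(rmorphM phi) -![phi _%:MP]/(cst _).
      rewrite !(rmorphB, rmorphM, rmorphN) /=; ring.
    apply: vgeD => //; apply: vgeZ => //;
      [apply: (@vge_le _ _ _ _ _ P 2 k) | apply: (@vge_le _ _ _ _ _ P 2 l)];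
      rewrite ?lezD1 //; exact: has_order_vge.
  rewrite add0r in oe.
  case=> [z0|[h oh h2]]; first by have := order_neq0 m_gt1 phi_eq0 oe; rewrite z0 eqxx.
  by rewrite -(order_uniq m_gt1 phi_eq0 oe oh) in h2.
have uv : c' *: line_form u = c *: line_form v.
  rewrite uE vE !scalerDr !scalerA [c' * c]mulrC; congr (_ + _ *: _).
  by apply/eqP; rewrite -subr_eq0 e0.
apply: (@proportional_eq _ u v (c / c')) => x.
have := congr1 (mcoeff U_(x)%MM) uv.
have coefE (w : proj_plane K) : (line_form w)@_(U_(x)) = val w 0 x.
  rewrite /line_form raddf_sum /= (bigD1 x) //= big1 => [|y /negbTE yx].
    by rewrite mcoeffZ mcoeffXU eqxx mulr1 addr0.
  by rewrite mcoeffZ mcoeffXU yx mulr0.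
rewrite !mcoeffZ !coefE => e; apply: (mulfI c'0); rewrite e.
by rewrite mulrA [c' * _]mulrC divfK.
Qed.

End Lines.

(** * Counting *)

Section PureGapArithmetic.

Lemma eq_digits (n p q r s : nat) : (q < n)%N -> (s < n)%N ->
  n%:Z * p%:Z + q%:Z = n%:Z * r%:Z + s%:Z -> p = r /\ q = s.
Proof.
move=> qn sn /eqP; rewrite -!PoszM -!PoszD eqz_nat => /eqP e.
have := congr1 (modn^~ n) e; rewrite ![(n * _)%N]mulnC !modnMDl !modn_small // => qs.
split=> //; move: e; rewrite qs => /addIn/eqP.
by rewrite eqn_pmul2l ?(leq_ltn_trans _ sn) // => /eqP.
Qed.

(** The three expressions are the orders at the three points of the monomial with exponents
    [(u1 - i, d - u1 - u2 - j, u2)]. Up to a shift each is a number in base n with two of the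
    exponents [u1], [d - u1 - u2], [u2] as digits, all at most d < n. *)
Lemma digits_inj (n i j d u1 u2 v1 v2 : nat) :
  (d < n)%N -> (u1 + u2 <= d)%N -> (v1 + v2 <= d)%N ->
  let eq := u1 = v1 /\ u2 = v2 in
  (n%:Z * (u1%:Z - i%:Z) + u2%:Z = n%:Z * (v1%:Z - i%:Z) + v2%:Z -> eq) /\
  (u1%:Z - i%:Z + n%:Z * (d%:Z - u1%:Z - u2%:Z - j%:Z) =
   v1%:Z - i%:Z + n%:Z * (d%:Z - v1%:Z - v2%:Z - j%:Z) -> eq) /\
  (d%:Z - u1%:Z - u2%:Z - j%:Z + n%:Z * u2%:Z =
   d%:Z - v1%:Z - v2%:Z - j%:Z + n%:Z * v2%:Z -> eq).
Proof.
move=> dn hu hv eq.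
have [bu hbu] : exists b, (b + u1 + u2 = d)%N.
  by exists (d - (u1 + u2))%N; rewrite -addnA subnK.
have [bv hbv] : exists b, (b + v1 + v2 = d)%N.
  by exists (d - (v1 + v2))%N; rewrite -addnA subnK.
split=> [e|]; first by apply: (@eq_digits n); lia.
split=> e.
  by have [|||? ?] := @eq_digits n bu u1 bv v1; rewrite /eq; lia.
by have [|||? ?] := @eq_digits n u2 bu v2 bv; rewrite /eq; lia.
Qed.

Lemma tri_degree (i j d p q : nat) : (i + j = d)%N ->
  p%:Z - i%:Z + (d%:Z - p%:Z - q%:Z - j%:Z) + q%:Z = 0.
Proof. by move=> <-; lia. Qed.

Lemma order_bounds (n i j d u1 u2 : nat) (a b : int) :
  - a <= n%:Z * (u1%:Z - i%:Z) + u2%:Z ->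
  - b <= u1%:Z - i%:Z + n%:Z * (d%:Z - u1%:Z - u2%:Z - j%:Z) ->
  - 0 <= d%:Z - u1%:Z - u2%:Z - j%:Z + n%:Z * u2%:Z ->
  [&& n%:Z * i%:Z - a <= n%:Z * u1%:Z + u2%:Z,
      i%:Z + n%:Z * j%:Z - b <= u1%:Z + n%:Z * (d%:Z - u1%:Z - u2%:Z) &
      j%:Z <= d%:Z - u1%:Z - u2%:Z + n%:Z * u2%:Z].
Proof. by move=> *; apply/and3P; split; lia. Qed.

Lemma sum_interval N lo hi : (\sum_(a < N) ((lo <= a) && (a < hi))%N = minn hi N - lo)%N.
Proof.
elim: N => [|N IH]; first by rewrite big_ord0; lia.
by rewrite big_ord_recr /= IH; case: leqP; case: ltnP => /= *; lia.
Qed.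

(** In this sum and the next two, truncated subtraction kills the terms past [k]. *)
Lemma sum_triangle N k : (k <= N)%N -> (2 * \sum_(c < N) (k - c) = k * (k + 1))%N.
Proof.
elim: N k => [|N IH] [|k] // kN; first by rewrite big_ord0.
  by rewrite big1 // => i _; lia.
rewrite big_ord_recl /= subn0 mulnDr.
under eq_bigr => i _ do rewrite subSS.
by rewrite IH //; lia.
Qed.

Lemma sum_pronic N k : (k <= N)%N ->
  (3 * \sum_(j < N) (k - 1 - j) * (k - j) = (k - 1) * k * (k + 1))%N.
Proof.
elim: N k => [|N IH] [|k] // kN; first by rewrite big_ord0.
  by rewrite big1 // => i _; lia.
rewrite big_ord_recl /= !subn0 subn1 /= mulnDr.
under eq_bigr => i _ do rewrite /bump add1n subSS subnS -subn1 subnAC.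
by rewrite IH //; case: k {IH kN} => [|k]; nia.
Qed.

Lemma sum_cubic N k : (k <= N)%N ->
  (4 * \sum_(j < N) (k - 1 - j) * (k - j) * (k + 1 - j) = (k - 1) * k * (k + 1) * (k + 2))%N.
Proof.
elim: N k => [|N IH] [|k] // kN; first by rewrite big_ord0.
  by rewrite big1 // => i _; lia.
rewrite big_ord_recl /= !subn0 subn1 /= mulnDr.
under eq_bigr => i _ do rewrite /bump add1n addSn !subSS subnS -subn1 subnAC.
by rewrite IH //; case: k {IH kN} => [|k]; nia.
Qed.

(** With indices starting at 0, [i + j + 2] is the d of the theorem, and the product counts the
    pairs (r, s). *)
Lemma sum_pure_gaps n : (12 * \sum_(i < n) \sum_(j < n) (n - (i + j + 2)) * (n + 1 - (i + j + 2)) =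
  (n - 2) * (n - 1) * n * (n + 1))%N.
Proof.
have -> : (12 = 4 * 3)%N by [].
rewrite -mulnA big_distrr /=.
under eq_bigr => i _.
  under eq_bigr => j _.
    rewrite (_ : (n - (i + j + 2) = n - 1 - i - 1 - j)%N); last by lia.
    rewrite (_ : (n + 1 - (i + j + 2) = n - 1 - i - j)%N); last by lia.
    over.
  rewrite sum_pronic; last by lia.
  rewrite (_ : ((n - 1 - i - 1) * (n - 1 - i) * (n - 1 - i + 1) =
     (n - 1 - 1 - i) * (n - 1 - i) * (n - 1 + 1 - i))%N); last first.
    have := ltn_ord i; move: (nat_of_ord i) => i' i'n.
    by congr (_ * _ * _)%N; lia.
  over.
by rewrite sum_cubic ?leq_subr //; case: n => [|[|n]] //;
  rewrite !subSS !subn0; congr (_ * _ * _ * _)%N; lia.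
Qed.

Lemma gap_decomposition n a : (0 < n)%N -> (0 < a)%N ->
  exists i r, [/\ (0 < i)%N, (r < n)%N & a = ((i - 1) * n + r + 1)%N].
Proof.
move=> n0 a0; exists ((a - 1) %/ n).+1, ((a - 1) %% n)%N; rewrite ltn_mod n0; split=> //.
by rewrite subn1 /= -divn_eq; lia.
Qed.

Lemma decomposition_inj n i r i' r' : (0 < i)%N -> (0 < i')%N -> (r < n)%N -> (r' < n)%N ->
  ((i - 1) * n + r + 1 = (i' - 1) * n + r' + 1)%N -> i = i' /\ r = r'.
Proof.
move=> i0 i'0 rn r'n /eqP; rewrite eqn_add2r => /eqP e.
have := congr1 (modn^~ n) e; rewrite !modnMDl !modn_small // => rr.
split=> //; move: e; rewrite rr => /addIn/eqP; rewrite eqn_pmul2r ?(leq_ltn_trans _ rn) //.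
by move=> /eqP; lia.
Qed.

(* The exponents [p, q, r] of a monomial of degree 0 whose poles are bounded by
   [a] at the first point and [b] at the second, one of the bounds being attained. *)
Definition attained (n a b : nat) : Prop := exists p q r : int,
  [/\ p + q + r = 0, - a%:Z <= n%:Z * p + r, - b%:Z <= p + n%:Z * q, 0 <= q + n%:Z * r
    & n%:Z * p + r = - a%:Z \/ p + n%:Z * q = - b%:Z].

Definition pure_gap_pair (n a b : nat) : Prop := exists i j r s : nat,
  [/\ (1 <= i)%N, (1 <= j)%N, (i + j <= n - 1)%N,
     (r <= n - (i + j) - 1)%N /\ (s <= n - (i + j))%N
    & a = ((i - 1) * n + r + 1)%N /\ b = ((j - 1) * n + i + s)%N].

(** Two monomials are tried, one with pole order exactly [a] at the first point, one with exactly
    [b] at the second; when both fail, the base n expansions of [a] and [b] satisfy the inequalities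
    of the list. *)
Lemma pure_gap_or_attained n a b : (2 < n)%N -> pure_gap_pair n a b \/ attained n a b.
Proof.
move=> n2; have [->|a0] := posnP a.
  by right; exists 0, 0, 0; split; [lia..|left; lia].
have [->|b0] := posnP b.
  by right; exists 0, 0, 0; split; [lia..|right; lia].
have [|i [r [i0 rn aE]]] := @gap_decomposition n a _ a0; first by lia.
have aZ : a%:Z = (i%:Z - 1) * n%:Z + r%:Z + 1 by rewrite aE; case: i i0 {aE} => // i _; lia.
have [h|h] := lerP (i%:Z + n%:Z * (n%:Z - 1 - r%:Z - i%:Z)) b%:Z.
  (* First and last exponents [- i] and [n - 1 - r] give order [- a] at the first point; [h] is the
     bound at the second. *)
  right; exists (- i%:Z), (- (n%:Z - 1 - r%:Z - i%:Z)), (i%:Z + (n%:Z - 1 - r%:Z - i%:Z)).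
  split; [lia|lia|lia| |left; lia].
  have : 0 <= (n%:Z - 1) * (n%:Z - 1 - r%:Z) by apply: mulr_ge0; lia.
  by lia.
(* Division in the integers, since [b] may be less than [i]: then [J <= 0]. *)
pose J := ((b%:Z - i%:Z) %/ n%:Z)%Z + 1; pose s := ((b%:Z - i%:Z) %% n%:Z)%Z.
have bE : b%:Z = (J - 1) * n%:Z + i%:Z + s.
  by rewrite /J /s addrK addrAC -divz_eq subrK.
have s0 : 0 <= s by apply: modz_ge0; lia.
have sn : s < n%:Z by apply: ltz_pmod; lia.
have Jle : J <= n%:Z - 1 - r%:Z - i%:Z.
  have : (J - 1) * n%:Z < (n%:Z - 1 - r%:Z - i%:Z) * n%:Z by lia.
  by rewrite ltr_pM2r; lia.
move: J s bE s0 sn Jle => J s bE s0 sn Jle.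
(* The second monomial has order exactly [- b] at the second point; the premises are its conditions
   at the third and at the first. *)
have use : 0 <= n%:Z * (i%:Z + s - n%:Z) + (n%:Z - 1) * J ->
    (n%:Z - 1) * (i%:Z + s - n%:Z) - J <= a%:Z -> attained n a b.
  move=> h3 h1; exists (- (i%:Z + s - n%:Z)), (- J), (i%:Z + s - n%:Z + J).
  by split; [lia|lia|lia|lia|right; lia].
have i1 : (n%:Z - 1) * (s - n%:Z + 1) <= 0 by apply: mulr_ge0_le0; lia.
have [J0|J1] := lerP J 0.
  right; apply: use.
    have : 0 <= (n%:Z * n%:Z - n%:Z + 1) * - J.
      apply: mulr_ge0; last lia.
      have : 0 <= n%:Z * (n%:Z - 1) by apply: mulr_ge0; lia.
      by lia.
    by lia.
  have : 0 <= (n%:Z - 1) * - J by apply: mulr_ge0; lia.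
  by lia.
(* Here [Jle] reads r <= n - d - 1 with d = i + J, so only the bound on [s] is left to decide. *)
have [sd|sd] := lerP s (n%:Z - i%:Z - J).
  left; exists i, `|J|%N, r, `|s|%N; split; try lia.
  split=> //; apply/eqP; rewrite -eqz_nat bE; apply/eqP.
  have JJ : `|J|%N%:Z = J by lia.
  have ss : `|s|%N%:Z = s by lia.
  rewrite !PoszD PoszM ss; have -> : (`|J| - 1)%N%:Z = J - 1 by lia.
  by [].
right; apply: use.
  have : 0 <= n%:Z * (s - (n%:Z - i%:Z - J) - 1) by apply: mulr_ge0; lia.
  by lia.
by lia.
Qed.

(** The first monomial of [pure_gap_or_attained] again; for [n <= i + r] it has no pole at the
    second point. *)
Lemma pole_order n i r : (2 < n)%N -> (0 < i)%N -> (r < n)%N -> (n <= i + r)%N ->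
  exists p q s : int, [/\ p + q + s = 0, n%:Z * p + s = - ((i - 1) * n + r + 1)%N%:Z,
    0 <= p + n%:Z * q & 0 <= q + n%:Z * s].
Proof.
move=> n2 i0 rn irn.
exists (- i%:Z), (- (n%:Z - 1 - r%:Z - i%:Z)), (i%:Z + (n%:Z - 1 - r%:Z - i%:Z)).
have h1 : 0 <= (n%:Z - 1) * (n%:Z - 1 - r%:Z) by apply: mulr_ge0; lia.
have h2 : i%:Z <= n%:Z * (i%:Z + r%:Z + 1 - n%:Z).
  have [iN|Ni] := leqP i n.
    have : 0 <= n%:Z * (i%:Z + r%:Z - n%:Z) by apply: mulr_ge0; lia.
    by lia.
  have : 0 <= (n%:Z - 1) * (i%:Z - n%:Z) by apply: mulr_ge0; lia.
  have : 0 <= n%:Z * r%:Z by apply: mulr_ge0; lia.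
  by lia.
by split; [lia| case: i i0 irn {h1 h2} => // i _ _; lia|lia|lia].
Qed.

(* The gaps at one point: [a = (i - 1) n + r + 1] with [1 <= i], [r < n] and [i + r < n]. *)
Definition gap_value (n a : nat) : bool :=
  (0 < a)%N && (((a - 1) %/ n).+1 + (a - 1) %% n < n)%N.

(** Quotient and remainder of [a - 1] inject the gap values into a triangle of n (n - 1) / 2 pairs,
    whatever [N] is. *)
Lemma sum_gap_value n N : (0 < n)%N -> (2 * \sum_(a < N) gap_value n a <= n * (n - 1))%N.
Proof.
move=> n0.
have -> : (n * (n - 1) = 2 * \sum_(q < n) (n - 1 - q))%N.
  by rewrite sum_triangle ?leq_subr // mulnC subnK.
rewrite leq_mul2l /=.
have -> : (\sum_(q < n) (n - 1 - q) = #|[pred u : 'I_n * 'I_n | (u.1.+1 + u.2 < n)%N]|)%N.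
  rewrite -sum1_card [RHS]big_mkcond /=.
  transitivity (\sum_(q < n) \sum_(r < n) (if (q.+1 + r < n)%N then 1 else 0))%N.
    apply: eq_bigr => q _; have := sum_interval n 0 (n - 1 - q).
    rewrite subn0 (minn_idPl _); last by lia.
    by move=> <-; apply: eq_bigr => r _; case: ifP; case: ltnP => //=; lia.
  by rewrite pair_bigA; apply: eq_bigr.
have -> : (\sum_(a < N) gap_value n a = #|[pred a : 'I_N | gap_value n a]|)%N.
  by rewrite -sum1_card [RHS]big_mkcond; apply: eq_bigr => a _; rewrite inE; case: gap_value.
case: n n0 => // n _.
pose h (a : 'I_N) : 'I_n.+1 * 'I_n.+1 := (inord ((a - 1) %/ n.+1), inord ((a - 1) %% n.+1)).
have hP (a : 'I_N) : gap_value n.+1 a ->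
    (h a).1 = ((a - 1) %/ n.+1)%N :> nat /\ (h a).2 = ((a - 1) %% n.+1)%N :> nat.
  by move=> /andP[a0 ha]; rewrite !inordK ?ltn_mod // ltnW // (leq_ltn_trans (leq_addr _ _) ha).
have hinj : {in [pred a : 'I_N | gap_value n.+1 a] &, injective h}.
  move=> a b ga gb hab; have [a1 a2] := hP a ga; have [b1 b2] := hP b gb.
  have e : (a - 1 = b - 1)%N.
    by rewrite (divn_eq (a - 1) n.+1) (divn_eq (b - 1) n.+1) -a1 -a2 -b1 -b2 hab.
  by move: ga gb => /andP[a0 _] /andP[b0 _]; apply/val_inj => /=; lia.
rewrite -(fintype.card_in_image hinj); apply/subset_leq_card/fintype.subsetP
  => u /fintype.imageP[a ga ->].
by have [a1 a2] := hP a ga; rewrite inE /= a1 a2; case/andP: ga.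
Qed.

(** From [2 g = n (n - 1)] follows [2 g - 2 = (n - 2) (n + 1)]. *)
Lemma card_genus (n g N : nat) : (2 < n)%N -> (2 * g = n * (n - 1))%N ->
  (12 * N = (n - 2) * (n - 1) * n * (n + 1))%N -> (3 * N = (g - 1) * g)%N.
Proof.
case: n => [|[|n]] // _; rewrite !subSS !subn0 => gE NE.
apply/eqP; rewrite -(eqn_pmul2l (isT : (0 < 4)%N)); apply/eqP.
have -> : (4 * ((g - 1) * g) = (2 * g - 2) * (2 * g))%N by move: (g); case=> [|h]; nia.
rewrite mulnA NE gE.
have -> : (n.+2 * n.+1 - 2 = n * (n.+2 + 1))%N by nia.
nia.
Qed.

End PureGapArithmetic.

Section Counting.

(* The monomials of degree [d] in three variables, given by the exponents of the
   first and the third variable. *)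
Definition tri d := {u : 'I_d.+1 * 'I_d.+1 | (u.1 + u.2 <= d)%N}.

(** The conditions at P1, P2, P3 for [x^al y^be z^ga / (x^i y^j)] to lie in L(a P1 + b P2). The
    bounds are integers so that [a - 1] and [b - 1] fit too. *)
Definition tri_ok (n i j : nat) (a b : int) d (u : tri d) : bool :=
  let al := (val u).1%:Z in let ga := (val u).2%:Z in let be := d%:Z - al - ga in
  [&& n%:Z * i%:Z - a <= n%:Z * al + ga,
      i%:Z + n%:Z * j%:Z - b <= al + n%:Z * be & j%:Z <= be + n%:Z * ga].

Lemma tri_inj d (u v : tri d) : (val u).1 = (val v).1 -> (val u).2 = (val v).2 -> u = v.
Proof. by case: u v => [[u1 u2] hu] [[v1 v2] hv] /= e1 e2; apply/val_inj; congr (_, _). Qed.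

Lemma card_tri d (Q : nat -> nat -> bool) :
  #|[pred u : tri d | Q (val u).1 (val u).2]| =
  (\sum_(c < d.+1) \sum_(a < d.+1) ((a + c <= d) && Q a c))%N.
Proof.
rewrite exchange_big pair_bigA /= -(fintype.card_image val_inj).
rewrite -sum1_card big_mkcond /=; apply: eq_bigr => u _.
rewrite (_ : (u \in _) = (u.1 + u.2 <= d)%N && Q u.1 u.2); first by case: (_ && _).
apply/fintype.imageP/andP => [[v Qv ->]|[hu Qu]]; first by rewrite (valP v).
by exists (exist _ u hu).
Qed.

(** The first two bounds become [n - r - 1 + e] and [n - s + e], both at least d. With [al = 0] the
    first could only hold for [ga = d], with [be = 0] the second only for [al = d], and each of
    these monomials violates another condition. The outcome is free of [e]: this is why lowering
    both coefficients by one keeps the dimension. *)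
Lemma pure_gap_cond (n i j r s e al be ga : nat) (d := (i + j)%N) :
  (0 < i)%N -> (0 < j)%N -> (d <= n - 1)%N -> (r <= n - d - 1)%N -> (s <= n - d)%N ->
  (e <= 1)%N -> (al + be + ga = d)%N ->
  [&& n%:Z * i%:Z - (((i - 1) * n + r + 1)%N%:Z - e%:Z) <= n%:Z * al%:Z + ga%:Z,
      i%:Z + n%:Z * j%:Z - (((j - 1) * n + i + s)%N%:Z - e%:Z) <= al%:Z + n%:Z * be%:Z &
      j%:Z <= be%:Z + n%:Z * ga%:Z] =
  [&& (0 < al)%N, (0 < be)%N & (0 < ga)%N || (j <= be)%N].
Proof.
move=> i0 j0 dn rn sn e1 sum.
have -> : n%:Z * i%:Z - (((i - 1) * n + r + 1)%N%:Z - e%:Z) = n%:Z - r%:Z - 1 + e%:Z.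
  by move: i0; clear; case: i => // i _; lia.
have -> : i%:Z + n%:Z * j%:Z - (((j - 1) * n + i + s)%N%:Z - e%:Z) = n%:Z - s%:Z + e%:Z.
  by move: j0; clear; case: j => // j _; lia.
have mul k : (n * k = 0)%N /\ k = 0%N \/ (n <= n * k)%N /\ (0 < k)%N.
  by case: k => [|k]; [left; rewrite muln0 | right; rewrite leq_pmulr].
have := mul al; have := mul be; have := mul ga; rewrite -!PoszM /d in dn rn sn sum *.
move: (n * al)%N (n * be)%N (n * ga)%N => nal nbe nga hga hbe hal.
by apply/and3P/and3P => -[h1 h2 h3]; split; lia.
Qed.

Lemma card_pure_gap (n i j r s e : nat) (d := (i + j)%N) :
  (0 < i)%N -> (0 < j)%N -> (d <= n - 1)%N -> (r <= n - d - 1)%N -> (s <= n - d)%N ->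
  (e <= 1)%N ->
  #|@tri_ok n i j (((i - 1) * n + r + 1)%N%:Z - e%:Z) (((j - 1) * n + i + s)%N%:Z - e%:Z) d| =
  (((d - 1) * (d - 2)) %/ 2 + i)%N.
Proof.
move=> i0 j0 dn rn sn e1.
rewrite (eq_card (B := [pred u : tri d | [&& (0 < (val u).1), (0 < d - (val u).1 - (val u).2)
  & (0 < (val u).2) || (j <= d - (val u).1 - (val u).2)]%N])); last first.
  move=> u; rewrite !inE /= [LHS]/(@tri_ok _ _ _ _ _ _ _) /tri_ok.
  have hu : ((val u).1 + (val u).2 <= d)%N := valP u.
  move: hu; move: (nat_of_ord (val u).1) (nat_of_ord (val u).2) => p q pq.
  rewrite -(@pure_gap_cond n i j r s e) //; last by lia.
  by have -> : (d - p - q)%N%:Z = d%:Z - p%:Z - q%:Z by lia.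
rewrite (@card_tri d (fun a c => [&& 0 < a, 0 < d - a - c & (0 < c) || (j <= d - a - c)]%N)).
(* The monomials with last exponent 0 have [1 <= al <= i]: they are the summand [i]. *)
rewrite big_ord_recl /= addnC; congr (_ + _)%N; last first.
  rewrite (eq_bigr (fun a : 'I_d.+1 => ((1 <= a) && (a < i.+1))%N : nat)) ?sum_interval.
    by rewrite /d; lia.
  by move=> a _; congr (nat_of_bool _); rewrite /d; lia.
(* With last exponent [c + 1], two positive exponents of sum [d - 1 - c] remain. *)
rewrite (eq_bigr (fun c : 'I_d => d - 2 - c)%N) => [|c _].
  have := @sum_triangle d (d - 2); rewrite leq_subr => /(_ isT) h.
  have -> : ((d - 1) * (d - 2) = (\sum_(c < d) (d - 2 - c)) * 2)%N.
    by rewrite [RHS]mulnC h mulnC; congr (_ * _)%N; rewrite /d; lia.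
  by rewrite mulnK.
rewrite (eq_bigr (fun a : 'I_d.+1 => ((1 <= a) && (a < d - 1 - c))%N : nat)) ?sum_interval.
  by have := ltn_ord c; rewrite /d; lia.
by move=> a _; congr (nat_of_bool _); rewrite /bump /=; lia.
Qed.

Lemma card_tri_all n d : d = (n - 1)%N -> (0 < n)%N ->
  (2 * #|@tri_ok n d 0 (n%:Z * d%:Z) d%:Z d| = n * (n + 1))%N.
Proof.
move=> dE n0.
rewrite (eq_card (B := [pred u : tri d | true])); last first.
  move=> u; rewrite !inE /= [LHS]/(@tri_ok _ _ _ _ _ _ _) /tri_ok.
  have := valP u; move: (nat_of_ord (val u).1) (nat_of_ord (val u).2) => a c /= ac.
  rewrite subrr mulr0 addr0 subrr.
  have h k : 0 <= n%:Z * k%:Z by [].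
  have <- : (d - a - c)%N%:Z = d%:Z - a%:Z - c%:Z by lia.
  by have := h a; have := h c; have := h (d - a - c)%N => h1 h2 h3; apply/and3P; split; lia.
rewrite (@card_tri d (fun _ _ => true)).
rewrite (eq_bigr (fun c : 'I_d.+1 => d.+1 - c)%N) => [|c _].
  by rewrite sum_triangle // dE subn1 prednK.
rewrite (eq_bigr (fun a : 'I_d.+1 => ((0 <= a) && (a < d.+1 - c))%N : nat)) ?sum_interval.
  by have := ltn_ord c; lia.
by move=> a _; congr (nat_of_bool _); have := ltn_ord c; lia.
Qed.

End Counting.

(** * Enumeration of the listed pairs *)

Section PureGapCount.

Local Open Scope nat_scope.

Lemma card_eq_seq (T : eqType) (s : seq T) : uniq s ->
  ([set x | x \in s]%classic #= `I_(size s))%card.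
Proof.
case: s => [_|x0 s us].
  rewrite (_ : [set x | x \in [::]]%classic = set0) ?II0 //.
  by apply/seteqP; split.
set t := x0 :: s in us *.
have -> : [set x | x \in t]%classic = [set nth x0 t k | k in `I_(size t)]%classic.
  apply/seteqP; split => x /=.
    by move=> xt; exists (index x t); rewrite ?index_mem ?nth_index.
  by move=> [k kt <-]; apply: mem_nth.
apply: inj_card_eq => k l; rewrite !inE /= => kt lt /eqP.
by rewrite nth_uniq // => /eqP.
Qed.

Variable n : nat.

(** The indices i and j are shifted to start at 0, so that all four parameters range over ['I_n]. *)
Definition gap_index (u : ('I_n * 'I_n) * ('I_n * 'I_n)) : bool :=
  [&& u.1.1.+1 + u.1.2.+1 <= n - 1, u.2.1 <= n - (u.1.1.+1 + u.1.2.+1) - 1 &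
      u.2.2 <= n - (u.1.1.+1 + u.1.2.+1)].

Definition gap_tuple (u : ('I_n * 'I_n) * ('I_n * 'I_n)) : 2.-tuple nat :=
  [tuple u.1.1 * n + u.2.1 + 1; u.1.2 * n + u.1.1.+1 + u.2.2].

(** The first entry determines i and r by division by n; once i is subtracted, the second determines
    j and s. *)
Lemma gap_tuple_inj : {in gap_index &, injective gap_tuple}.
Proof.
move=> [[i j] [r s]] [[i' j'] [r' s']]; rewrite !unfold_in.
move=> /and3P[/= h1 h2 h3] /and3P[/= h1' h2' h3'].
move=> /(congr1 val) /= [e1 e2].
have [|||||[ei] er] := @decomposition_inj n i.+1 r i'.+1 r'; rewrite ?ltn_ord //.
  by rewrite !subSS !subn0.
have [|||||[ej] es] := @decomposition_inj n j.+1 s j'.+1 s'; rewrite ?ltn_ord //.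
  by move: e2; rewrite !subSS !subn0 ei; lia.
by congr ((_, _), (_, _)); apply/val_inj.
Qed.

Definition gap_seq : seq (2.-tuple nat) := [seq gap_tuple u | u <- enum gap_index].

Lemma gap_seq_uniq : uniq gap_seq.
Proof.
rewrite map_inj_in_uniq ?enum_uniq // => u v; rewrite !mem_enum => hu hv.
exact: gap_tuple_inj.
Qed.

Lemma size_gap_seq : 12 * size gap_seq = (n - 2) * (n - 1) * n * (n + 1).
Proof.
rewrite size_map -cardE -sum_pure_gaps; congr (12 * _).
rewrite -sum1_card big_mkcond /=.
transitivity (\sum_(p : 'I_n * 'I_n) \sum_(q : 'I_n * 'I_n) (gap_index (p, q) : nat)).
  rewrite pair_bigA /=; apply: eq_bigr => -[p q] _.
  by case: (boolP (gap_index (p, q))) => [|/negbTE] h; rewrite unfold_in [X in if X then _ else _]h.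
transitivity (\sum_(i < n) \sum_(j < n) \sum_(q : 'I_n * 'I_n) (gap_index ((i, j), q) : nat)).
  by rewrite [RHS]pair_bigA /=; apply: eq_bigr => -[i j] _.
apply: eq_bigr => i _; apply: eq_bigr => j _.
have hr := sum_interval n 0 (n - (i + j + 2)).
have hs := sum_interval n 0 (n + 1 - (i + j + 2)).
rewrite subn0 (minn_idPl _) in hr; last by lia.
rewrite subn0 (minn_idPl _) in hs; last by lia.
rewrite -hr -hs big_distrlr pair_bigA /=; apply: eq_bigr => -[r s] _ /=.
rewrite /gap_index /=; clear.
move: (nat_of_ord i) (nat_of_ord j) (nat_of_ord r) (nat_of_ord s) => {}i {}j {}r {}s.
have -> : [&& i.+1 + j.+1 <= n - 1, r <= n - (i.+1 + j.+1) - 1 & s <= n - (i.+1 + j.+1)]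
   = (r < n - (i + j + 2)) && (s < n + 1 - (i + j + 2)) by lia.
by case: (r < _); case: (s < _).
Qed.

Lemma mem_gap_seq (ab : 2.-tuple nat) : ab \in gap_seq <-> exists i j r s : nat,
  [/\ (1 <= i), (1 <= j), (i + j <= n - 1),
     (r <= n - (i + j) - 1) /\ (s <= n - (i + j))
   & ab = [tuple ((i - 1) * n + r + 1)%N; ((j - 1) * n + i + s)%N]].
Proof.
split=> [/mapP[[[i j] [r s]]]|[i [j [r [s [i0 j0 ij [hr hs] ->]]]]]].
  rewrite mem_enum unfold_in => /and3P[/= h1 h2 h3] ->.
  by exists i.+1, j.+1, r, s; split=> //; rewrite /gap_tuple /= !subSS !subn0.
have hi : i - 1 < n by lia.
have hj : j - 1 < n by lia.
have hr' : r < n by lia.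
have hs' : s < n by lia.
apply/mapP; exists ((Ordinal hi, Ordinal hj), (Ordinal hr', Ordinal hs')).
  by rewrite mem_enum unfold_in /gap_index /=; apply/and3P; split; lia.
by apply/val_inj; rewrite /= subn1 prednK // -subn1.
Qed.

End PureGapCount.

(** * Pure gaps *)

(** The arithmetic that ends [riemann]: [S] counts gap values, [a] and [b] are the sizes of the
    effective parts, [l] the copies of [P1] added. *)
Lemma degree_bound (S a b k l N n : nat) (d e : int) :
  (N.+1 - S + a <= k + (b + l))%N -> l%:Z = N%:Z - e -> d + b%:Z = e + a%:Z ->
  2%:Z * S%:Z <= n%:Z * (n%:Z - 1) -> 2 * (d + 1 - k%:Z) <= n%:Z * (n%:Z - 1).
Proof. by move=> h1 h2 h3 h4; apply: le_trans h4; rewrite ler_pM2l //; lia. Qed.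

Section FlexTriangle.

Context {K : closedFieldType} {n : nat} {X : smooth_plane_curve K (n + 1)}.
Hypothesis n_gt2 : (2 < n)%N.
Local Notation F := (curve_form X).
Context {L : fieldType} (phi : {rmorphism {mpoly K[3]} -> L}).
Hypothesis phi_eq0 : forall G, phi G = 0 <-> mdvd F G.
Local Notation cst := (cst phi).
Local Notation has_order := (has_order phi).
Local Notation "G @@ P" := (mpoly_at G (val P)) (at level 30).
Local Notation at_neq0 := (at_neq0 phi_eq0).
Local Notation RR := (@RR K (n + 1) X L phi).
Local Notation vge := (vge phi).

Implicit Types (G H A B : {mpoly K[3]}) (P Q : curve_point X) (f g : L)
  (D : divisor X).

Let m_gt1 : (1 < n + 1)%N. Proof. by rewrite addn1 ltnS (ltn_trans _ n_gt2). Qed.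

Variables (P1 P2 P3 : curve_point X) (l1 l2 l3 : proj_plane K).
Hypotheses (hl12 : l1 <> l2) (hl23 : l2 <> l3) (hl31 : l3 <> l1).
Hypothesis hl1 : cut_out phi 1 (line_form l1) (<< n%:Z *g P1 >> + << P2 >>).
Hypothesis hl2 : cut_out phi 1 (line_form l2) (<< n%:Z *g P2 >> + << P3 >>).
Hypothesis hl3 : cut_out phi 1 (line_form l3) (<< n%:Z *g P3 >> + << P1 >>).

Lemma cut_out_order (l : proj_plane K) D Q i : cut_out phi 1 (line_form l) D ->
  'X_i @@ Q = 1 -> has_order Q (phi (line_form l) / phi 'X_i) (coeff Q D).
Proof.
move=> cl iQ; apply: cl; first by rewrite dhomogX /= mdeg1.
by rewrite iQ oner_eq0.
Qed.

Lemma exists_coord (Q : curve_point X) : exists i, 'X_i @@ Q = 1.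
Proof.
by have [i [iQ _]] := normalizedP (val Q); exists i; rewrite /mpoly_at mevalXU.
Qed.

Lemma cut_out_neq (l l' : proj_plane K) (A B A' B' : curve_point X) : l <> l' ->
  cut_out phi 1 (line_form l) (<< n%:Z *g A >> + << B >>) ->
  cut_out phi 1 (line_form l') (<< n%:Z *g A' >> + << B' >>) -> A != A'.
Proof.
move=> ll' cl cl'; apply/eqP => AA; apply: ll'; rewrite -AA in cl'.
have [i iA] := exists_coord A.
have big (C : curve_point X) : (1 : int) < coeff A (<< n%:Z *g A >> + << C >>).
  rewrite coeffD !coeffU eqxx mulr1 mul1r; case: (C == A) => /=; lia.
apply: (tangent_unique m_gt1 phi_eq0 iA (big B) (big B')); exact: cut_out_order.
Qed.

Let P12 : P1 != P2. Proof. exact: cut_out_neq hl12 hl1 hl2. Qed.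
Let P23 : P2 != P3. Proof. exact: cut_out_neq hl23 hl2 hl3. Qed.
Let P31 : P3 != P1. Proof. exact: cut_out_neq hl31 hl3 hl1. Qed.

Let x := phi (line_form l1).
Let y := phi (line_form l2).
Let z := phi (line_form l3).

Definition mon (p q r : int) : L := x ^ p * y ^ q * z ^ r.

Definition mon_ord (Q : curve_point X) (p q r : int) : int :=
  if Q == P1 then n%:Z * p + r else if Q == P2 then p + n%:Z * q
  else if Q == P3 then q + n%:Z * r else 0.

Lemma line_neq0 (l : proj_plane K) D : cut_out phi 1 (line_form l) D ->
  phi (line_form l) != 0.
Proof.
move=> cl; have [i iP] := exists_coord P1.
have := order_neq0 m_gt1 phi_eq0 (cut_out_order cl iP).
by apply: contraNneq => ->; rewrite mul0r.
Qed.

Let x0 : x != 0. Proof. exact: line_neq0 hl1. Qed.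
Let y0 : y != 0. Proof. exact: line_neq0 hl2. Qed.
Let z0 : z != 0. Proof. exact: line_neq0 hl3. Qed.

(** A monomial of nonzero degree is not a function; a power of a coordinate equal to 1 at [Q]
    corrects the degree and leaves the order alone. *)
Lemma mon_orderP Q i p q r : 'X_i @@ Q = 1 ->
  has_order Q (mon p q r * phi 'X_i ^ (- (p + q + r))) (mon_ord Q p q r).
Proof.
move=> iQ.
have s0 : phi 'X_i != 0 by apply: (@at_neq0 _ Q); rewrite iQ oner_eq0.
have ox := orderXz m_gt1 phi_eq0 p (cut_out_order hl1 iQ).
have oy := orderXz m_gt1 phi_eq0 q (cut_out_order hl2 iQ).
have oz := orderXz m_gt1 phi_eq0 r (cut_out_order hl3 iQ).
have := orderM m_gt1 phi_eq0 (orderM m_gt1 phi_eq0 ox oy) oz.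
rewrite -/x -/y -/z !expfzMl !exprz_inv.
have gen (a b c a' b' c' : L) : a * a' * (b * b') * (c * c') = a * b * c * (a' * b' * c').
  by ring.
rewrite gen -!expfzDr // -!opprD.
suff -> : mon_ord Q p q r = coeff Q (<< n%:Z *g P1 >> + << P2 >>) * p +
   coeff Q (<< n%:Z *g P2 >> + << P3 >>) * q + coeff Q (<< n%:Z *g P3 >> + << P1 >>) * r by [].
rewrite !coeffD !coeffU /mon_ord !mul1r ![_ == Q]eq_sym.
have [->|Q1] := eqVneq Q P1.
  by rewrite (negbTE P12) eq_sym (negbTE P31) /=; ring.
have [->|Q2] := eqVneq Q P2.
  by rewrite (negbTE P23) /=; ring.
by have [_|_] := eqVneq Q P3; rewrite /=; ring.
Qed.

Lemma mon_order0 Q p q r : p + q + r = 0 -> has_order Q (mon p q r) (mon_ord Q p q r).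
Proof.
move=> s0; have [i iQ] := exists_coord Q.
by have := mon_orderP p q r iQ; rewrite s0 oppr0 expr0z mulr1.
Qed.

(** At [P3] the three lines have the distinct orders 0, 1 and n, so they are independent, hence a
    basis of the linear forms. *)
Lemma lines_span : forall j, exists b1 b2 b3 : K,
  'X_j = b1 *: line_form l1 + b2 *: line_form l2 + b3 *: line_form l3.
Proof.
pose l i := if i == 0 :> 'I_3 then l1 else if i == 1 then l2 else l3.
pose M : 'M[K]_3 := \matrix_(i, j) val (l i) 0 j.
have lE k : line_form (l k) = \sum_i M k i *: 'X_i.
  by apply: eq_bigr => i _; rewrite mxE.
have fM : row_free M.
  rewrite -kermx_eq0; apply/eqP/row_matrixP => k; rewrite row0.
  set c := row k _; have cM : c *m M = 0 by rewrite -row_mul mulmx_ker row0.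
  have [i iP] := exists_coord P3.
  pose f (j : 'I_3) := phi (line_form (l j)) / phi 'X_i.
  pose o (j : 'I_3) : int := if j == 0 then 0 else if j == 1 then 1 else n%:Z.
  have hof j : has_order P3 (f j) (o j).
    have h1 := cut_out_order hl1 iP; have h2 := cut_out_order hl2 iP.
    have h3 := cut_out_order hl3 iP.
    rewrite !coeffD !coeffU !eqxx ![_ == P3]eq_sym in h1 h2 h3.
    rewrite (negbTE P31) [P3 == P2]eq_sym (negbTE P23) in h1 h2 h3.
    rewrite /= !mulr0 !mulr1 ?addr0 ?add0r in h1 h2 h3.
    by rewrite /f /o /l; case: j => [[|[|[|//]]] ?].
  have oinj : injective o.
    move=> [[|[|[|//]]] ?] [[|[|[|//]]] ?] h; apply/val_inj => //;
      exfalso; move: h; rewrite /o /=; lia.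
  apply/rowP => j; rewrite [RHS]mxE.
  apply: (@sum_order_indep _ _ _ m_gt1 _ _ phi_eq0 _ P3 f o (fun j => c 0 j)) => //.
  rewrite /f; under eq_bigr => k' _ do rewrite mulrA.
  rewrite -mulr_suml [X in X / _](_ : _ = 0) ?mul0r //.
  have -> : \sum_k' cst (c 0 k') * phi (line_form (l k')) =
      phi (\sum_k' c 0 k' *: line_form (l k')).
    by rewrite rmorph_sum; apply: eq_bigr => k' _; rewrite -mul_mpolyC rmorphM.
  rewrite [X in phi X](_ : _ = 0) ?rmorph0 //.
  under eq_bigr => k' _ do rewrite lE scaler_sumr.
  rewrite exchange_big big1 // => i' _ /=.
  under eq_bigr => k' _ do rewrite scalerA.
  rewrite -scaler_suml; have := congr1 (fun A : 'rV[K]_3 => A 0 i') cM.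
  by rewrite !mxE => ->; rewrite scale0r.
have uM : M \in unitmx by rewrite -row_free_unit.
move=> j; pose B := invmx M.
exists (B j 0), (B j 1), (B j 2%:R).
have := sum_ord3 (fun k => B j k *: line_form (l k)) => /= <-.
under eq_bigr => k _ do rewrite lE scaler_sumr.
rewrite exchange_big /= (bigD1 j) //= [X in _ + X]big1 => [|i ij].
  rewrite addr0 -[LHS]scale1r.
  have := congr1 (fun A : 'M[K]_3 => A j j) (mulVmx uM); rewrite !mxE eqxx mulr1n => <-.
  by rewrite scaler_suml; apply: eq_bigr => k _; rewrite scalerA.
have := congr1 (fun A : 'M[K]_3 => A j i) (mulVmx uM); rewrite !mxE eq_sym (negbTE ij) => e.
under eq_bigr => k _ do rewrite scalerA.
by rewrite -scaler_suml e scale0r.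
Qed.

Lemma forms_span d G (V : set L) : G \is d.-homog -> subspace cst V ->
  (forall a b c : nat, (a + b + c = d)%N -> V (mon a b c)) -> V (phi G).
Proof.
move=> hG; move: G hG V.
apply: (@dhomog_ind _ (fun G => forall V : set L, subspace cst V ->
  (forall a b c : nat, (a + b + c = d)%N -> V (mon a b c)) -> V (phi G))).
- by move=> V [V0 _] _; rewrite rmorph0.
- move=> a A B hA hB V sV hV.
  rewrite rmorphD -mul_mpolyC rmorphM; case: (sV) => _; apply; [exact: hA|exact: hB].
move: d; apply: (@mnm_ind (fun d m => forall V : set L, subspace cst V ->
  (forall a b c : nat, (a + b + c = d)%N -> V (mon a b c)) -> V (phi 'X_[m]))).
  move=> V sV /(_ 0 0 0)%N; rewrite /mon !expr0z !mulr1 mpolyX0 rmorph1; exact.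
move=> d i m hm IH V sV hV; rewrite mpolyXD rmorphM.
have [b1 [b2 [b3 ->]]] := lines_span i.
rewrite -!mul_mpolyC !rmorphD !rmorphM /= -/x -/y -/z -![phi _%:MP]/(cst _).
have comb (u v w : L) : V u -> V v -> V w -> V (cst b1 * u + cst b2 * v + cst b3 * w).
  move=> Vu Vv Vw; have [V0 VD] := sV; rewrite -addrA; apply: (VD) => //.
  by apply: (VD) => //; apply: subspaceZ.
rewrite !mulrDl -!mulrA.
(* The induction runs over all subspaces [V], so it applies to the [g] with [t * g] in [V]. *)
have step t : t != 0 -> (forall a b c : nat, (a + b + c = d)%N -> V (t * mon a b c)) ->
    V (t * phi 'X_[m]).
  move=> t0 ht; apply: (IH (fun g => V (t * g))) => //.
  have [V0 VD] := sV; split; first by rewrite mulr0.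
  by move=> a f g Vf Vg; rewrite mulrDr mulrCA; apply: (VD).
have ids (t u v w : L) : [/\ t * (u * v * w) = t * u * v * w,
    t * (u * v * w) = u * (t * v) * w & t * (u * v * w) = u * v * (t * w)].
  by split; ring.
apply: comb; apply: step => // a b c abc; rewrite /mon.
- have := hV a.+1 b c; rewrite !addSn abc /mon => /(_ erefl).
  by rewrite -(exprnP x a.+1) exprS; case: (ids x (x ^+ a) (y ^ b) (z ^ c)) => <-.
- have := hV a b.+1 c; rewrite addnS addSn abc /mon => /(_ erefl).
  by rewrite -(exprnP y b.+1) exprS; case: (ids y (x ^ a) (y ^+ b) (z ^ c)) => _ <-.
- have := hV a b c.+1; rewrite addnS abc /mon => /(_ erefl).
  by rewrite -(exprnP z c.+1) exprS; case: (ids z (x ^ a) (y ^ b) (z ^+ c)) => _ _ <-.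
Qed.

Definition tri_mon i j d (u : tri d) : L :=
  mon ((val u).1%:Z - i%:Z) (d%:Z - (val u).1%:Z - (val u).2%:Z - j%:Z) (val u).2.

Lemma coeffPQ (a b : int) Q : coeff Q (<< a *g P1 >> + << b *g P2 >>) =
  if Q == P1 then a else if Q == P2 then b else 0.
Proof.
rewrite coeffD !coeffU ![_ == Q]eq_sym.
have [->|_] := eqVneq Q P1; first by rewrite (negbTE P12) /= mulr1 mulr0 addr0.
by have [_|_] := eqVneq Q P2; rewrite /= ?mulr1 ?mulr0 ?add0r.
Qed.

Lemma tri_ord_inj Q i j d : (d < n)%N -> [\/ Q = P1, Q = P2 | Q = P3] ->
  injective (fun u : tri d => mon_ord Q ((val u).1%:Z - i%:Z)
    (d%:Z - (val u).1%:Z - (val u).2%:Z - j%:Z) (val u).2).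
Proof.
move=> dn hQ u v.
have ed : (val u).1 = (val v).1 :> nat /\ (val u).2 = (val v).2 :> nat -> u = v.
  by move=> [e1 e2]; apply: tri_inj; apply/val_inj.
have [e1 [e2 e3]] := digits_inj i j dn (valP u) (valP v).
rewrite /mon_ord; case: ifP => [_ /e1/ed //|/eqP Q1].
by case: ifP => [_ /e2/ed //|/eqP Q2]; case: ifP => [_ /e3/ed //|/eqP Q3]; case: hQ.
Qed.

Lemma mon_ordE p q r : [/\ mon_ord P1 p q r = n%:Z * p + r,
  mon_ord P2 p q r = p + n%:Z * q & mon_ord P3 p q r = q + n%:Z * r].
Proof.
rewrite /mon_ord !eqxx [P2 == _]eq_sym (negbTE P12) (negbTE P31).
by rewrite [P3 == _]eq_sym (negbTE P23).
Qed.

Lemma tri_mon_order Q i j d (u : tri d) : (i + j = d)%N ->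
  has_order Q (tri_mon i j u) (mon_ord Q ((val u).1%:Z - i%:Z)
    (d%:Z - (val u).1%:Z - (val u).2%:Z - j%:Z) (val u).2).
Proof. by move=> ij; apply/mon_order0/tri_degree. Qed.

Lemma monM p q r p' q' r' : mon p q r * mon p' q' r' = mon (p + p') (q + q') (r + r').
Proof.
rewrite /mon !expfzDr //.
by rewrite [LHS]mulrACA; congr (_ * _); rewrite [LHS]mulrACA.
Qed.

Lemma mon_neq0 p q r : mon p q r != 0.
Proof. by rewrite !mulf_neq0 // expfz_neq0. Qed.

(** The bounds on [a] and [b] say that [x^i y^j] absorbs the allowed poles; i + j = d < n keeps the
    orders of the monomials distinct. *)
Lemma RR_basis i j d (a b : int) : (i + j = d)%N -> (d < n)%N ->
  a <= n%:Z * i%:Z -> b <= i%:Z + n%:Z * j%:Z ->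
  basis_dim cst (RR (<< a *g P1 >> + << b *g P2 >>)) #|@tri_ok n i j a b d|.
Proof.
move=> ij dn ha hb; apply: (@basis_fin _ _ _ _ (@tri_mon i j d)).
- move=> c; apply: (@sum_order_indep _ _ _ m_gt1 _ _ phi_eq0 _ P1).
    by move=> u; apply: tri_mon_order.
  by apply: tri_ord_inj => //; apply: Or31.
- move=> u /and3P[h1 h2 h3]; apply/RRP; split.
    exact: has_order_ratfun (tri_mon_order P1 u ij).
  move=> Q; right; eexists; first exact: tri_mon_order.
  rewrite coeffPQ /mon_ord; case: ifP => _; first lia.
  case: ifP => _; first lia.
  rewrite oppr0; case: ifP => _ //; lia.
move=> f /RRP[rf vf].
(* [f x^i y^j] has no poles, so it is a form of degree [d]. *)
have [|G hG fG] := @complete_forms _ _ _ m_gt1 _ _ phi_eq0 P1 d (f * mon i j 0).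
  move=> Q; have [k kQ] := exists_coord Q.
  have v0 : vge Q 0 (f * (mon i j 0 * phi 'X_k ^ (- (i%:Z + j%:Z + 0)))).
    have := vgeM m_gt1 phi_eq0 (vf Q) (has_order_vge (mon_orderP i j 0 kQ)).
    apply: vge_le; rewrite coeffPQ /mon_ord; case: ifP => _; first lia.
    case: ifP => _; first lia.
    by rewrite oppr0; case: ifP.
  have [e [G [H [hG hH HQ E]]]] := proj1 (vge_regular m_gt1 phi_eq0 Q _) v0.
  have s0 : phi 'X_k != 0 by apply: (@at_neq0 _ Q); rewrite kQ oner_eq0.
  exists e, H, (G * 'X_k ^+ d); split=> //.
    have hX : ('X_k : {mpoly K[3]}) \is 1.-homog by rewrite dhomogX /= mdeg1.
    by have := dhomogM hG (dhomogMn d hX); rewrite mul1n.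
  have H0 := at_neq0 HQ.
  have sd : phi 'X_k ^ (- (i%:Z + j%:Z + 0)) * phi 'X_k ^+ d = 1.
    by rewrite addr0 -PoszD ij exprnP -expfzDr // addNr expr0z.
  have -> : f * mon i j 0 = f * (mon i j 0 * phi 'X_k ^ (- (i%:Z + j%:Z + 0))) * phi 'X_k ^+ d.
    by rewrite -[RHS]mulrA -[X in _ = f * X]mulrA sd mulr1.
  by rewrite E rmorphM rmorphXn /= mulrA mulrCA mulfV // mulr1.
have [c fE] : exists c : tri d -> K, f = \sum_u cst (c u) * tri_mon i j u.
  pose V := [set g : L | exists c : tri d -> K,
    g = (\sum_u cst (c u) * tri_mon i j u) * mon i j 0]%classic.
  have [] : V (phi G); last first.
    by move=> c; rewrite -fG => /(mulIf (mon_neq0 _ _ _)) ->; exists c.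
  apply: (forms_span hG).
    split; first by exists (fun=> 0); rewrite big1 ?mul0r // => u _; rewrite rmorph0 mul0r.
    move=> k g g' [c ->] [c' ->]; exists (fun u => k * c u + c' u).
    rewrite mulrA -mulrDl mulr_sumr -big_split; congr (_ * _); apply: eq_bigr => u _ /=.
    by rewrite rmorphD rmorphM mulrDl mulrA.
  move=> p q r pqr; have hp : (p < d.+1)%N by rewrite ltnS -pqr -addnA leq_addr.
  have hr : (r < d.+1)%N by rewrite ltnS -pqr leq_addl.
  have hpr : ((Ordinal hp, Ordinal hr).1 + (Ordinal hp, Ordinal hr).2 <= d)%N.
    by rewrite /= -pqr addnAC leq_addr.
  pose u : tri d := exist _ (Ordinal hp, Ordinal hr) hpr.
  exists (fun v => (v == u)%:R).
  rewrite (bigD1 u) //= eqxx big1 => [|v /negbTE ->]; last by rewrite rmorph0 mul0r.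
  rewrite rmorph1 mul1r addr0 /tri_mon monM /=; congr (mon _ _ _); rewrite -?pqr ?PoszD; ring.
(* Orders being distinct at each of the three points, no cancellation occurs: every monomial present
   in [f] satisfies the bounds itself. *)
exists c; split=> // u; apply: contraNeq => cu.
have ge Q : [\/ Q = P1, Q = P2 | Q = P3] -> - coeff Q (<< a *g P1 >> + << b *g P2 >>) <=
    mon_ord Q ((val u).1%:Z - i%:Z) (d%:Z - (val u).1%:Z - (val u).2%:Z - j%:Z) (val u).2.
  move=> hQ; move: (vf Q); rewrite fE => vQ.
  apply: (sum_order_ge m_gt1 phi_eq0 (fun u => tri_mon_order Q u ij) _ vQ) => //.
  exact: tri_ord_inj.
have [o1 o2 o3] := mon_ordE ((val u).1%:Z - i%:Z)
  (d%:Z - (val u).1%:Z - (val u).2%:Z - j%:Z) (val u).2.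
have P21 : (P2 == P1) = false by rewrite eq_sym (negbTE P12).
have P32 : (P3 == P2) = false by rewrite eq_sym (negbTE P23).
have := ge _ (Or31 _ _ erefl); have := ge _ (Or32 _ _ erefl).
have := ge _ (Or33 _ _ erefl).
rewrite o1 o2 o3 !coeffPQ P21 P32 (negbTE P31) !eqxx => g3 g2 g1.
exact: order_bounds g1 g2 g3.
Qed.

(* The monomial [x ^ (n ^ 2) y ^ (- n) z], of degree [n ^ 2 - n + 1], vanishes only
   at [P1]; it replaces the power of a line as a denominator. *)
Let M := mon (n%:Z * n%:Z) (- n%:Z) 1.

Lemma M_ord Q : Q != P1 -> mon_ord Q (n%:Z * n%:Z) (- n%:Z) 1 = 0.
Proof.
rewrite /mon_ord => /negbTE ->; case: ifP => _; first by rewrite mulrN subrr.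
by case: ifP => _ //; rewrite mulr1 addNr.
Qed.

(** The exponent is deg M + 1 - n, which gives [A 'X_i ^ eM / (b M)] degree 0 when [A] has degree n
    and [b] is a line. *)
Let eM := n%:Z * n%:Z - n%:Z + 1 + 1 - n%:Z.

Lemma M_frac (s t a b mm : L) : s != 0 -> t != 0 -> b != 0 -> mm != 0 ->
  a * t ^ eM / (b * mm) = (a / s ^+ n) * (t / s) ^ eM * (b / s)^-1 *
    (mm * s ^ (- (n%:Z * n%:Z + - n%:Z + 1)))^-1.
Proof.
move=> s0 t0 b0 mm0.
have e : s ^+ n * s ^ eM = s * s ^ (n%:Z * n%:Z + - n%:Z + 1).
  rewrite exprnP -expfzDr // -[X in X * _]expr1z -expfzDr //; congr (_ ^ _).
  by rewrite /eM; ring.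
rewrite invf_div [(mm * _)^-1]invfM invr_expz opprK expfzMl exprz_inv.
have z1 : s ^+ n != 0 by apply: expf_neq0.
have z2 : s ^ eM != 0 by apply: expfz_neq0.
have z3 : s ^ (n%:Z * n%:Z + - n%:Z + 1) != 0 by apply: expfz_neq0.
move: e; rewrite -invr_expz.
move: z1 z2 z3; move: (s ^+ n) (s ^ eM) (s ^ (n%:Z * n%:Z + - n%:Z + 1)) (t ^ eM).
move=> u v w t' u0 v0 w0 e.
have -> : w = u * v / s by rewrite e [s * w]mulrC mulfK.
by field; rewrite u0 v0 s0 b0 mm0.
Qed.

(** The function is [A 'X_i ^ eM / (b M)], with [A] and [b] from the local frame: at [P], [A] is
    invertible and [b] is a uniformizer, while [M] vanishes only at [P1]. *)
Lemma simple_pole P : P != P1 -> exists2 f,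
  has_order P f (-1) & forall Q, Q != P -> Q != P1 -> vge Q 0 f.
Proof.
move=> PP1.
have [i [a [b [A [B [[iP aP bP bk AP] [hA hB FE dec QP]]]]]]] := local_frame P.
rewrite addn1 /= in hA hB.
have i0 : 'X_i @@ P != 0 by rewrite iP oner_eq0.
have t0 : phi 'X_i != 0 := at_neq0 i0.
have b0 : phi (lform b) != 0 := phi_lform_neq0 m_gt1 phi_eq0 bk.
have M0 : M != 0 := mon_neq0 _ _ _.
have hX k : ('X_k : {mpoly K[3]}) \is 1.-homog by rewrite dhomogX /= mdeg1.
have hXn k d : ('X_k ^+ d : {mpoly K[3]}) \is d.-homog.
  by have := dhomogMn d (hX k); rewrite mul1n.
exists (phi A * phi 'X_i ^ eM / (phi (lform b) * M)).
  rewrite (M_frac (s := phi 'X_i)) // divff // exp1rz mulr1.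
  have oA : has_order P (phi A / phi 'X_i ^+ n) 0.
    apply: (lunit_order m_gt1 phi_eq0); apply/(unitP phi_eq0).
    exists n, A, ('X_i ^+ n); split=> //; last by rewrite rmorphXn.
    by rewrite atX expf_neq0.
  have ob : has_order P (phi (lform b) / phi 'X_i) 1.
    exists (phi (lform b) / phi 'X_i), 1; split.
    - apply: (frame_uniformizing phi_eq0 iP bP AP _ _ FE dec); by rewrite addn1.
    - exact: unit1.
    - by rewrite mul1r expr1z.
  have := orderM m_gt1 phi_eq0 (orderM m_gt1 phi_eq0 oA (orderV phi_eq0 ob))
    (orderV phi_eq0 (mon_orderP (n%:Z * n%:Z) (- n%:Z) 1 iP)).
  by rewrite M_ord // oppr0 addr0 add0r.
move=> Q QP' QP1; have [k kQ] := exists_coord Q.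
have k0 : 'X_k @@ Q != 0 by rewrite kQ oner_eq0.
have s0 : phi 'X_k != 0 := at_neq0 k0.
have regQ (b' : 'I_3 -> K) A' : A' \is n.-homog -> lform b' @@ Q != 0 ->
    vge Q 0 (phi A' * phi 'X_i ^ eM / (phi (lform b') * M)).
  move=> hA' b'Q; have b'0 := at_neq0 b'Q.
  rewrite (M_frac (s := phi 'X_k)) //.
  have v1 : vge Q 0 (phi A' / phi 'X_k ^+ n).
    apply/(vge_regular m_gt1 phi_eq0); exists n, A', ('X_k ^+ n); split=> //.
      by rewrite atX expf_neq0.
    by rewrite rmorphXn.
  have v2 : vge Q 0 ((phi 'X_i / phi 'X_k) ^ eM).
    have [e ->] : exists e : nat, eM = e.
      have : 0 <= eM.
        rewrite /eM; have : 0 <= (n%:Z - 1) * (n%:Z - 1) by rewrite -expr2 sqr_ge0.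
        by clear; lia.
      by case: eM => // e _; exists e.
    apply/(vge_regular m_gt1 phi_eq0); rewrite -exprnP; apply: regularX.
    by exists 1%N, 'X_i, 'X_k.
  have v3 : vge Q 0 (phi (lform b') / phi 'X_k)^-1.
    rewrite invf_div; apply/(vge_regular m_gt1 phi_eq0).
    by exists 1%N, 'X_k, (lform b'); split=> //; apply: lform_homog.
  have v4 := has_order_vge (orderV phi_eq0 (mon_orderP (n%:Z * n%:Z) (- n%:Z) 1 kQ)).
  rewrite M_ord // oppr0 in v4.
  have := vgeM m_gt1 phi_eq0 (vgeM m_gt1 phi_eq0 (vgeM m_gt1 phi_eq0 v1 v2) v3) v4.
  by rewrite !addr0.
have [bQ|bQ] := eqVneq (lform b @@ Q) 0; last exact: regQ.
have aQ : lform a @@ Q != 0.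
  by apply: contraNneq QP' => aQ; apply/eqP/val_inj; apply: QP.
have a0 : phi (lform a) != 0 := at_neq0 aQ.
(* At another zero of [b], the relation [A a = - B b] trades the denominator [b] for [a], which is
   nonzero away from [P]. *)
have -> : phi A * phi 'X_i ^ eM / (phi (lform b) * M) =
   phi (- B) * phi 'X_i ^ eM / (phi (lform a) * M).
  have e : phi A * phi (lform a) = phi (- B) * phi (lform b).
    have := phi_curve phi_eq0; rewrite FE rmorphD !rmorphM rmorphN mulNr => /eqP.
    by rewrite addr_eq0 => /eqP.
  apply/eqP; rewrite (eqr_div _ _ (mulf_neq0 b0 M0) (mulf_neq0 a0 M0)); apply/eqP.
  rewrite mulrAC [phi A * _]mulrA e; move: (phi (- B)) (phi (lform b)) (phi 'X_i ^ eM).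
  by clear; move=> u v w; ring.
have hNB : - B \is n.-homog by rewrite rpredN.
exact: (regQ a (- B) hNB aQ).
Qed.

Lemma pole_function P k : P != P1 -> exists2 f,
  has_order P f (- k%:Z) & forall Q, Q != P -> Q != P1 -> vge Q 0 f.
Proof.
move=> /simple_pole[f fP fQ]; exists (f ^+ k).
  by have := orderXz m_gt1 phi_eq0 k fP; rewrite mulN1r.
move=> Q h1 h2; apply/(vge_regular m_gt1 phi_eq0)/regularX.
exact/(vge_regular m_gt1 phi_eq0)/fQ.
Qed.

(** * Riemann's inequality and the value of the genus *)

Definition divisor_of (s : seq (curve_point X)) : divisor X := \sum_(P <- s) << P >>.

Lemma coeff_divisor_of Q s : coeff Q (divisor_of s) = (count_mem Q s)%:Z.
Proof.
rewrite /divisor_of; elim: s => [|P s IH]; first by rewrite big_nil coeff0.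
by rewrite big_cons coeffD coeffU IH mul1r /= PoszD; case: (P == Q).
Qed.

Lemma deg_divisor_of s : deg (divisor_of s) = (size s)%:Z.
Proof.
rewrite /divisor_of; elim: s => [|P s IH]; first by rewrite big_nil deg0.
by rewrite big_cons degD degU IH /= intS.
Qed.

(** Each pole order up to [N] that is not a gap value contributes one new function. *)
Lemma has_indep_P1 N :
  has_indep cst (RR << N%:Z *g P1 >>) (N.+1 - \sum_(a < N.+1) gap_value n a).
Proof.
have cP k Q : coeff Q << k%:Z *g P1 >> = if Q == P1 then k%:Z else 0.
  by rewrite coeffU eq_sym; case: eqP => _; rewrite ?mulr1 ?mulr0.
elim: N => [|N IH].
  rewrite big_ord_recl big_ord0 /=.
  exists (fun=> 1) => [_|c].
    apply/RRP; split; first exact: has_order_ratfun (order1 m_gt1 phi_eq0 P1).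
    move=> Q; rewrite cP; have -> : (if Q == P1 then 0%:Z else 0) = 0 by case: ifP.
    by rewrite oppr0; apply/has_order_vge/order1.
  rewrite /lcomb big_ord1 mulr1 => /eqP; rewrite fmorph_eq0 => /eqP c0.
  by apply/rowP => i; rewrite ord1 mxE.
have sub : (RR << N%:Z *g P1 >> `<=` RR << N.+1%:Z *g P1 >>)%classic.
  by apply: RR_le => Q; rewrite !cP; case: ifP => _ //; rewrite lez_nat.
have le : (\sum_(a < N.+1) gap_value n a <= N.+1)%N.
  rewrite -[X in (_ <= X)%N]card_ord -sum1_card leq_sum // => i _; exact: leq_b1.
rewrite big_ord_recr /=; move: (\sum_(i < N.+1) gap_value n i)%N IH le => S IH le.
have [gN|gN] := boolP (gap_value n N.+1).
  have -> : (N.+2 - (S + true) = N.+1 - S)%N by rewrite addn1 subSS.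
  exact: has_indep_sub IH.
have -> : (N.+2 - (S + false) = (N.+1 - S).+1)%N by rewrite addn0 subSn.
(* [N.+1] is not a gap value, so [i + r >= n] and [pole_order] gives a monomial regular off [P1]
   with a pole of order exactly [N.+1]. *)
have [|i [r [i0 rn aE]]] := @gap_decomposition n N.+1 _ isT; first exact: ltn_trans n_gt2.
have irn : (n <= i + r)%N.
  move: gN; rewrite /gap_value /= subn1 /= -leqNgt.
  have -> : N = ((i - 1) * n + r)%N by move: aE; rewrite addn1 => -[].
  rewrite divnMDl ?(leq_ltn_trans _ rn) // modnMDl (divn_small rn) (modn_small rn).
  by rewrite addn0; move: i0; clear; lia.
have [p [q [s [pqs h1 h2 h3]]]] := pole_order n_gt2 i0 rn irn.
rewrite -aE in h1.
have oQ Q := mon_order0 Q pqs.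
have [o1 o2 o3] := mon_ordE p q s.
apply: (has_indepS (g := mon p q s)) IH => //.
- exact: (subspace_RR m_gt1 phi_eq0 P1).
- apply/RRP; split; first exact: has_order_ratfun (oQ P1).
  move=> Q; right; exists (mon_ord Q p q s); first exact: oQ.
  rewrite cP /mon_ord; case: ifP => _; first by rewrite h1.
  by rewrite oppr0; case: ifP => _ //; case: ifP.
move=> /RRP[_ /(_ P1)]; rewrite cP eqxx.
case=> [m0|[j oj jN]]; first by have := mon_neq0 p q s; rewrite m0 eqxx.
have := order_uniq m_gt1 phi_eq0 oj (oQ P1); rewrite o1 h1 => je.
by move: jN; rewrite je lerN2 lez_nat ltnn.
Qed.

Let cP1 k Q : coeff Q << k%:Z *g P1 >> = if Q == P1 then k%:Z else 0.
Proof. by rewrite coeffU eq_sym; case: eqP => _; rewrite ?mulr1 ?mulr0. Qed.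

(** Each point added to [s] brings a function whose pole there is one higher than allowed before;
    its order at [P1] is unknown, whence the threshold [N0]. *)
Lemma has_indep_large s : (forall P, P \in s -> P != P1) ->
  exists N0, forall N, (N0 <= N)%N ->
    has_indep cst (RR (<< N%:Z *g P1 >> + divisor_of s))
      (N.+1 - \sum_(a < N.+1) gap_value n a + size s).
Proof.
elim: s => [|P s IH] hs.
  by exists 0%N => N _; rewrite /divisor_of big_nil addr0 addn0; apply: has_indep_P1.
have [|N0 hN0] := IH; first by move=> Q Qs; apply: hs; rewrite inE Qs orbT.
have PP1 : P != P1 by apply: hs; rewrite inE eqxx.
have [f fP fQ] := pole_function (count_mem P s).+1 PP1.
have [e fe] := order_exists m_gt1 phi_eq0 P1 (has_order_ratfun m_gt1 phi_eq0 fP)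
  (order_neq0 m_gt1 phi_eq0 fP).
exists (maxn N0 `|e|%N) => N; rewrite geq_max => /andP[NN0 Ne].
have dE Q : coeff Q (divisor_of (P :: s)) = coeff Q (divisor_of s) + (P == Q)%:Z.
  by rewrite /divisor_of big_cons coeffD coeffU mul1r addrC natz.
rewrite /= [(_ + (size s).+1)%N]addnS; apply: (has_indepS (g := f)) (hN0 N NN0).
- exact: (subspace_RR m_gt1 phi_eq0 P1).
- by apply: RR_le => Q; rewrite !coeffD dE lerD2l lerDl.
- apply/RRP; split; first exact: has_order_ratfun fP.
  move=> Q; rewrite coeffD cP1 dE coeff_divisor_of.
  have [->|QP] := eqVneq Q P.
    by apply: vge_le (has_order_vge fP); rewrite (negbTE PP1) ?eqxx /=; clear; lia.
  have [->|QP1] := eqVneq Q P1.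
    by apply: vge_le (has_order_vge fe); move: Ne; case: (P == P1); clear; lia.
  by apply: vge_le (fQ _ QP QP1); case: (P == Q); clear; lia.
move=> /RRP[_ /(_ P)]; rewrite coeffD cP1 (negbTE PP1) coeff_divisor_of add0r.
case=> [f0|[j oj jN]]; first by have := order_neq0 m_gt1 phi_eq0 fP; rewrite f0 eqxx.
by move: jN; rewrite (order_uniq m_gt1 phi_eq0 oj fP); clear; lia.
Qed.

Lemma divisor_split D : exists s t (e : int), (forall P, P \in s -> P != P1) /\
  D + divisor_of t = << e *g P1 >> + divisor_of s.
Proof.
have dcat s t : divisor_of (s ++ t) = divisor_of s + divisor_of t.
  by rewrite /divisor_of big_cat.
have dnseq k P : divisor_of (nseq k P) = << k%:Z *g P >>.
  elim: k => [|k IH]; first by rewrite /divisor_of big_nil freegU0.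
  by rewrite intS -freegUD -IH /divisor_of big_cons.
rewrite -[D]freeg_sumE; elim: (dom D) => [|P r [s [t [e [hs E]]]]].
  exists [::], [::], 0; split=> //.
  by rewrite big_nil freegU0.
rewrite big_cons; have [->|PP1] := eqVneq P P1.
  exists s, t, (coeff P1 D + e); split=> //.
  by rewrite -addrA E addrA freegUD.
case: (coeff P D) => k.
  exists (nseq k P ++ s), t, e; split.
    by move=> Q; rewrite mem_cat => /orP[/nseqP[->]|/hs].
  by rewrite -addrA E dcat dnseq addrCA.
exists s, (nseq k.+1 P ++ t), e; split=> //.
by rewrite dcat dnseq addrACA E NegzE freegUD addNr freegU0 add0r.
Qed.

Lemma max_indep_add D s k : max_indep cst (RR D) k ->
  max_indep cst (RR (D + divisor_of s)) (k + size s).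
Proof.
elim: s D k => [|P s IH] D k h; first by rewrite /divisor_of big_nil addr0 addn0.
rewrite /divisor_of big_cons addrA /= [(k + _)%N]addnS -addSn; apply: IH.
exact: max_indep_RR.
Qed.

(** [D] is enlarged to [N P1 + s]. The dimension grows by at most the degree added, so the many
    functions of [has_indep_large] force [k] to be large already. *)
Lemma riemann D k : basis_dim cst (RR D) k ->
  2 * (deg D + 1 - k%:Z) <= n%:Z * (n%:Z - 1).
Proof.
move=> /basis_dim_max mk; have [s [t [e [hs E]]]] := divisor_split D.
have [N0 hN0] := has_indep_large hs.
(* The summand with [e] makes [N - e] nonnegative, so that passing to [N] copies of [P1] only adds
   points. *)
pose N := (N0 + `|e|)%N; pose l := `|N%:Z - e|%N.
have lE : l%:Z = N%:Z - e by rewrite /l gez0_abs // /N; lia.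
have := max_indep_add (s := t ++ nseq l P1) mk.
have -> : D + divisor_of (t ++ nseq l P1) = << N%:Z *g P1 >> + divisor_of s.
  rewrite /divisor_of big_cat addrA -/(divisor_of t) E addrAC.
  have -> : \sum_(i <- nseq l P1) << i >> = << l%:Z *g P1 >> :> divisor X.
    elim: l {lE} => [|k' IH]; first by rewrite big_nil freegU0.
    by rewrite intS -freegUD -IH big_cons.
  by rewrite freegUD lE subrKC.
move=> /(_ _ (hN0 N (leq_addr _ _))).
have := congr1 (@deg _) E; rewrite !degD !deg_divisor_of degU => dE.
rewrite size_cat size_nseq => le.
have n0 : (0 < n)%N by rewrite (ltn_trans _ n_gt2).
have := sum_gap_value N.+1 n0; move: le; move: (\sum_(a < N.+1) _)%N => S le.
rewrite -lez_nat !PoszM -subzn // => hS.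
exact: (degree_bound le lE dE hS).
Qed.

Lemma genus_value (g : nat) :
  (forall D k, basis_dim cst (RR D) k -> deg D + 1 - k%:Z <= g%:Z) ->
  (exists D k, basis_dim cst (RR D) k /\ deg D + 1 - k%:Z = g%:Z) ->
  (2 * g = n * (n - 1))%N.
Proof.
move=> gmax [D [k [hk gE]]].
have n0 : (0 < n)%N by rewrite (ltn_trans _ n_gt2).
have nn : (n * (n - 1))%N%:Z = n%:Z * (n%:Z - 1) by rewrite PoszM subzn.
have up : (2 * g <= n * (n - 1))%N.
  by rewrite -lez_nat nn PoszM -gE; apply: riemann.
apply/eqP; rewrite eqn_leq up /=.
have dn : (n - 1 < n)%N by rewrite subn1 ltn_predL.
have ha : n%:Z * (n - 1)%N%:Z <= n%:Z * (n - 1)%N%:Z by [].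
have hb : (n - 1)%N%:Z <= (n - 1)%N%:Z + n%:Z * 0%:Z by rewrite mulr0 addr0.
have /gmax := RR_basis (addn0 _) dn ha hb.
rewrite degD !degU -lez_nat nn; have := card_tri_all (erefl (n - 1)%N) n0.
move: #|_| => c /(congr1 Posz); rewrite !PoszM PoszD -subzn //; clear.
by lia.
Qed.

(** * The pure gaps at [(P1, P2)] *)

Definition pure_gap_at (a b : nat) : Prop :=
  (exists k, basis_dim cst (RR (<< a%:Z *g P1 >> + << b%:Z *g P2 >>)) k /\
     basis_dim cst (RR (<< a%:Z *g P1 >> + << b%:Z *g P2 >> - << P1 >>)) k) /\
  (exists k, basis_dim cst (RR (<< a%:Z *g P1 >> + << b%:Z *g P2 >>)) k /\
     basis_dim cst (RR (<< a%:Z *g P1 >> + << b%:Z *g P2 >> - << P2 >>)) k).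

Lemma RR_pure_dim i j r s d a b : (1 <= i)%N -> (1 <= j)%N -> (i + j = d)%N ->
  (d <= n - 1)%N -> (r <= n - d - 1)%N -> (s <= n - d)%N ->
  a = ((i - 1) * n + r + 1)%N -> b = ((j - 1) * n + i + s)%N ->
  basis_dim cst (RR (<< a%:Z *g P1 >> + << b%:Z *g P2 >>)) (((d - 1) * (d - 2)) %/ 2 + i) /\
  basis_dim cst (RR (<< a%:Z - 1 *g P1 >> + << b%:Z - 1 *g P2 >>))
    (((d - 1) * (d - 2)) %/ 2 + i).
Proof.
move=> i0 j0 <- dn rn sn -> ->.
have dn' : (i + j < n)%N by move: dn i0; clear; lia.
(* The values 0 and 1 of [e] give the two divisors of the statement. *)
have le e : (e <= 1)%N ->
   basis_dim cst (RR (<< ((i - 1) * n + r + 1)%N%:Z - e%:Z *g P1 >> +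
     << ((j - 1) * n + i + s)%N%:Z - e%:Z *g P2 >>)) (((i + j - 1) * (i + j - 2)) %/ 2 + i).
  move=> e1; rewrite -(card_pure_gap i0 j0 dn rn sn e1); apply: RR_basis => //.
    move: i0 rn dn'; case: (i) => // i' _; clear; lia.
  move: j0 sn dn'; case: (j) => // j' _; clear; lia.
by split; [have := le 0%N isT; rewrite !subr0 | apply: (le 1%N)].
Qed.

(** For an unlisted pair, the monomial of [attained] lies in L(D) but not in L(D - P1) or not in L(D
    - P2), so one of the dimensions drops. For a listed pair, L(D - P1) and L(D - P2) lie between
    two spaces of equal dimension. *)
Lemma pure_gap_atP a b : pure_gap_at a b <-> pure_gap_pair n a b.
Proof.
split=> [[[k [hk hk1]] [l [gk gk2]]]|[i [j [r [s [i0 j0 dn [rn sn] [aE bE]]]]]]].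
  have [//|[p [q [r [pqr h1 h2 h3 h4]]]]] := pure_gap_or_attained a b n_gt2.
  have sR D := subspace_RR m_gt1 phi_eq0 P1 D.
  have oQ Q := mon_order0 Q pqr.
  have [o1 o2 o3] := mon_ordE p q r.
  have fD : RR (<< a%:Z *g P1 >> + << b%:Z *g P2 >>) (mon p q r).
    apply/RRP; split; first exact: has_order_ratfun (oQ P1).
    move=> Q; right; exists (mon_ord Q p q r); first exact: oQ.
    rewrite coeffPQ /mon_ord; case: ifP => _ //; case: ifP => _ //.
    by rewrite oppr0; case: ifP.
  have sub P : (RR (<< a%:Z *g P1 >> + << b%:Z *g P2 >> - << P >>) `<=`
      RR (<< a%:Z *g P1 >> + << b%:Z *g P2 >>))%classic.
    by apply: RR_le => Q; rewrite coeffB coeffU mul1r natz lerBlDr lerDl.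
  have contra P : coeff P (<< a%:Z *g P1 >> + << b%:Z *g P2 >>) = - mon_ord P p q r ->
      ~ RR (<< a%:Z *g P1 >> + << b%:Z *g P2 >> - << P >>) (mon p q r).
    move=> cP /RRP[_ /(_ P)]; rewrite coeffB cP coeffU eqxx natz.
    case=> [m0|[j oj jN]]; first by have := mon_neq0 p q r; rewrite m0 eqxx.
    by move: jN; rewrite (order_uniq m_gt1 phi_eq0 oj (oQ P)); clear; lia.
  case: h4 => h4.
    case: (contra P1); first by rewrite coeffPQ eqxx o1 h4 opprK.
    by rewrite -(basis_dim_eq (sR _) (sub P1) hk1 hk).
  case: (contra P2); first by rewrite coeffPQ eq_sym (negbTE P12) eqxx o2 h4 opprK.
  by rewrite -(basis_dim_eq (sR _) (sub P2) gk2 gk).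
have [h1 h2] := RR_pure_dim i0 j0 erefl dn rn sn aE bE.
pose D := << a%:Z *g P1 >> + << b%:Z *g P2 >>.
pose D' := << a%:Z - 1 *g P1 >> + << b%:Z - 1 *g P2 >>.
rewrite /pure_gap_at -/D; rewrite -/D in h1; rewrite -/D' in h2.
have cD' Q : coeff Q D' = coeff Q D - (Q == P1)%:Z - (Q == P2)%:Z.
  rewrite /D /D' !coeffPQ; case: eqP => [->|_]; first by rewrite (negbTE P12) /= subr0.
  by case: eqP => _ /=; rewrite ?subr0.
have sR E := subspace_RR m_gt1 phi_eq0 P1 E.
have sub : (RR D' `<=` RR D)%classic.
  by apply: RR_le => Q; rewrite cD' -addrA gerDl -opprD oppr_le0.
have e : RR D = RR D' := basis_dim_eq (sR D') sub h2 h1.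
have key P : P = P1 \/ P = P2 -> RR (D - << P >>) = RR D.
  move=> hP; apply/seteqP; split.
    by apply: RR_le => Q; rewrite coeffB coeffU mul1r natz lerBlDr lerDl.
  rewrite e; apply: RR_le => Q; rewrite coeffB coeffU natz cD' ![Q == _]eq_sym.
  by rewrite mul1r -addrA -opprD lerD2l lerN2; case: hP => ->; rewrite ?lerDl ?lerDr.
by split; exists ((i + j - 1) * (i + j - 2) %/ 2 + i)%N; rewrite key //; [left|right].
Qed.

Lemma pure_gapP (ab : 2.-tuple nat) :
  (forall j : 'I_2, exists k, basis_dim cst (RR (sum_divisor [tuple P1; P2] ab)) k /\
     basis_dim cst (RR (sum_divisor [tuple P1; P2] ab - << tnth [tuple P1; P2] j >>)) k) <->
  ab \in gap_seq n.
Proof.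
have -> : sum_divisor [tuple P1; P2] ab =
    << (tnth ab 0)%:Z *g P1 >> + << (tnth ab 1)%:Z *g P2 >>.
  rewrite /sum_divisor big_ord_recl big_ord1.
  by congr (<< (tnth ab _)%:Z *g _ >> + << (tnth ab _)%:Z *g _ >>); apply/val_inj.
have gapP := pure_gap_atP (tnth ab 0) (tnth ab 1).
split=> [h|/mem_gap_seq[i [j [r [s [i0 j0 ij hrs abE]]]]]].
  have [|i [j [r [s [i0 j0 ij hrs [aE bE]]]]]] := gapP.1.
    by split; [apply: (h 0)|apply: (h 1)].
  apply/mem_gap_seq; exists i, j, r, s; split=> //; rewrite -aE -bE.
  by apply/eq_from_tnth => -[[|[|k]] hk] //; congr tnth; apply/val_inj.
have [h1 h2] : pure_gap_at (tnth ab 0) (tnth ab 1).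
  by apply/gapP; exists i, j, r, s; rewrite abE.
move=> k; have [->|->] : k = 0 \/ k = 1; [|exact: h1|exact: h2].
by case: k => [[|[|k]] hk] //; [left|right]; apply/val_inj.
Qed.

End FlexTriangle.

(** * Transfer to the concrete function field *)

Section FunctionField.

Local Open Scope quotient_scope.

Context {K : closedFieldType} {m : nat} {X : smooth_plane_curve K m}.
Implicit Types (G H A B : {mpoly K[3]}) (P : curve_point X).
Local Notation F := (curve_form X).
Local Notation cls := (@cls K m X).

Lemma cls_is_zmod_morphism : zmod_morphism cls.
Proof.
move=> G H; rewrite /cls -tofracB; congr tofrac.
exact: (@pi_is_zmod_morphism _ _ _ {ideal_quot (curve_ideal X)} G H).
Qed.

Lemma cls_is_monoid_morphism : monoid_morphism cls.
Proof.
have [pi1 piM] := @pi_is_monoid_morphism _ _ _ {ideal_quot (curve_ideal X)}.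
split=> [|G H]; rewrite /cls; first by rewrite [X in tofrac X]pi1 tofrac1.
by rewrite [X in tofrac X]piM tofracM.
Qed.

HB.instance Definition _ :=
  GRing.isZmodMorphism.Build _ _ cls cls_is_zmod_morphism.
HB.instance Definition _ :=
  GRing.isMonoidMorphism.Build _ _ cls cls_is_monoid_morphism.

Lemma cls_eq0 G : cls G = 0 <-> mdvd F G.
Proof.
have e : (cls G == 0) = (G \in curve_ideal X).
  rewrite -[G in RHS]subr0 Quotient.idealrBE -(rmorph0 cls) /cls.
  by rewrite tofrac_eq.
split=> [/eqP|h]; first by rewrite e => /asboolP.
by apply/eqP; rewrite e; apply/asboolP.
Qed.

End FunctionField.

Section TwoPoints.

Context {K : closedFieldType} {n : nat} (n_gt2 : (2 < n)%N).
Context {X : smooth_plane_curve K (n + 1)}.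
Variables (P1 P2 P3 : curve_point X) (l1 l2 l3 : proj_plane K).
Hypotheses (hl12 : l1 <> l2) (hl23 : l2 <> l3) (hl31 : l3 <> l1).
Hypothesis hl1 : line_cuts_out l1 (<< n%:Z *g P1 >> + << P2 >>).
Hypothesis hl2 : line_cuts_out l2 (<< n%:Z *g P2 >> + << P3 >>).
Hypothesis hl3 : line_cuts_out l3 (<< n%:Z *g P3 >> + << P1 >>).

Local Notation phi := (@cls K (n + 1) X : {rmorphism {mpoly K[3]} -> hom_field X}).

Lemma pure_gaps_seq : pure_gaps [tuple P1; P2] = [set ab | ab \in gap_seq n]%classic.
Proof.
apply/seteqP; split=> ab h.
  exact: (pure_gapP n_gt2 (phi := phi) (@cls_eq0 K _ X) hl12 hl23 hl31 hl1 hl2 hl3 ab).1.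
exact: (pure_gapP n_gt2 (phi := phi) (@cls_eq0 K _ X) hl12 hl23 hl31 hl1 hl2 hl3 ab).2.
Qed.

Lemma pure_gaps_card g : is_genus X g ->
  exists2 N, (pure_gaps [tuple P1; P2] #= `I_N)%card & (3 * N = (g - 1) * g)%N.
Proof.
move=> [gmax gex]; exists (size (gap_seq n)).
  by rewrite pure_gaps_seq; apply/card_eq_seq/gap_seq_uniq.
apply: card_genus n_gt2 _ (size_gap_seq n).
exact: (genus_value n_gt2 (phi := phi) (@cls_eq0 K _ X) hl12 hl23 hl31 hl1 hl2 hl3 gmax gex).
Qed.

Lemma pure_gap_dim i j r s d a b : (1 <= i)%N -> (1 <= j)%N -> (i + j = d)%N ->
  (d <= n - 1)%N -> (r <= n - d - 1)%N -> (s <= n - d)%N ->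
  a = ((i - 1) * n + r + 1)%N -> b = ((j - 1) * n + i + s)%N ->
  has_dim (RRspace (<< a%:Z *g P1 >> + << b%:Z *g P2 >>)) (((d - 1) * (d - 2)) %/ 2 + i) /\
  has_dim (RRspace (<< a%:Z - 1 *g P1 >> + << b%:Z - 1 *g P2 >>))
    (((d - 1) * (d - 2)) %/ 2 + i).
Proof.
exact: (RR_pure_dim n_gt2 (phi := phi) (@cls_eq0 K _ X) hl12 hl23 hl31 hl1 hl2 hl3).
Qed.

End TwoPoints.

Unset Implicit Arguments.
Set Strict Implicit.
Set Printing Implicit Defensive.

Local Open Scope ring_scope.
Local Open Scope classical_set_scope.
Local Open Scope card_scope.

Theorem theorem1p1 (K : closedFieldType) (n : nat) (hn : (3 < n + 1)%N)
    (X : smooth_plane_curve K (n + 1)) (P1 P2 P3 : curve_point X)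
    (l1 l2 l3 : proj_plane K)
    (hl12 : l1 <> l2) (hl23 : l2 <> l3) (hl31 : l3 <> l1)
    (hl1 : line_cuts_out l1 (<< n%:Z *g P1 >> + << P2 >>))
    (hl2 : line_cuts_out l2 (<< n%:Z *g P2 >> + << P3 >>))
    (hl3 : line_cuts_out l3 (<< n%:Z *g P3 >> + << P1 >>))
    (g : nat) (hg : is_genus X g)
    (P Q : curve_point X) (hPQ : (P, Q) \in [:: (P1, P2); (P2, P3); (P3, P1)]) :
  [/\ exists2 N : nat, pure_gaps [tuple P; Q] #= `I_N & (3 * N = (g - 1) * g)%N,
      pure_gaps [tuple P; Q] =
        [set ab | exists i j r s : nat,
           [/\ (1 <= i)%N, (1 <= j)%N, (i + j <= n - 1)%N,
               (r <= n - (i + j) - 1)%N /\ (s <= n - (i + j))%N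
             & ab = [tuple ((i - 1) * n + r + 1)%N; ((j - 1) * n + i + s)%N]]]
    & forall i j r s d a b : nat,
        (1 <= i)%N -> (1 <= j)%N -> (i + j = d)%N -> (d <= n - 1)%N ->
        (r <= n - d - 1)%N -> (s <= n - d)%N ->
        a = ((i - 1) * n + r + 1)%N -> b = ((j - 1) * n + i + s)%N ->
        has_dim (RRspace (<< a%:Z *g P >> + << b%:Z *g Q >>))
          (((d - 1) * (d - 2)) %/ 2 + i) /\
        has_dim (RRspace (<< a%:Z - 1 *g P >> + << b%:Z - 1 *g Q >>))
          (((d - 1) * (d - 2)) %/ 2 + i)].
Proof.
have n_gt2 : (2 < n)%N by rewrite addn1 in hn.
(* The hypotheses are invariant under cyclic permutation, so it suffices to supply the third point
   and the rotated lines. *)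
suff [R [m1 [m2 [m3 [[h12 h23 h31] [h1 h2 h3]]]]]] :
    exists (R : curve_point X) (m1 m2 m3 : proj_plane K),
      [/\ m1 <> m2, m2 <> m3 & m3 <> m1] /\
      [/\ line_cuts_out m1 (<< n%:Z *g P >> + << Q >>),
          line_cuts_out m2 (<< n%:Z *g Q >> + << R >>) &
          line_cuts_out m3 (<< n%:Z *g R >> + << P >>)].
  split.
  - exact: (pure_gaps_card n_gt2 h12 h23 h31 h1 h2 h3 hg).
  - rewrite (pure_gaps_seq n_gt2 h12 h23 h31 h1 h2 h3).
    by apply/seteqP; split=> ab /mem_gap_seq.
  - exact: (pure_gap_dim n_gt2 h12 h23 h31 h1 h2 h3).
move: hPQ; rewrite !in_cons => /or4P[/eqP[-> ->]|/eqP[-> ->]|/eqP[-> ->]|//].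
- by exists P3, l1, l2, l3.
- by exists P1, l2, l3, l1.
- by exists P2, l3, l1, l2.
Qed.
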